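(* Let $n\ge1$, $\alpha\in(0,2]$, $\beta>0$, and let $S_{\alpha,\beta}(\omega)$, $\omega\in\mathbb{R}^n\setminus\{0\}$, be the spectral density of the centered stationary Gaussian field on $\mathbb{R}^n$ with covariance $C_{\alpha,\beta}(\tau)=(1+\Vert\tau\Vert^{\alpha})^{-\beta}$. Then as $\Vert\omega\Vert\to0^+$: if $\alpha\beta<n$, $$S_{\alpha,\beta}(\omega)\sim\frac{\Vert\omega\Vert^{\alpha\beta-n}}{2^{\alpha\beta}\pi^{\frac n2}}\frac{\Gamma\left(\frac{n-\alpha\beta}{2}\right)}{\Gamma\left(\frac{\alpha\beta}{2}\right)};$$ if $\alpha\beta=n$, $$S_{\alpha,\beta}(\omega)\sim\frac{1}{2^{n-1}\pi^{\frac n2}\Gamma\left(\frac n2\right)}\left\{\ln\frac{1}{\Vert\omega\Vert}-\frac{\beta}{n}\left(\psi(\beta)+\gamma\right)+\ln2-\frac12\gamma+\frac12\psi\left(\frac n2\right)\right\};$$ if $\alpha\beta>n$, $$S_{\alpha,\beta}(\omega)\sim\frac{1}{2^{n-1}\pi^{\frac n2}\Gamma\left(\frac n2\right)}\frac{\Gamma\left(\frac n\alpha\right)\Gamma\left(\beta-\frac n\alpha\right)}{\alpha\Gamma(\beta)}.$$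
   Context: $\Vert\cdot\Vert$ is the Euclidean norm, $\psi=\Gamma'/\Gamma$, $\gamma$ is the Euler constant, and $f\sim g$ means $f/g\to1$. The spectral density of a stationary field with covariance $C(t)$ is the Fourier transform $S(\omega)=\frac{1}{(2\pi)^n}\int_{\mathbb{R}^n}e^{-i\omega\cdot t}C(t)\,d^nt$ if this integral converges, and otherwise the Fourier transform (same normalization) of $C$ as a generalized function on Schwartz space; alternatively, it is the function $S$ satisfying $C(t)=\int_{\mathbb{R}^n}e^{i\omega\cdot t}S(\omega)\,d^n\omega$. *)

(* Defs.v *)
From HB Require Import structures.
From mathcomp Require Import all_boot all_order all_algebra.
From mathcomp Require Import complex.
From mathcomp Require Import all_classical all_reals all_analysis.

Set Implicit Arguments.
Unset Strict Implicit.
Unset Printing Implicit Defensive.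

Import Order.TTheory GRing.Theory Num.Theory.
Import numFieldNormedType.Exports.

Local Open Scope classical_set_scope.
Local Open Scope ring_scope.
Local Open Scope complex_scope.

Section LebesgueMeasureRn.
Context {R : realType}.

Definition tcons (n : nat) (p : measurableTypeR R * n.-tuple R) : n.+1.-tuple R :=
  [the n.+1.-tuple R of p.1 :: p.2].

Lemma measurable_tcons (n : nat) : measurable_fun [set: _] (@tcons n).
Proof. exact: (measurable_cons measurable_fst measurable_snd). Qed.

Section Step.
Context {n : nat} (m : {sigma_finite_measure set (n.-tuple R) -> \bar R}).

Definition lebesgue_step : set (n.+1.-tuple R) -> \bar R :=
  pushforward (@lebesgue_measure R \x m)%E (@tcons n).

Lemma lebesgue_step0 : lebesgue_step set0 = 0%E.
Proof. by rewrite /lebesgue_step /pushforward preimage_set0 measure0. Qed.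

Lemma lebesgue_step_ge0 A : (0 <= lebesgue_step A)%E.
Proof. by rewrite /lebesgue_step /pushforward measure_ge0. Qed.

Lemma lebesgue_step_sigma_additive : semi_sigma_additive lebesgue_step.
Proof.
have mt := @measurable_tcons n.
exact: (@measure_semi_sigma_additive _ _ _ (pushforward _ (@tcons n))).
Qed.

HB.instance Definition _ := isMeasure.Build _ _ _ lebesgue_step
  lebesgue_step0 lebesgue_step_ge0 lebesgue_step_sigma_additive.

Lemma sigma_finite_lebesgue_step : sigma_finite [set: _] lebesgue_step.
Proof.
have /sigma_finiteP[F [TF ndF Foo]] :=
  sigma_finiteT (@lebesgue_measure R : {sigma_finite_measure set _ -> \bar R}).
have /sigma_finiteP[G [TG ndG Goo]] := sigma_finiteT m.
have TFG : [set: measurableTypeR R * n.-tuple R] = \bigcup_i (F i `*` G i).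
  apply/esym; rewrite -subTset => -[x y] _.
  have [i _ Fx] : (\bigcup_i F i) x by rewrite -TF.
  have [j _ Gy] : (\bigcup_i G i) y by rewrite -TG.
  exists (maxn i j) => //; split => /=.
  - by move: x Fx; exact/subsetPset/ndF/leq_maxl.
  - by move: y Gy; exact/subsetPset/ndG/leq_maxr.
pose g (x : n.+1.-tuple R) : measurableTypeR R * n.-tuple R :=
  (thead x, [tuple of behead x]).
have gK : cancel g (@tcons n).
  by move=> x; apply: val_inj => /=; case/tupleP: x => a x /=; rewrite theadE.
have fK : cancel (@tcons n) g.
  move=> [a x]; rewrite /g /tcons/=; congr pair; apply: val_inj => //=.
have mg : measurable_fun [set: _] g.
  apply/measurable_fun_pairP; split.
    exact: (@measurable_tnth _ R n.+1 ord0).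
  exact: measurable_behead.
exists (fun i => g @^-1` (F i `*` G i)).
  by rewrite -preimage_bigcup -TFG preimage_setT.
move=> i; have [mF Fi] := Foo i; have [mG Gi] := Goo i; split.
  by rewrite -[X in measurable X]setTI; apply: mg => //; exact: measurableX.
rewrite /lebesgue_step /pushforward -comp_preimage.
rewrite (_ : g \o _ = id) ?preimage_id; last by apply/funext => p /=; rewrite fK.
by rewrite product_measure1E// lte_mul_pinfty// ge0_fin_numE.
Qed.

HB.instance Definition _ :=
  Measure_isSigmaFinite.Build _ _ _ lebesgue_step sigma_finite_lebesgue_step.

End Step.

(* Lebesgue measure on [R^n]; the points are tuples because the library puts
   the product sigma-algebra on [n.-tuple R], not on ['rV[R]_n]. *)
Fixpoint lebesgue_Rn (n : nat) : {sigma_finite_measure set (n.-tuple R) -> \bar R} :=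
  match n with
  | 0 => \d_([tuple] : 0.-tuple R)
  | n'.+1 => lebesgue_step (lebesgue_Rn n')
  end.

End LebesgueMeasureRn.

Section SpecialFunctions.
Context {R : realType}.

(* Euler's integral: only meaningful for [0 < x]. *)
Definition Gamma (x : R) : R :=
  \int[lebesgue_measure]_(t in `]0, +oo[) (t `^ (x - 1) * expR (- t)).

Definition digamma (x : R) : R := derive1 Gamma x / Gamma x.

(* [series harmonic k] is [1 + 1/2 + ... + 1/k]. *)
Definition euler_gamma : R :=
  limn (fun k : nat => series (@harmonic R) k - ln k%:R).

End SpecialFunctions.

Section Rn.
Context {R : realType} {n : nat}.
Implicit Types (t w x : 'rV[R]_n) (f : 'rV[R]_n -> R).

Definition dotv x t : R := \sum_(i < n) x 0 i * t 0 i.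

(* The library norm [`|x|] on ['rV[R]_n] is the sup norm. *)
Definition enorm x : R := Num.sqrt (dotv x x).

Definition rvec (u : n.-tuple R) : 'rV[R]_n := \row_(i < n) tnth u i.

Definition integrable_Rn f : Prop :=
  (@lebesgue_Rn R n).-integrable [set: _] (fun u => (f (rvec u))%:E).

Definition integral_Rn f : R := \int[@lebesgue_Rn R n]_u f (rvec u).

Implicit Types g : 'rV[R]_n -> R[i].

Definition cintegrable_Rn g : Prop :=
  integrable_Rn (fun x => complex.Re (g x)) /\
  integrable_Rn (fun x => complex.Im (g x)).

Definition cintegral_Rn g : R[i] :=
  integral_Rn (fun x => complex.Re (g x)) +i*
  integral_Rn (fun x => complex.Im (g x)).

(* [expi a] is [e^(i a)]. *)
Definition expi (a : R) : R[i] := cos a +i* sin a.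

Definition fourier g w : R[i] :=
  (((2 * pi) ^+ n)^-1)%:C * cintegral_Rn (fun t => expi (- dotv w t) * g t).

Definition iter_partial (s : seq 'I_n) f : 'rV[R]_n -> R :=
  foldr (fun i (h : 'rV[R]_n -> R) x => 'D_(delta_mx 0 i) h x) f s.

(* Iterated partial derivatives of every order exist and decay faster than any
   power; boundedness of all of them forces their continuity. *)
Definition schwartz f : Prop :=
  (forall (s : seq 'I_n) i x, derivable (iter_partial s f) x (delta_mx 0 i)) /\
  (forall (s : seq 'I_n) (k : nat), exists M : R,
     forall x, enorm x ^+ k * `|iter_partial s f x| <= M).

Definition cschwartz g : Prop :=
  schwartz (fun x => complex.Re (g x)) /\ schwartz (fun x => complex.Im (g x)).

Definition continuous_off0 f : Prop :=
  forall w, w != 0 -> {for w, continuous f}.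

(* [S] is the spectral density attached to the covariance [C]; its value at the
   origin is irrelevant.  The last two characterizations determine [S] only
   almost everywhere, and continuity off the origin singles out the
   representative whose pointwise values are meant.
   - [SD_integral]: [S] is the convergent (Lebesgue) Fourier integral of [C];
   - [SD_generalized]: otherwise, [S] is the Fourier transform of [C] as a
     generalized function, i.e. [<S, phi> = <C, F phi>] for Schwartz [phi];
   - [SD_inversion]: [C t] is the integral of [e^(i w.t) S w]. *)
Variant spectral_density (C S : 'rV[R]_n -> R) : Prop :=
| SD_integral of
    integrable_Rn C &
    (forall w, w != 0 -> (S w)%:C = fourier (fun t => (C t)%:C) w)
| SD_generalized of
    ~ integrable_Rn C &
    continuous_off0 S &
    (forall phi, cschwartz phi ->
       cintegrable_Rn (fun w => (S w)%:C * phi w) /\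
       cintegral_Rn (fun w => (S w)%:C * phi w) =
       cintegral_Rn (fun t => (C t)%:C * fourier phi t))
| SD_inversion of
    integrable_Rn S &
    continuous_off0 S &
    (forall t, (C t)%:C = cintegral_Rn (fun w => expi (dotv w t) * (S w)%:C)).

Definition cauchy_covariance (alpha beta : R) (tau : 'rV[R]_n) : R :=
  (1 + enorm tau `^ alpha) `^ (- beta).

(* [f w ~ h w] as [enorm w] tends to [0+]; the topology of ['rV[R]_n] is the
   Euclidean one. *)
Definition asymptotic_at0 (f h : 'rV[R]_n -> R) : Prop :=
  f w / h w @[w --> (0 : 'rV[R]_n)^'] --> (1 : R).

End Rn.

Section GaussianField.
Context d (T : measurableType d) {R : realType} (P : probability T R) {n : nat}.

(* The Dirac mass is the variance-zero case, which [normal_prob] does not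
   cover ([normal_prob 0 0] is the uniform law on [[0, 1]]). *)
Definition centered_gaussian (Y : T -> R) : Prop :=
  (exists2 s : R, 0 < s & forall B : set R, measurable B ->
     P (Y @^-1` B) = normal_prob 0 s B) \/
  (forall B : set R, measurable B -> P (Y @^-1` B) = \d_(0 : R) B).

Definition centered_stationary_gaussian_field
    (X : 'rV[R]_n -> {RV P >-> R}) (C : 'rV[R]_n -> R) : Prop :=
  [/\ forall t, expectation P (X t) = 0%E,
      forall s t, covariance P (X s) (X t) = (C (s - t))%:E &
      forall (k : nat) (a : 'I_k -> R) (t : 'I_k -> 'rV[R]_n),
        centered_gaussian (fun w => \sum_(i < k) a i * X (t i) w)].

Definition field_spectral_density
    (X : 'rV[R]_n -> {RV P >-> R}) (S : 'rV[R]_n -> R) : Prop :=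
  spectral_density (fun t => fine (covariance P (X t) (X 0))) S.

End GaussianField.

(* Main.v *)
(* Write C(t) = F(|t|^2) with F(r) = (1 + r^(alpha/2))^(-beta).  As
   alpha/2 <= 1, F is completely monotone, i.e. a limit of positive
   combinations of the functions r |-> exp(-s r).  Whichever way the spectral
   density is attached to C, a Gaussian regularization gives, for w <> 0,
     (2 pi)^n S(w) = lim_(e -> 0) J(e, w),
     J(e, w) = \int F(|u|^2) cos(w.u) exp(-e |u|^2) du.
   For F(r) = exp(-s r) the integral J(e, w) is the explicit kernel
   (pi/(s+e))^(n/2) exp(-|w|^2/(4(s+e))), so that every inequality between such
   kernels which is uniform in s >= 0 passes to J for a general F.  In this way
   S(w) is squeezed between values of J at e = c |w|^2, and it remains to find
   the asymptotics of these.  If alpha beta > n, J(e, 0) tends to the integral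
   of C.  If alpha beta = n, F(r) is compared with r^(-n/2) (1 - exp(-r)), for
   which J(e, 0) is a multiple of ln((1+e)/e).  If alpha beta < n, rescaling
   by |w| and dominated convergence replace C by |t|^(-alpha beta), for which J
   is a mixture of the kernels above. *)

Require Import Defs.
From HB Require Import structures.
From mathcomp Require Import all_boot all_order all_algebra.
From mathcomp Require Import complex.
From mathcomp Require Import all_classical all_reals all_analysis.
From mathcomp Require Import measurable_realfun.
From mathcomp Require Import ring lra.

Set Implicit Arguments.
Unset Strict Implicit.
Unset Printing Implicit Defensive.

Import Order.TTheory GRing.Theory Num.Theory.
Import numFieldNormedType.Exports.

Local Open Scope classical_set_scope.
Local Open Scope ring_scope.

(** * Completely monotone and Bernstein functions *)

(** For alpha beta <= n the covariance is not integrable, and S is within reach only through J(e, w)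
    as e tends to 0. Hence pointwise bounds on S are derived from inequalities at fixed e > 0, where
    every integral converges absolutely. The representing measure of Bernstein's theorem never
    appears: membership in [cmono] is built by explicit limits with a uniform bound, which is
    exactly what dominated convergence asks for. For the Cauchy profile these limits are a
    discretization of \int (1 - exp(-s r)) s^(-a-1) ds for r^a and Riemann sums for ln(1 + r^a);
    then (1 + r^a)^(-b) = exp(-b ln(1 + r^a)). Two Tauberian arguments are needed. If J(c r^2, 0) /
    N(r) has the same limit for every c > 0 (alpha beta >= n), S(w) can be compared with J at
    frequency 0. If alpha beta < n that limit depends on c, so the frequency has to stay near w: the
    ratio of squared norms tends to 1 and c to 0, but only after r has tended to 0. *)

Section CompleteMonotonicity.
Context {R : realType}.
Implicit Types (F G psi : R -> R).

(* Bernstein's theorem makes this class that of the bounded completely monotone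
   functions; all that is needed here is that identities and inequalities
   checked on exponentials extend to it. *)
Inductive cmono : (R -> R) -> Prop :=
| cmono_exp s of 0 <= s : cmono (fun r => expR (- (s * r)))
| cmono_add F G of cmono F & cmono G : cmono (fun r => F r + G r)
| cmono_scale c F of 0 <= c & cmono F : cmono (fun r => c * F r)
| cmono_lim (F_ : nat -> R -> R) F M of (forall k, cmono (F_ k)) &
    (forall k r, 0 <= r -> F_ k r <= M) &
    (forall r, 0 <= r -> F_ k r @[k --> \oo] --> F r) : cmono F.

Lemma cmono_ge0 F : cmono F -> forall r, 0 <= r -> 0 <= F r.
Proof.
elim=> [s s0 r r0|? ? _ h _ k r r0|c ? c0 _ h r r0|F_ ? M _ h _ k r r0].
- exact: expR_ge0.
- by rewrite addr_ge0 ?h ?k.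
- by rewrite mulr_ge0 ?h.
- by apply: (cvgr_to_ge (k r r0)); apply: nearW => i; exact: h.
Qed.

Lemma cmono_bounded F : cmono F ->
  exists M, forall r, 0 <= r -> F r <= M.
Proof.
elim=> [s s0|? ? _ [M h] _ [N k]|c ? c0 _ [M h]|F_ ? M _ _ h k].
- by exists 1 => r r0; rewrite expR_le1 oppr_le0 mulr_ge0.
- by exists (M + N) => r r0; rewrite lerD ?h ?k.
- by exists (c * M) => r r0; rewrite ler_wpM2l ?h.
- exists M => r r0.
  by apply: (cvgr_to_le (k r r0)); apply: nearW => i; exact: h.
Qed.

(** A constant sequence fed to [cmono_lim], whose hypotheses only concern r >= 0; so membership
    depends only on the values on the half-line. *)
Lemma cmono_eq F G : (forall r, 0 <= r -> F r = G r) -> cmono F -> cmono G.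
Proof.
move=> FG cF; have [M FM] := cmono_bounded cF.
apply: (@cmono_lim (fun=> F) G M) => // r r0.
by rewrite FG//; exact: cvg_cst.
Qed.

Lemma cmono_cst c : 0 <= c -> cmono (fun=> c).
Proof.
move=> c0; apply: (cmono_eq _ (cmono_scale c0 (cmono_exp (lexx 0)))) => r _.
by rewrite mul0r oppr0 expR0 mulr1.
Qed.

(** Induction on both factors: a product of exponentials is an exponential, and the other
    constructors survive multiplication by a bounded nonnegative function. *)
Lemma cmono_mul F G : cmono F -> cmono G -> cmono (fun r => F r * G r).
Proof.
move=> cF cG; elim: cF => {F}[s s0|F1 F2 _ h _ k|c F c0 _ h|F_ F M cF_ h FM cvF].
- elim: cG => {G}[t t0|G1 G2 _ h _ k|c G c0 _ h|G_ G M cG_ h GM cvG].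
  + apply: (cmono_eq _ (cmono_exp (addr_ge0 s0 t0))) => r _.
    by rewrite -expRD mulrDl opprD.
  + by apply: (cmono_eq _ (cmono_add h k)) => r _; rewrite mulrDr.
  + by apply: (cmono_eq _ (cmono_scale c0 h)) => r _; rewrite mulrCA.
  + apply: (cmono_lim h (M := M)) => [k r r0|r r0].
      apply: le_trans (GM k r r0); rewrite ler_piMl ?(cmono_ge0 (cG_ k))//.
      by rewrite expR_le1 oppr_le0 mulr_ge0.
    by apply: cvgMl_tmp; exact: cvG.
- by apply: (cmono_eq _ (cmono_add h k)) => r _; rewrite mulrDl.
- by apply: (cmono_eq _ (cmono_scale c0 h)) => r _; rewrite mulrA.
- have [N GN] := cmono_bounded cG.
  apply: (cmono_lim h (M := M * N)) => [k r r0|r r0].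
    by rewrite ler_pM ?(cmono_ge0 (cF_ k)) ?(cmono_ge0 cG) ?FM ?GN.
  by apply: cvgMr_tmp; exact: cvF.
Qed.

Lemma cmono_exprn F k : cmono F -> cmono (fun r => F r ^+ k).
Proof.
move=> cF; elim: k => [|k ih]; first by apply: cmono_eq (cmono_cst ler01).
by apply: cmono_eq (cmono_mul cF ih) => r _; rewrite exprS.
Qed.

Lemma cmono_sum (F_ : nat -> R -> R) k : (forall i, cmono (F_ i)) ->
  cmono (fun r => \sum_(0 <= i < k) F_ i r).
Proof.
move=> cF; elim: k => [|k ih].
  by apply: cmono_eq (cmono_cst (lexx 0)) => r _; rewrite big_geq.
by apply: cmono_eq (cmono_add ih (cF k)) => r _; rewrite big_nat_recr.
Qed.

(** The Taylor sums have nonnegative coefficients, so they stay in the class and increase to their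
    limit; this gives the uniform bound exp M required by [cmono_lim]. *)
Lemma cmono_expR F : cmono F -> cmono (fun r => expR (F r)).
Proof.
move=> cF; have [M FM] := cmono_bounded cF.
pose T (x : R) := [sequence i`!%:R^-1 * x ^+ i]_i.
have cvT x : series (T x) @ \oo --> expR x.
  by rewrite expRE; have := is_cvg_series_exp_coeff x; rewrite exp_coeffE.
apply: (@cmono_lim (fun k r => \sum_(0 <= i < k) T (F r) i) _ (expR M)).
- move=> k; apply: cmono_sum => i.
  by apply: cmono_scale (cmono_exprn i cF).
- move=> k r r0; apply: (@le_trans _ _ (expR (F r))); last by rewrite ler_expR FM.
  have F0 := cmono_ge0 cF r0.
  apply: (cvgr_to_ge (cvT (F r))); near=> m.
  have km : (k <= m)%N by near: m; exact: nbhs_infty_ge.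
  rewrite /series/= [leRHS](big_cat_nat _ km)//= lerDl sumr_ge0// => i _.
  by rewrite mulr_ge0// exprn_ge0.
- by move=> r r0; exact: cvT.
Unshelve. all: by end_near. Qed.

(* Bernstein functions, through Schoenberg's characterization. *)
Definition bernst psi := (forall r, 0 <= r -> 0 <= psi r) /\
  forall c, 0 <= c -> cmono (fun r => expR (- (c * psi r))).

Lemma bernst_eq F G : (forall r, 0 <= r -> F r = G r) -> bernst F -> bernst G.
Proof.
move=> FG [F0 cF]; split=> [r r0|c c0]; first by rewrite -FG ?F0.
by apply: cmono_eq (cF c c0) => r r0; rewrite FG.
Qed.

(** exp(-c (M - F)) = exp(-c M) exp(c F), and exponentials of members of [cmono] are members. *)
Lemma bernst_sub M F : (forall r, 0 <= r -> F r <= M) -> cmono F ->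
  bernst (fun r => M - F r).
Proof.
move=> FM cF; split=> [r r0|c c0]; first by rewrite subr_ge0 FM.
apply: cmono_eq (cmono_scale (expR_ge0 (- (c * M))) (cmono_expR (cmono_scale c0 cF))).
by move=> r _; rewrite -expRD mulrBr opprB addrC.
Qed.

Lemma bernst_add F G : bernst F -> bernst G -> bernst (fun r => F r + G r).
Proof.
move=> [F0 cF] [G0 cG]; split=> [r r0|c c0]; first by rewrite addr_ge0 ?F0 ?G0.
by apply: cmono_eq (cmono_mul (cF c c0) (cG c c0)) => r _; rewrite -expRD mulrDr opprD.
Qed.

Lemma bernst_scale a F : 0 <= a -> bernst F -> bernst (fun r => a * F r).
Proof.
move=> a0 [F0 cF]; split=> [r r0|c c0]; first by rewrite mulr_ge0 ?F0.
by apply: cmono_eq (cF _ (mulr_ge0 c0 a0)) => r _; rewrite mulrA.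
Qed.

Lemma bernst_sum (F_ : nat -> R -> R) k : (forall i, bernst (F_ i)) ->
  bernst (fun r => \sum_(0 <= i < k) F_ i r).
Proof.
move=> bF; elim: k => [|k ih].
  apply: (@bernst_eq (fun r => 0 - 0)) => [r _|]; first by rewrite big_geq ?subr0.
  by apply: bernst_sub => //; exact: cmono_cst.
by apply: bernst_eq (bernst_add ih (bF k)) => r _; rewrite big_nat_recr.
Qed.

Lemma bernst_lim (F_ : nat -> R -> R) F : (forall k, bernst (F_ k)) ->
  (forall r, 0 <= r -> F_ k r @[k --> \oo] --> F r) -> bernst F.
Proof.
move=> bF cvF; split=> [r r0|c c0].
  by apply: (cvgr_to_ge (cvF r r0)); apply: nearW => i; have [+ _] := bF i; exact.
apply: (@cmono_lim (fun k r => expR (- (c * F_ k r))) _ 1).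
- by move=> k; have [_] := bF k; exact.
- by move=> k r r0; have [+ _] := bF k => /(_ r r0) ?; rewrite expR_le1 oppr_le0 mulr_ge0.
- move=> r r0; apply: (cvg_comp _ expR); last exact: continuous_expR.
  by apply: cvgN; apply: cvgMl_tmp; exact: cvF.
Qed.

Lemma bernst_id : bernst id.
Proof. by split=> // c c0; exact: cmono_exp. Qed.

Lemma bernst_1mexp s : 0 <= s -> bernst (fun r => 1 - expR (- (s * r))).
Proof.
move=> s0; apply: bernst_sub; last exact: cmono_exp.
by move=> r r0; rewrite expR_le1 oppr_le0 mulr_ge0.
Qed.
End CompleteMonotonicity.

(** * Bernstein functions comparable to a power r^a, 0 < a < 1 *)

Section BernsteinPower.
Context {R : realType}.
Variables (a h : R).
Hypotheses (a0 : 0 < a) (a1 : a < 1) (h0 : 0 < h).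

(** Substituting exp(h x) for s in \int_0^oo (1 - exp(-s r)) s^(-a-1) ds, a multiple of r^a, turns
    the integrand into h [T r x]. [Phi] is the sum of [T r] over all integers, which [u] folds into
    a series by pairing -(i+1) with i. The sum converges at -oo because 1 - exp(-z) <= z and a < 1,
    at +oo because a > 0. *)
Let T (r x : R) := (1 - expR (- (expR (h * x) * r))) * expR (- (a * h * x)).
Let u (r : R) (i : nat) := T r (- i.+1%:R) + T r i%:R.
Let Phi (r : R) := limn (series (u r)).

Let ah0 : 0 < a * h. Proof. exact: mulr_gt0. Qed.

Let ah1 : 0 < (1 - a) * h. Proof. by rewrite mulr_gt0 ?subr_gt0. Qed.

Let T_ge0 r x : 0 <= r -> 0 <= T r x.
Proof.
move=> r0; rewrite mulr_ge0 ?expR_ge0// subr_ge0 expR_le1 oppr_le0.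
by rewrite mulr_ge0 ?expR_ge0.
Qed.

Let T_le1 r i : 0 <= r -> T r i%:R <= geometric 1 (expR (- (a * h))) i.
Proof.
move=> r0; rewrite /geometric/= mul1r -expRM_natl mulrN (mulrC _ (a * h)).
by rewrite ler_piMl ?expR_ge0// lerBlDr lerDl expR_ge0.
Qed.

Let T_ler r i : 0 <= r ->
  T r (- i%:R) <= geometric r (expR (- ((1 - a) * h))) i.
Proof.
move=> r0; rewrite /geometric/= -expRM_natl.
apply: (@le_trans _ _ (expR (h * - i%:R) * r * expR (- (a * h * - i%:R)))).
  rewrite ler_wpM2r ?expR_ge0// lerBlDr.
  by rewrite -lerBlDl; apply: le_trans (expR_ge1Dx _); rewrite lexx.
by rewrite mulrAC -expRD mulrC ler_wpM2l// ler_expR; nra.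
Qed.

Let z1 : `|expR (- (a * h))| < 1.
Proof. by rewrite ger0_norm ?expR_ge0// expR_lt1 oppr_lt0. Qed.

Let z2 : `|expR (- ((1 - a) * h))| < 1.
Proof. by rewrite ger0_norm ?expR_ge0// expR_lt1 oppr_lt0. Qed.

Let cvT1 r : 0 <= r -> T r k%:R @[k --> \oo] --> (0 : R).
Proof.
move=> r0; apply: (squeeze_cvgr _ (cvg_cst 0) (cvg_geometric 1 z1)).
by apply: nearW => k; rewrite T_ge0//= T_le1.
Qed.

Let cvT2 r : 0 <= r -> T r (- k%:R) @[k --> \oo] --> (0 : R).
Proof.
move=> r0; apply: (squeeze_cvgr _ (cvg_cst 0) (cvg_geometric r z2)).
by apply: nearW => k; rewrite T_ge0//= T_ler.
Qed.

Let cvu r : 0 <= r -> cvgn (series (u r)).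
Proof.
move=> r0; have := is_cvg_seriesD (is_cvg_geometric_series (a := r) z2)
  (is_cvg_geometric_series (a := 1) z1).
apply: series_le_cvg => i; first by rewrite addr_ge0 ?T_ge0.
  by rewrite addr_ge0// geometric_ge0 ?expR_ge0.
apply: lerD; last exact: T_le1.
apply: (le_trans (T_ler i.+1 r0)).
rewrite /geometric/= ler_wpM2l// ler_wiXn2l ?expR_ge0//.
by rewrite expR_le1 oppr_le0 ltW.
Qed.

(** Replacing r by exp(h) r shifts the index by one, up to the factor exp(a h). The symmetric
    partial sums then differ by the two boundary terms at N and -N, which vanish in the limit. So
    [Phi] is exactly homogeneous along powers of exp(h). *)
Let Phi_shift r : 0 <= r -> Phi (expR h * r) = expR (a * h) * Phi r.
Proof.
move=> r0; have er0 : 0 <= expR h * r by rewrite mulr_ge0 ?expR_ge0.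
have TE x : T (expR h * r) x = expR (a * h) * T r (x + 1).
  have e1 : expR (h * x) * (expR h * r) = expR (h * (x + 1)) * r.
    by rewrite mulrA -expRD; congr (expR _ * _); ring.
  have e2 : expR (- (a * h * x)) = expR (a * h) * expR (- (a * h * (x + 1))).
    by rewrite -expRD; congr expR; ring.
  by rewrite /T e1 e2 mulrCA.
have SE N : series (u (expR h * r)) N =
    expR (a * h) * (series (u r) N + (T r N%:R - T r (- N%:R))).
  elim: N => [|N ih].
    by rewrite /series/= !big_geq// oppr0 subrr addr0 mulr0.
  rewrite !seriesSr ih /u !TE.
  have -> : - N.+1%:R + 1 = - N%:R :> R by rewrite -natr1; ring.
  by rewrite -natr1; ring.
apply/cvg_lim => //.
rewrite (_ : series _ = fun N => expR (a * h) * (series (u r) N + (T r N%:R - T r (- N%:R)))); last exact/funext.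
apply: cvgMl_tmp; rewrite -[Phi r]addr0; apply: cvgD; first exact: cvu.
by rewrite -[0](subrr 0); apply: cvgB; [exact: cvT1|exact: cvT2].
Qed.

Let Phi_nd r s : 0 <= r -> r <= s -> Phi r <= Phi s.
Proof.
move=> r0 rs; apply: lim_series_le; [exact: cvu|exact/cvu/(le_trans r0)|].
move=> i; rewrite lerD// ler_wpM2r ?expR_ge0// lerB// ler_expR lerN2 ler_wpM2l//; exact: expR_ge0.
Qed.

Let Phi0 : Phi 0 = 0.
Proof.
apply/cvg_lim => //; rewrite (_ : series _ = cst 0); first exact: cvg_cst.
apply/funext => N; rewrite /series/= big1// => i _.
by rewrite /u /T !mulr0 oppr0 expR0 subrr !mul0r addr0.
Qed.

Let Phi1_gt0 : 0 < Phi 1.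
Proof.
apply: (@lt_le_trans _ _ (u 1 0)).
  rewrite ltr_wpDl ?T_ge0// /T !mulr0 oppr0 !expR0 !mulr1 subr_gt0 expR_lt1.
  by rewrite oppr_lt0.
apply: (cvgr_to_ge (cvu ler01)); near=> N.
have N0 : (0 < N)%N by near: N; exact: nbhs_infty_gt.
rewrite /series/= big_ltn// lerDl sumr_ge0// => i _.
by rewrite addr_ge0 ?T_ge0.
Unshelve. all: by end_near. Qed.

Let Phi_nat m r : 0 <= r -> Phi (expR (h * m%:R) * r) = expR (a * h * m%:R) * Phi r.
Proof.
move=> r0; elim: m => [|m ih]; first by rewrite !mulr0 !expR0 !mul1r.
have -> : expR (h * m.+1%:R) * r = expR h * (expR (h * m%:R) * r).
  by rewrite mulrA -expRD -natr1; congr (expR _ * _); ring.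
rewrite Phi_shift; last by rewrite mulr_ge0 ?expR_ge0.
rewrite ih mulrA -expRD -natr1.
by congr (expR _ * _); ring.
Qed.

Let Phi_int (k : int) : Phi (expR (h * k%:~R)) = expR (a * h * k%:~R) * Phi 1.
Proof.
case: (intP k) => [|m|m].
- by rewrite !mulr0 !expR0 mul1r.
- by have := @Phi_nat m.+1 1 ler01; rewrite mulr1.
- have -> : (- m.+1%:Z)%:~R = - m.+1%:R :> R by rewrite rmorphN.
  have := @Phi_nat m.+1 _ (expR_ge0 (h * - m.+1%:R)).
  rewrite -expRD -mulrDr subrr mulr0 expR0 => ->.
  by rewrite mulrA -expRD -mulrDr addNr mulr0 expR0 mul1r.
Qed.

(** Normalized by [Phi 1], the sum equals r^a at the points exp(h k), k an integer. A general r lies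
    between two consecutive such points (k is the floor of ln r / h), and monotonicity costs a
    factor exp(a h) on either side. *)
Lemma bernst_powR_approx : exists2 psi : R -> R, bernst psi &
  forall r, 0 <= r -> expR (- (a * h)) * r `^ a <= psi r <= expR (a * h) * r `^ a.
Proof.
exists (fun r => (Phi 1)^-1 * Phi r).
  apply: bernst_scale; first by rewrite invr_ge0 ltW.
  apply: (@bernst_lim _ (fun N r => series (u r) N)); last by move=> r /cvu.
  move=> N; apply: bernst_sum => i.
  by apply: bernst_add; (apply: bernst_eq (bernst_scale (expR_ge0 _) (bernst_1mexp (expR_ge0 _))) => r r0; rewrite mulrC).
move=> r; rewrite le_eqVlt => /predU1P[<-|r0].
  by rewrite powR0 ?gt_eqF// Phi0 !mulr0 lexx.
pose k := Num.floor (ln r / h).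
have /andP[k1 k2] := floor_itv (ln r / h); rewrite -/k in k1 k2.
have kr : h * k%:~R <= ln r by rewrite mulrC -ler_pdivlMr.
have rk : ln r <= h * (k + 1)%:~R by rewrite mulrC -ler_pdivrMr// ltW.
have rE : r `^ a = expR (a * ln r) by rewrite /powR gt_eqF.
rewrite rE -!expRD (mulrC (Phi 1)^-1) ler_pdivlMr// ler_pdivrMr//.
have le_r : expR (h * k%:~R) <= r by rewrite -[leRHS](lnK r0) ler_expR.
have ge_r : r <= expR (h * (k + 1)%:~R) by rewrite -[leLHS](lnK r0) ler_expR.
apply/andP; split.
  apply: le_trans (Phi_nd _ le_r); last exact: expR_ge0.
  rewrite Phi_int ler_wpM2r ?(ltW Phi1_gt0)// ler_expR.
  by rewrite intrD in rk; have := ler_wpM2l (ltW a0) rk; lra.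
apply: le_trans (Phi_nd (ltW r0) ge_r) _.
rewrite Phi_int ler_wpM2r ?(ltW Phi1_gt0)// ler_expR.
by rewrite intrD; have := ler_wpM2l (ltW a0) kr; lra.
Qed.
End BernsteinPower.

(** * Complete monotonicity of the Cauchy profile *)

Section CauchyCompleteMonotonicity.
Context {R : realType}.
Implicit Types (F psi : R -> R).

(** For a < 1, the two-sided approximation with step h = 1/(k+1) pinches r^a as k tends to
    infinity. *)
Lemma bernst_powR (a : R) : 0 < a <= 1 -> bernst (fun r : R => r `^ a).
Proof.
move=> /andP[a0]; rewrite le_eqVlt => /predU1P[->|a1].
  by apply: bernst_eq bernst_id => r r0; rewrite powRr1.
have hk k : 0 < (k.+1%:R : R)^-1 by rewrite invr_gt0.
have H k := bernst_powR_approx a0 a1 (hk k).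
pose f k := sval (cid2 (H k)).
have Bf k : bernst (f k) by rewrite /f; case: cid2.
have If k r : 0 <= r -> expR (- (a * k.+1%:R^-1)) * r `^ a <= f k r <= expR (a * k.+1%:R^-1) * r `^ a.
  by rewrite /f; case: cid2 => /= x _; exact.
apply: (bernst_lim Bf) => r r0.
have cv0 : a * (k.+1%:R : R)^-1 @[k --> \oo] --> (0 : R).
  by rewrite -(mulr0 a); apply: cvgMl_tmp; exact: cvg_harmonic.
have cvN0 : - (a * (k.+1%:R : R)^-1) @[k --> \oo] --> (0 : R).
  by rewrite -[X in _ --> X]oppr0; exact: cvgN.
apply: (@squeeze_cvgr _ _ _ _ _ _ _ _ (r `^ a)).
- by apply: nearW => k; exact: If.
- rewrite -[X in _ --> X]mul1r; apply: cvgMr_tmp.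
  by have := cvg_comp _ _ cvN0 (@continuous_expR R 0); rewrite expR0.
- rewrite -[X in _ --> X]mul1r; apply: cvgMr_tmp.
  by have := cvg_comp _ _ cv0 (@continuous_expR R 0); rewrite expR0.
Qed.

(* Riemann sums of [\int_0^oo exp (- t (1 + u psi)) dt] are geometric. *)
Lemma cmono_inv1D psi (c : R) : 0 <= c -> bernst psi ->
  cmono (fun r => (1 + c * psi r)^-1).
Proof.
move=> c0 [psi0 cpsi].
pose h k : R := k.+1%:R^-1.
have h0 k : 0 < h k by rewrite invr_gt0.
pose q k r := expR (- (h k * (1 + c * psi r))).
have z1 r : 0 <= r -> 1 <= 1 + c * psi r.
  by move=> r0; rewrite lerDl mulr_ge0 ?psi0.
have q1 k r : 0 <= r -> 0 < q k r < 1.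
  move=> r0; rewrite expR_gt0 expR_lt1 oppr_lt0 mulr_gt0//.
  by apply: lt_le_trans (z1 r r0).
have qN k r : 0 <= r -> `|q k r| < 1.
  by move=> r0; have /andP[q0 ?] := q1 k r r0; rewrite gtr0_norm.
have cq k : cmono (q k).
  apply: cmono_eq (cmono_scale (expR_ge0 (- h k)) (cpsi _ (mulr_ge0 (ltW (h0 k)) c0))).
  by move=> r _; rewrite /q -expRD; congr expR; ring.
(* The geometric series with ratio q = exp(-h z), z = 1 + c psi, sums to h / (1 - q). From exp(x) >=
   1 + x this lies between 1/z and 1/z + h, hence below 2 since z >= 1 and h <= 1. *)
have geo_ub k r : 0 <= r -> h k / (1 - q k r) <= (1 + c * psi r)^-1 + h k.
  move=> r0; have /andP[? ?] := q1 k r r0; have zr := z1 r r0; have hk := h0 k.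
  set z := 1 + c * psi r in zr *.
  have z0 : 0 < z by exact: lt_le_trans zr.
  rewrite ler_pdivrMr ?subr_gt0//.
  have qz : q k r * (1 + h k * z) <= 1.
    rewrite /q -/z expRN mulrC ler_pdivrMr ?expR_gt0// mul1r.
    exact: expR_ge1Dx.
  have h2 : h k = z^-1 * (h k * z) by rewrite mulrCA mulVf ?mulr1// gt_eqF.
  suff : (h k * z) <= (1 + h k * z) * (1 - q k r).
    have -> : z^-1 + h k = z^-1 * (1 + h k * z).
      by rewrite mulrDr mulr1 -h2.
    by move=> le1; rewrite [leLHS]h2 -mulrA ler_wpM2l// invr_ge0 ltW.
  lra.
have geo_lb k r : 0 <= r -> (1 + c * psi r)^-1 <= h k / (1 - q k r).
  move=> r0; have /andP[? ?] := q1 k r r0; have zr := z1 r r0; have hk := h0 k.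
  set z := 1 + c * psi r in zr *.
  have z0 : 0 < z by exact: lt_le_trans zr.
  rewrite ler_pdivlMr ?subr_gt0// mulrC ler_pdivrMr//.
  by have := expR_ge1Dx (- (h k * z)); rewrite -/z -/(q k r) /q -/z; lra.
have cg k : cmono (fun r => h k / (1 - q k r)).
  apply: (@cmono_lim _ (fun N r => \sum_(0 <= i < N) h k * q k r ^+ i) _ 2).
  - move=> N; apply: cmono_sum => i; apply: cmono_scale (ltW (h0 k)) _.
    exact: cmono_exprn.
  - move=> N r r0; have /andP[? ?] := q1 k r r0.
    have := geometric_le_lim N (ltW (h0 k)) _ (qN k r r0) => /(_ ltac:(by [])).
    move/le_trans; apply; apply: (le_trans (geo_ub k r r0)).
    have h1 : h k <= 1 by rewrite invf_le1// ler1n.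
    have : (1 + c * psi r)^-1 <= 1.
      by rewrite invf_le1 ?z1//; apply: lt_le_trans (z1 r r0).
    lra.
  - by move=> r r0; apply: cvg_geometric_series; exact: qN.
apply: (@cmono_lim _ (fun k r => h k / (1 - q k r)) _ 2) => // [k r r0|r r0].
  apply: (le_trans (geo_ub k r r0)).
  have h1 : h k <= 1 by rewrite invf_le1// ler1n.
  have : (1 + c * psi r)^-1 <= 1.
    by rewrite invf_le1 ?z1//; apply: lt_le_trans (z1 r r0).
  lra.
apply: (squeeze_cvgr _ (cvg_cst _)).
  by apply: nearW => k; rewrite geo_lb//=; exact: geo_ub.
rewrite -[X in _ --> X]addr0; apply: cvgD; first exact: cvg_cst.
exact: cvg_harmonic.
Qed.

(** These are the left Riemann sums of \int_0^1 x / (1 + t x) dt. Each summand y is such that 1 + y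
    is the ratio of consecutive values of 1 + t x, so the sum of ln(1 + y) telescopes to ln(1 + x),
    and y - y^2 <= ln(1 + y) <= y bounds the error by x^2/(N+1). *)
Lemma ln1D_riemann (x : R) : 0 <= x ->
  \sum_(0 <= j < N.+1) (x / N.+1%:R) / (1 + j%:R / N.+1%:R * x) @[N --> \oo]
    --> ln (1 + x).
Proof.
move=> x0.
pose y N j : R := (x / N.+1%:R) / (1 + j%:R / N.+1%:R * x).
have d0 N j : 0 < 1 + j%:R / N.+1%:R * x :> R.
  by rewrite ltr_wpDr// mulr_ge0// divr_ge0.
have y0 N j : 0 <= y N j by rewrite divr_ge0 ?divr_ge0// ltW.
have yx N j : y N j <= x / N.+1%:R.
  rewrite ler_pdivrMr// ler_peMr ?divr_ge0//.
  by rewrite lerDl mulr_ge0// divr_ge0.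
have lnE N : \sum_(0 <= j < N.+1) ln (1 + y N j) = ln (1 + x).
  pose f j := ln (1 + j%:R / N.+1%:R * x).
  rewrite (eq_bigr (fun j => f j.+1 - f j)); last first.
    move=> j _; rewrite /f -ln_div ?posrE//; congr ln.
    rewrite /y -[X in X + _](divff (lt0r_neq0 (d0 N j))) -mulrDl; congr (_ / _).
    by rewrite -[j.+1%:R]natr1 mulrDl mulrDl addrA mul1r [N.+1%:R^-1 * x]mulrC.
  by rewrite telescope_sumr// /f mul0r mul0r addr0 ln1 subr0 divff ?mul1r.
have ub N : \sum_(0 <= j < N.+1) y N j <= ln (1 + x) + x ^+ 2 * N.+1%:R^-1.
  have -> : x ^+ 2 * N.+1%:R^-1 = \sum_(0 <= j < N.+1) (x / N.+1%:R) ^+ 2 :> R.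
    rewrite big_const_nat subn0 iter_addr_0 -[RHS]mulr_natr.
    by field; rewrite addrC natr1 pnatr_eq0.
  rewrite -(lnE N) -big_split/= ler_sum// => j _.
  have yj := y0 N j.
  have y1 : 0 < 1 + y N j by rewrite ltr_wpDr.
  have : y N j - y N j ^+ 2 <= ln (1 + y N j).
    have : - ln (1 + y N j) <= - (y N j / (1 + y N j)).
      rewrite -lnV ?posrE//.
      have E : (1 + y N j)^-1 = 1 + - (y N j / (1 + y N j)).
        by rewrite -[X in X + - _](divff (lt0r_neq0 y1)) -mulrBl addrK mul1r.
      rewrite {1}E; apply: le_ln1Dx; rewrite ltrN2 ltr_pdivrMr//; lra.
    rewrite lerN2; apply: le_trans; rewrite ler_pdivlMr//.
    rewrite -subr_ge0 (_ : _ - _ = y N j ^+ 3); first by rewrite exprn_ge0.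
    by ring.
  have : y N j ^+ 2 <= (x / N.+1%:R) ^+ 2.
    by rewrite !expr2; apply: ler_pM; [exact: y0|exact: y0|exact: yx|exact: yx].
  by move=> A B; rewrite (le_trans _ (lerD (lexx _) A))// -lerBlDr.
apply: (squeeze_cvgr _ (cvg_cst _)).
  apply: nearW => N; apply/andP; split; last exact: ub.
  rewrite -(lnE N) ler_sum// => j _.
  by apply: le_ln1Dx; rewrite (lt_le_trans _ (y0 _ _)).
rewrite -[X in _ --> X]addr0 -(mulr0 (x ^+ 2)); apply: cvgD; first exact: cvg_cst.
by apply: cvgMl_tmp; exact: cvg_harmonic.
Qed.

(** In the Riemann sum for ln(1 + psi), the term j = 0 is a multiple of psi, and with c = j/(N+1)
    the term j > 0 is (1/j) (1 - 1/(1 + c psi)), a bound minus a completely monotone function. *)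
Lemma bernst_ln1D psi : bernst psi -> bernst (fun r => ln (1 + psi r)).
Proof.
move=> bpsi; have [psi0 _] := bpsi.
apply: bernst_lim (fun r r0 => ln1D_riemann (psi0 r r0)) => N.
apply: bernst_sum => -[|j].
  have cN : 0 <= N.+1%:R^-1 :> R by rewrite invr_ge0.
  apply: bernst_eq (bernst_scale cN bpsi) => r _.
  by rewrite mul0r mul0r addr0 divr1 mulrC.
have c0 : 0 <= j.+1%:R / N.+1%:R :> R by rewrite divr_ge0.
have d1 r : 0 <= r -> 1 <= 1 + j.+1%:R / N.+1%:R * psi r.
  by move=> r0; rewrite lerDl mulr_ge0 ?psi0.
have cj : 0 <= j.+1%:R^-1 :> R by rewrite invr_ge0.
apply: bernst_eq (bernst_scale cj (bernst_sub (M := 1) _ (cmono_inv1D c0 bpsi))).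
- move=> r r0; have d0 := lt_le_trans ltr01 (d1 r r0).
  rewrite -[X in X - _](divff (lt0r_neq0 d0)) -{2}[(1 + _)^-1]mul1r -mulrBl.
  rewrite addrAC subrr add0r !mulrA; congr (_ / _).
  by rewrite mulVf ?mul1r 1?mulrC ?pnatr_eq0.
- by move=> r r0; rewrite invf_le1 ?d1// (lt_le_trans ltr01 (d1 r r0)).
Qed.

Lemma cmono_cauchy (a b : R) : 0 < a <= 1 -> 0 <= b ->
  cmono (fun r => (1 + r `^ a) `^ (- b)).
Proof.
move=> a01 b0; have [_ /(_ _ b0)] := bernst_ln1D (bernst_powR a01).
apply: cmono_eq => r _.
by rewrite /powR [in RHS]gt_eqF ?mulNr// ltr_pwDl// powR_ge0.
Qed.

End CauchyCompleteMonotonicity.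

(** * Lebesgue measure on R^n and Gaussian integrals *)

Section ChangeOfVariables.
Context {R : realType}.
Local Notation mu := (@lebesgue_measure R).
Local Open Scope ereal_scope.

(** Positive and negative parts reduce to the nonnegative case. Since c > 0, an infinite integral of
    |f o phi| would make that of |f| infinite, which gives the integrability of f o phi. *)
Lemma integral_change_of_ge0 d (T : measurableType d)
    (m : {measure set T -> \bar R}) (phi : T -> T) (c : R) :
  measurable_fun setT phi -> (0 < c)%R ->
  (forall f : T -> \bar R, measurable_fun setT f -> (forall x, 0 <= f x) ->
    \int[m]_x f x = c%:E * \int[m]_x f (phi x)) ->
  forall f : T -> \bar R, m.-integrable setT f ->
  m.-integrable setT (f \o phi) /\ \int[m]_x f x = c%:E * \int[m]_x f (phi x).
Proof.
move=> mphi c0 H f intf; have /integrableP[mf foo] := intf.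
have mfp : measurable_fun setT (f \o phi) by exact: measurableT_comp.
have intfp : m.-integrable setT (f \o phi).
  apply/integrableP; split => //.
  have mabs : measurable_fun setT (abse \o f) by exact: measurableT_comp.
  move: foo; rewrite (H _ mabs (fun x => abse_ge0 (f x))) => e.
  rewrite ltNge leye_eq; apply/negP => /eqP e2.
  by move: e; rewrite /= e2 gt0_muley ?lte_fin// ltxx.
split=> //.
rewrite integralE H ?(measurable_funepos mf)//; last by exact: measurable_funepos.
rewrite [X in _ - X]H//; last by exact: measurable_funeneg.
have -> : \int[m]_x f (phi x) =
    \int[m]_x f^\+ (phi x) - \int[m]_x f^\- (phi x).
  by rewrite [LHS]integralE -/(f \o phi) funepos_comp funeneg_comp.
have fp : \int[m]_x f^\+ (phi x) \is a fin_num.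
  have := integrable_funepos measurableT intfp.
  by rewrite funepos_comp => /(integrable_fin_num measurableT).
by rewrite [RHS]muleBr// fin_num_adde_defr.
Qed.

(** The rescaled pushforward gives half-open intervals their length, so it is Lebesgue measure by
    uniqueness. *)
Lemma ge0_integral_affine (c w : R) (f : R -> \bar R) : (0 < c)%R ->
  measurable_fun setT f -> (forall x, 0 <= f x) ->
  \int[mu]_x f x = c%:E * \int[mu]_x f (c * x + w)%R.
Proof.
move=> c0 mf f0.
have mphi : measurable_fun setT (fun x : measurableTypeR R => c * x + w : measurableTypeR R)%R.
  by apply: measurable_funD => //; exact: measurable_funM.
pose c' := NngNum (ltW c0).
rewrite (@eq_measure_integral _ _ _ setT
  (mscale c' (pushforward mu (fun x : measurableTypeR R => c * x + w : measurableTypeR R)%R))).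
  rewrite ge0_integral_mscale//=; congr (_ * _).
  by rewrite ge0_integral_pushforward.
move=> A mA _; apply: lebesgue_measure_unique => //= _ [[a b]] _ <-.
rewrite /mscale/= /pushforward.
rewrite (_ : _ @^-1` _ = `]((a - w) / c)%R, ((b - w) / c)%R]%classic); last first.
  apply/seteqP; split => x /=; rewrite !in_itv/= => /andP[].
    by move=> ? ?; rewrite ltr_pdivrMr// ler_pdivlMr// !(mulrC x); apply/andP; split; lra.
  by rewrite ltr_pdivrMr// ler_pdivlMr// !(mulrC c) => ? ?; apply/andP; split; lra.
rewrite !lebesgue_measure_itv/= !lte_fin ltr_pM2r ?invr_gt0//.
rewrite ltrD2r; case: ifPn => _; last by rewrite mule0.
rewrite -!EFinB -EFinM; congr EFin; field; exact: lt0r_neq0.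
Qed.
End ChangeOfVariables.

Section Rn.
Context {R : realType}.
Local Notation mu := (@lebesgue_measure R).
Local Open Scope ereal_scope.

Lemma ge0_integral_RnS (n : nat) (f : n.+1.-tuple R -> \bar R) :
  measurable_fun setT f -> (forall u, 0 <= f u) ->
  \int[lebesgue_Rn n.+1]_u f u =
  \int[mu]_x \int[lebesgue_Rn n]_u f (tcons (x, u)).
Proof.
move=> mf f0.
rewrite [LHS](@ge0_integral_pushforward _ _ _ _ _ _ (@measurable_tcons R n)
  (mu \x @lebesgue_Rn R n) setT)//.
rewrite preimage_setT fubini_tonelli1//.
- by apply: measurableT_comp => //; exact: measurable_tcons.
- by move=> x; exact: f0.
Qed.

Lemma integral_Rn0 (f : 0.-tuple R -> \bar R) :
  \int[lebesgue_Rn 0]_u f u = f [tuple].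
Proof.
rewrite (eq_integral (cst (f [tuple]))); last by move=> u _; rewrite tuple0.
by rewrite integral_cst//= diracT mule1.
Qed.

Definition dil n (c : R) (u : n.-tuple R) : n.-tuple R := map_tuple ( *%R c) u.

Lemma tnth_dil n c (u : n.-tuple R) i : tnth (dil c u) i = (c * tnth u i)%R.
Proof. by rewrite tnth_map. Qed.

Lemma measurable_dil n c : measurable_fun setT (@dil n c).
Proof.
apply/measurable_fun_tnthP => i.
rewrite (_ : _ \o _ = fun u : n.-tuple R => (c * tnth u i)%R); last first.
  by apply/funext => u /=; rewrite tnth_map.
by apply: measurable_funM => //; exact: measurable_tnth.
Qed.

Lemma ge0_integral_dil n (c : R) (f : n.-tuple R -> \bar R) : (0 < c)%R ->
  measurable_fun setT f -> (forall u, 0 <= f u) ->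
  \int[lebesgue_Rn n]_u f u =
  (c ^+ n)%:E * \int[lebesgue_Rn n]_u f (dil c u).
Proof.
move=> c0; elim: n f => [|n ih] f mf f0.
  by rewrite !integral_Rn0 expr0 mul1e; congr f; rewrite [RHS]tuple0.
have mtc x : measurable_fun setT (fun u : n.-tuple R => f (tcons (x, u))).
  apply: measurableT_comp => //; apply: measurableT_comp => //.
  exact: measurable_tcons.
have mfd : measurable_fun setT (fun u => f (dil c u)).
  by apply: measurableT_comp => //; exact: measurable_dil.
rewrite !ge0_integral_RnS//.
under eq_integral do rewrite ih//.
have mF : measurable_fun setT (fun x : R => \int[lebesgue_Rn n]_u f (tcons (x, dil c u))).
  apply: (measurable_fun_fubini_tonelli_F (m2 := lebesgue_Rn n)
    (fun xu : measurableTypeR R * n.-tuple R => f (tcons (xu.1, dil c xu.2)))) => //.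
  apply: measurableT_comp => //; apply: (measurableT_comp (@measurable_tcons R n)).
  apply: measurable_fun_pair => //=.
  apply: (measurableT_comp (@measurable_dil n c)) => //.
rewrite ge0_integralZl//; last 2 first.
- by move=> x _; apply: integral_ge0 => u _.
- by rewrite lee_fin exprn_ge0// ltW.
rewrite exprS EFinM -muleA muleCA; congr (_ * _).
rewrite [LHS](ge0_integral_affine (c := c) 0%R)//; last first.
  by move=> x; apply: integral_ge0.
congr (_ * _); apply: eq_integral => x _; apply: eq_integral => u _.
congr f; apply: val_inj; rewrite /= addr0//.
Qed.

Lemma integral_dil n (c : R) (f : n.-tuple R -> \bar R) : (0 < c)%R ->
  (lebesgue_Rn n).-integrable setT f ->
  (lebesgue_Rn n).-integrable setT (f \o dil c) /\
  \int[lebesgue_Rn n]_u f u =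
  (c ^+ n)%:E * \int[lebesgue_Rn n]_u f (dil c u).
Proof.
move=> c0; apply: integral_change_of_ge0; first exact: measurable_dil.
  by rewrite exprn_gt0.
by move=> g mg g0; exact: ge0_integral_dil.
Qed.
End Rn.

Section MeasurableTrigo.
Context {R : realType}.

Lemma measurable_sin : measurable_fun setT (sin : R -> R).
Proof. exact: continuous_measurable_fun (@continuous_sin R). Qed.

Lemma measurable_cos : measurable_fun setT (cos : R -> R).
Proof. exact: continuous_measurable_fun (@continuous_cos R). Qed.

End MeasurableTrigo.
#[global] Hint Resolve measurable_sin measurable_cos : core.

(** * One-dimensional Gaussian Fourier integrals *)

Section Gauss1.
Context {R : realType}.
Local Notation mu := (@lebesgue_measure R).

Lemma ge0_integral_gauss1 (p w : R) : 0 < p ->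
  (\int[mu]_x (expR (- (p * (x - w) ^+ 2)))%:E = (Num.sqrt (pi / p))%:E)%E.
Proof.
move=> p0; have sp0 : 0 < Num.sqrt p by rewrite sqrtr_gt0.
have := @integralT_gauss R.
rewrite (ge0_integral_affine (c := Num.sqrt p) (- (Num.sqrt p * w)))//; last 2 first.
- by apply/measurable_EFinP; exact: measurable_gauss_fun.
- by move=> x; rewrite lee_fin gauss_fun_ge0.
have E (x : R) : gauss_fun (Num.sqrt p * x + - (Num.sqrt p * w)) = expR (- (p * (x - w) ^+ 2)).
  by rewrite /gauss_fun -mulrBr exprMn sqr_sqrtr// ltW.
under eq_integral do rewrite E.
move=> H; have : ((Num.sqrt p)^-1%:E * ((Num.sqrt p)%:E * \int[mu]_x (expR (- (p * (x - w) ^+ 2)))%:E) = (Num.sqrt p)^-1%:E * (Num.sqrt pi)%:E)%E.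
  by rewrite H.
rewrite muleA -EFinM mulVf ?lt0r_neq0// mul1e => ->.
by rewrite -EFinM sqrtrM ?pi_ge0// sqrtrV ?(ltW p0)// mulrC.
Qed.

Lemma measurable_gauss1 (p w : R) :
  measurable_fun setT (fun x : R => expR (- (p * (x - w) ^+ 2))).
Proof.
apply: measurableT_comp => //; apply: measurableT_comp => //.
apply: measurable_funM => //; apply: measurable_funX => //.
exact: measurable_funB.
Qed.

Lemma integrable_gauss1 (p w : R) : 0 < p ->
  mu.-integrable setT (fun x => (expR (- (p * (x - w) ^+ 2)))%:E).
Proof.
move=> p0; apply/integrableP; split.
  by apply/measurable_EFinP; exact: measurable_gauss1.
under eq_integral do rewrite gee0_abs ?lee_fin ?expR_ge0//.
by rewrite ge0_integral_gauss1// ltry.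
Qed.

Lemma le_integrable_EFin d (T : measurableType d) (m : {measure set T -> \bar R})
    (f g : T -> R) : measurable_fun setT f -> (forall x, `|f x| <= g x) ->
  m.-integrable setT (EFin \o g) -> m.-integrable setT (EFin \o f).
Proof.
move=> mf fg ig; apply: (le_integrable _ _ _ ig) => //; first exact/measurable_EFinP.
by move=> x _ /=; rewrite lee_fin (le_trans (fg x))// ler_norm.
Qed.

(** Half of the Gaussian absorbs the linear factor produced by differentiation: |y| <= 1 + y^2/2 <=
    exp(y^2/2). *)
Lemma ler_abs_gauss (y : R) : `|y| * expR (- y ^+ 2) <= expR (- (y ^+ 2 / 2)).
Proof.
have -> : expR (- y ^+ 2) = expR (- (y ^+ 2 / 2)) * expR (- (y ^+ 2 / 2)).
  by rewrite -expRD; congr expR; lra.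
rewrite mulrA ler_piMl ?expR_ge0// expRN ler_pdivrMr ?expR_gt0// mul1r.
apply: le_trans (expR_ge1Dx _).
have : 0 <= (1 - `|y|) ^+ 2 by exact: sqr_ge0.
by rewrite -[y ^+ 2]real_normK ?num_real//; lra.
Qed.

Lemma Rintegral_affine (c w : R) (f : R -> R) : 0 < c ->
  mu.-integrable setT (EFin \o f) ->
  mu.-integrable setT (EFin \o (fun x => f (c * x + w))) /\
  \int[mu]_x f x = c * \int[mu]_x f (c * x + w).
Proof.
move=> c0 intf.
have mphi : measurable_fun setT (fun x : R => c * x + w).
  by apply: measurable_funD => //; exact: measurable_funM.
have [//|] := @integral_change_of_ge0 R _ _ mu (fun x : R => c * x + w) c mphi c0 _ _ intf.
  by move=> g mg g0; exact: ge0_integral_affine.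
move=> iphi E; split=> //.
rewrite /Rintegral E -[c in RHS]/(fine c%:E) -fineM//.
exact: integrable_fin_num.
Qed.

Section ode.
Variable theta : R.

(** A Gaussian wave translated by s. Its integral in x is independent of s, so that of its
    s-derivative [dh] vanishes at s = 0. This replaces the integration by parts relating \int
    cos(theta + t x) exp(-x^2) dx to its t-derivative. *)
Let h t (s x : R) := sin (theta + t * (x + s)) * expR (- (x + s) ^+ 2).

Let dh t (s x : R) := (t * cos (theta + t * (x + s)) - 2 * (x + s) * sin (theta + t * (x + s))) * expR (- (x + s) ^+ 2).

Let is_derive_h t x s : is_derive s (1 : R) (h t ^~ x) (dh t s x).
Proof.
rewrite /h.
have d1 : is_derive s (1:R) (fun s : R => x + s) 1.
  by apply: is_derive_eq; rewrite add0r mulr1.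
have d2 : is_derive s (1:R) (fun s : R => theta + t * (x + s)) t.
  by apply: is_derive_eq; rewrite /GRing.scale/=; ring.
have d3 : is_derive s (1:R) (fun s : R => - (x + s) ^+ 2) (- (2 * (x + s))).
  by apply: is_derive_eq; rewrite /GRing.scale/=; ring.
have d4 : is_derive s (1:R) (fun s : R => sin (theta + t * (x + s))) (cos (theta + t * (x + s)) * t).
  exact: (@is_derive1_comp _ sin (fun s : R => theta + t * (x + s))).
have d5 : is_derive s (1:R) (fun s : R => expR (- (x + s) ^+ 2)) (expR (- (x + s) ^+ 2) * (- (2 * (x + s)))).
  exact: (@is_derive1_comp _ expR (fun s : R => - (x + s) ^+ 2)).
apply: (is_derive_eq (is_deriveM d4 d5)).
rewrite /dh /GRing.scale/=; ring.
Qed.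

Let integrable_h t s : mu.-integrable setT (EFin \o h t s).
Proof.
apply: le_integrable_EFin (integrable_gauss1 (- s) ltr01).
  apply: measurable_funM.
    apply: (measurableT_comp measurable_sin).
    by apply: measurable_funD => //; apply: measurable_funM => //; exact: measurable_funD.
  apply: (measurableT_comp (@measurable_expR R)).
  by apply: measurableT_comp => //; apply: measurable_funX; exact: measurable_funD.
move=> x; rewrite normrM (ger0_norm (expR_ge0 _)) mul1r opprK.
by rewrite ler_piMl ?expR_ge0// ler_norml sin_geN1 sin_le1.
Qed.

Let dh_ub t s x : -1 < s < 1 ->
  `|dh t s x| <= (`|t| + 2) * expR 1 * expR (- (4^-1 * (x - 0) ^+ 2)).
Proof.
move=> /andP[s1 s2]; rewrite /dh normrM (ger0_norm (expR_ge0 _)).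
set y := x + s.
have c1 z : `|cos z| <= 1 :> R by rewrite ler_norml cos_geN1 cos_le1.
have n1 z : `|sin z| <= 1 :> R by rewrite ler_norml sin_geN1 sin_le1.
apply: (@le_trans _ _ ((`|t| + 2 * `|y|) * expR (- y ^+ 2))).
  rewrite ler_wpM2r ?expR_ge0//; apply: (le_trans (ler_normB _ _)).
  rewrite !normrM (ger0_norm (_ : 0 <= 2))// lerD// ?ler_piMr// mulr_ge0//.
(* For |s| < 1 one has (x + s)^2 / 2 >= x^2 / 4 - 1, by expanding (x + 2 s)^2 >= 0. The resulting
   dominating function does not depend on s. *)
have e1 : expR (- (y ^+ 2 / 2)) <= expR 1 * expR (- (4^-1 * (x - 0) ^+ 2)).
  rewrite -expRD ler_expR subr0 /y.
  have : 0 <= (x + 2 * s) ^+ 2 by exact: sqr_ge0.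
  have s21 : s ^+ 2 <= 1 by nra.
  lra.
rewrite -mulrA; apply: (@le_trans _ _ ((`|t| + 2) * expR (- (y ^+ 2 / 2)))).
  rewrite [leRHS]mulrDl [leLHS]mulrDl; apply: lerD.
    rewrite ler_wpM2l// ler_expR lerN2.
    by rewrite ler_pdivrMr// ler_peMr ?sqr_ge0// ler1n.
  by rewrite -mulrA ler_wpM2l//; exact: ler_abs_gauss.
by rewrite ler_wpM2l// addr_ge0.
Qed.

Let int_dh t : \int[mu]_x dh t 0 x = 0.
Proof.
have cF s : \int[mu]_x h t s x = \int[mu]_x h t 0 x.
  have [_ ->] := Rintegral_affine s ltr01 (integrable_h t 0).
  by rewrite mul1r; apply: eq_Rintegral => x _; rewrite /h mul1r addr0.
have I0 : (`](-1), 1[%classic : set R) 0 by rewrite /= in_itv/=; apply/andP; split; lra.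
have H := @differentiation_under_integral _ _ _ mu (h t) setT measurableT 0 (-1) 1 I0
  (fun x _ => integrable_h t x)
  (fun x y _ _ => @ex_derive _ _ _ _ _ _ _ (is_derive_h t y x))
  (fun x => (`|t| + 2) * expR 1 * expR (- (4^-1 * (x - 0) ^+ 2))).
have dE s x : partial1of2 (h t) s x = dh t s x.
  by rewrite /partial1of2 derive1E; apply: derive_val; exact: is_derive_h.
transitivity (\int[mu]_x partial1of2 (h t) 0 x).
  by apply: eq_Rintegral => x _; rewrite dE.
rewrite -H.
- have -> : (fun s => \int[mu]_x h t s x) = cst (\int[mu]_x h t 0 x).
    by apply/funext => s; exact: cF.
  exact: derive1_cst.
- by move=> y; rewrite !mulr_ge0 ?expR_ge0// addr_ge0.
- have i4 : 0 < 4^-1 :> R by rewrite invr_gt0.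
  exact: (integrableZl measurableT ((`|t| + 2) * expR 1) (integrable_gauss1 0 i4)).
- move=> s x; rewrite /= in_itv/= => ? _; rewrite dE; exact: dh_ub.
Qed.

Let g t (x : R) := cos (theta + t * x) * expR (- x ^+ 2).
Let dg t (x : R) := - x * sin (theta + t * x) * expR (- x ^+ 2).

Let is_derive_g t x : is_derive t (1 : R) (g ^~ x) (dg t x).
Proof.
rewrite /g.
have d2 : is_derive t (1:R) (fun t : R => theta + t * x) x.
  by apply: is_derive_eq; rewrite /GRing.scale/=; ring.
have d4 : is_derive t (1:R) (fun t : R => cos (theta + t * x)) (- sin (theta + t * x) * x).
  exact: (@is_derive1_comp _ cos (fun t : R => theta + t * x)).
apply: is_derive_eq; rewrite /dg /GRing.scale/=; ring.
Qed.

Let integrable_g t : mu.-integrable setT (EFin \o g t).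
Proof.
apply: le_integrable_EFin (integrable_gauss1 0 ltr01).
  apply: measurable_funM.
    apply: (measurableT_comp measurable_cos).
    by apply: measurable_funD => //; exact: measurable_funM.
  apply: (measurableT_comp (@measurable_expR R)).
  by apply: measurableT_comp => //; exact: measurable_funX.
move=> x; rewrite normrM (ger0_norm (expR_ge0 _)) mul1r subr0.
by rewrite ler_piMl ?expR_ge0// ler_norml cos_geN1 cos_le1.
Qed.

Let dg_ub t x : `|dg t x| <= expR (- (2^-1 * (x - 0) ^+ 2)).
Proof.
rewrite /dg normrM (ger0_norm (expR_ge0 _)) normrM normrN subr0 (mulrC 2^-1).
apply: le_trans (ler_abs_gauss x); rewrite ler_wpM2r ?expR_ge0//.
by rewrite ler_piMr// ler_norml sin_geN1 sin_le1.
Qed.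

Let integrable_dg t : mu.-integrable setT (EFin \o dg t).
Proof.
have i2 : 0 < 2^-1 :> R by rewrite invr_gt0.
apply: le_integrable_EFin (integrable_gauss1 0 i2); last exact: dg_ub.
apply: measurable_funM; last exact: measurable_gauss_fun.
apply: measurable_funM; first exact: oppr_measurable.
apply: (measurableT_comp measurable_sin).
by apply: measurable_funD => //; exact: measurable_funM.
Qed.

Let is_derive_int_g t : is_derive t (1 : R) (fun t => \int[mu]_x g t x) (\int[mu]_x dg t x).
Proof.
have It : (`](t - 1), (t + 1)[%classic : set R) t by rewrite /= in_itv/=; apply/andP; split; lra.
have dE s x : partial1of2 g s x = dg s x.
  by rewrite /partial1of2 derive1E; apply: derive_val; exact: is_derive_g.
have i2 : 0 < 2^-1 :> R by rewrite invr_gt0.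
have P1 := @derivable_under_integral _ _ _ mu g setT measurableT t _ _ It
  (fun x _ => integrable_g x)
  (fun x y _ _ => @ex_derive _ _ _ _ _ _ _ (is_derive_g x y))
  (fun x => expR (- (2^-1 * (x - 0) ^+ 2)))
  (fun x => expR_ge0 _) (integrable_gauss1 0 i2).
have P2 := @differentiation_under_integral _ _ _ mu g setT measurableT t _ _ It
  (fun x _ => integrable_g x)
  (fun x y _ _ => @ex_derive _ _ _ _ _ _ _ (is_derive_g x y))
  (fun x => expR (- (2^-1 * (x - 0) ^+ 2)))
  (fun x => expR_ge0 _) (integrable_gauss1 0 i2).
apply: DeriveDef.
  by apply: P1 => s x _ _; rewrite dE; exact: dg_ub.
rewrite -derive1E P2 => [|s x _ _]; last by rewrite dE; exact: dg_ub.
by apply: eq_Rintegral => x _; exact: dE.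
Qed.

(** With F t for the left-hand side, [int_dh] reads t F + 2 F' = 0. Hence F t exp(t^2 / 4) has zero
    derivative and equals its value at 0, a Gaussian integral. *)
Lemma Rintegral_cos_gauss t :
  \int[mu]_x (cos (theta + t * x) * expR (- x ^+ 2)) =
  cos theta * Num.sqrt pi * expR (- (t ^+ 2 / 4)).
Proof.
pose F t := \int[mu]_x g t x.
have ode t' : t' * F t' + 2 * \int[mu]_x dg t' x = 0.
  rewrite -[RHS](int_dh t') /F -RintegralZl// -RintegralZl// -RintegralD//.
  - by apply: eq_Rintegral => x _; rewrite /g /dg /dh !addr0; ring.
  - by apply: (integrableZl measurableT t' (integrable_g t')).
  - by apply: (integrableZl measurableT 2 (integrable_dg t')).
pose E t := F t * expR (t ^+ 2 / 4).
have dE t' : is_derive t' (1 : R) E 0.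
  have d1 : is_derive t' (1 : R) (fun t : R => t ^+ 2 / 4) (t' / 2).
    by apply: is_derive_eq; rewrite /GRing.scale/=; field.
  have d2 : is_derive t' (1 : R) (fun t : R => expR (t ^+ 2 / 4)) (expR (t' ^+ 2 / 4) * (t' / 2)).
    exact: (@is_derive1_comp _ expR (fun t : R => t ^+ 2 / 4)).
  apply: (is_derive_eq (is_deriveM (is_derive_int_g t') d2)).
  rewrite /GRing.scale/= -/(F t').
  have -> : \int[mu]_x dg t' x = - (t' / 2 * F t').
    by have := ode t'; lra.
  by ring.
have : E t = E 0 by exact: is_derive_0_is_cst.
rewrite /E expr0n/= mul0r expR0 mulr1 => Et.
have F0 : F 0 = cos theta * Num.sqrt pi.
  rewrite /F -[Num.sqrt pi]/(fine (Num.sqrt pi)%:E) -integralT_gauss.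
  rewrite -/(Rintegral mu setT gauss_fun) -RintegralZl//; last exact: integrableT_gauss.
  by apply: eq_Rintegral => x _; rewrite /g mul0r addr0.
by rewrite -F0 -Et -mulrA -expRD subrr expR0 mulr1.
Qed.

End ode.
Lemma integral_cos_gauss1 (theta t p w : R) : 0 < p ->
  (\int[mu]_x (cos (theta + t * x) * expR (- (p * (x - w) ^+ 2)))%:E =
  (cos (theta + t * w) * Num.sqrt (pi / p) * expR (- (t ^+ 2 / (4 * p))))%:E)%E.
Proof.
move=> p0; pose f (x : R) := cos (theta + t * x) * expR (- (p * (x - w) ^+ 2)).
have sp0 : 0 < Num.sqrt p by rewrite sqrtr_gt0.
have isp0 : 0 < (Num.sqrt p)^-1 by rewrite invr_gt0.
have intf : mu.-integrable setT (EFin \o f).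
  apply: le_integrable_EFin (integrable_gauss1 w p0).
    apply: measurable_funM; last exact: measurable_gauss1.
    apply: (measurableT_comp measurable_cos).
    by apply: measurable_funD => //; exact: measurable_funM.
  move=> x; rewrite normrM (ger0_norm (expR_ge0 _)).
  by rewrite ler_piMl ?expR_ge0// ler_norml cos_geN1 cos_le1.
have fi := integrable_fin_num measurableT intf.
rewrite -[LHS](fineK fi); congr EFin; rewrite -/(Rintegral mu setT f).
have [_ ->] := Rintegral_affine w isp0 intf.
have E x : f ((Num.sqrt p)^-1 * x + w) =
    cos ((theta + t * w) + (t / Num.sqrt p) * x) * expR (- x ^+ 2).
  rewrite /f; congr (cos _ * expR (- _)); first by ring.
  by rewrite addrK exprMn exprVn sqr_sqrtr ?(ltW p0)// mulrA divff ?mul1r ?lt0r_neq0.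
under eq_Rintegral do rewrite E.
rewrite Rintegral_cos_gauss.
rewrite expr_div_n sqr_sqrtr ?(ltW p0)// sqrtrM ?pi_ge0// sqrtrV ?(ltW p0)//.
have -> : t ^+ 2 / p / 4 = t ^+ 2 / (4 * p) by rewrite -mulrA -invfM (mulrC p).
by ring.
Qed.
End Gauss1.

(** * Gaussian Fourier integrals in n dimensions *)

Section GaussN.
Context {R : realType}.
Local Notation mu := (@lebesgue_measure R).
Local Notation leb := (@lebesgue_Rn R).
Local Open Scope ereal_scope.

Lemma integral_RnS (n : nat) (f : n.+1.-tuple R -> \bar R) :
  (leb n.+1).-integrable setT f ->
  \int[leb n.+1]_u f u = \int[mu]_x \int[leb n]_u f (tcons (x, u)).
Proof.
move=> intf; have /integrableP[mf foo] := intf.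
have mft : measurable_fun setT (f \o @tcons R n).
  by apply: measurableT_comp => //; exact: measurable_tcons.
have intft : (mu \x leb n).-integrable setT (f \o @tcons R n).
  apply/integrableP; split => //.
  have mft2 : measurable_fun setT (fun x => `|(f \o @tcons R n) x|).
    exact: measurableT_comp.
  rewrite fubini_tonelli1//; apply: le_lt_trans foo.
  rewrite ge0_integral_RnS//.
  exact: measurableT_comp.
rewrite [LHS](@integral_pushforward _ _ _ _ _ _ (@measurable_tcons R n)
  (mu \x @lebesgue_Rn R n) setT)//.
by rewrite preimage_setT -integral12_prod_meas1.
Qed.

Local Open Scope ring_scope.

Definition qdist n (w : 'I_n -> R) (u : n.-tuple R) := \sum_i (tnth u i - w i) ^+ 2.
Definition lform n (t : 'I_n -> R) (u : n.-tuple R) := \sum_i t i * tnth u i.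

Lemma measurable_qdist n (w : 'I_n -> R) : measurable_fun setT (qdist w).
Proof.
apply: measurable_sum => i; apply: measurable_funX.
by apply: measurable_funB => //; exact: measurable_tnth.
Qed.

Lemma measurable_lform n (t : 'I_n -> R) : measurable_fun setT (lform t).
Proof.
apply: measurable_sum => i; apply: measurable_funM => //.
exact: measurable_tnth.
Qed.

Lemma qdist_ge0 n (w : 'I_n -> R) u : 0 <= qdist w u.
Proof. by apply: sumr_ge0 => i _; exact: sqr_ge0. Qed.

Lemma qdistS n (w : 'I_n.+1 -> R) x u :
  qdist w (tcons (x, u)) = (x - w ord0) ^+ 2 + qdist (fun i => w (lift ord0 i)) u.
Proof.
rewrite /qdist big_ord_recl; congr (_ + _).
by apply: eq_bigr => i _; rewrite tnthS.
Qed.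

Lemma lformS n (t : 'I_n.+1 -> R) x u :
  lform t (tcons (x, u)) = t ord0 * x + lform (fun i => t (lift ord0 i)) u.
Proof.
rewrite /lform big_ord_recl; congr (_ + _).
by apply: eq_bigr => i _; rewrite tnthS.
Qed.

Lemma measurable_gaussN n p (w : 'I_n -> R) :
  measurable_fun setT (fun u => expR (- (p * qdist w u))).
Proof.
apply: (measurableT_comp (@measurable_expR R)).
apply: measurableT_comp => //; apply: measurable_funM => //.
exact: measurable_qdist.
Qed.

Lemma ge0_integral_gaussN n p (w : 'I_n -> R) : 0 < p ->
  (\int[leb n]_u (expR (- (p * qdist w u)))%:E = (Num.sqrt (pi / p) ^+ n)%:E)%E.
Proof.
move=> p0; elim: n w => [|n ih] w.
  by rewrite integral_Rn0 /qdist big_ord0 mulr0 oppr0 expR0 expr0.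
rewrite ge0_integral_RnS; last 2 first.
- by apply/measurable_EFinP; exact: measurable_gaussN.
- by move=> u; rewrite lee_fin expR_ge0.
have E x : (\int[leb n]_u (expR (- (p * qdist w (tcons (x, u)))))%:E =
    (Num.sqrt (pi / p) ^+ n)%:E * (expR (- (p * (x - w ord0) ^+ 2)))%:E)%E.
  rewrite muleC -(ih (fun i => w (lift ord0 i))) -ge0_integralZl//.
  - apply: eq_integral => u _; rewrite -EFinM -expRD qdistS; congr (expR _)%:E.
    by rewrite mulrDr opprD.
  - by apply/measurable_EFinP; exact: measurable_gaussN.
under eq_integral do rewrite E.
rewrite ge0_integralZl//.
- by rewrite ge0_integral_gauss1// -EFinM exprSr.
- by apply/measurable_EFinP; exact: measurable_gauss1.
Qed.

Lemma integrable_gaussN n p (w : 'I_n -> R) : 0 < p ->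
  (leb n).-integrable setT (EFin \o (fun u => expR (- (p * qdist w u)))).
Proof.
move=> p0; apply/integrableP; split.
  by apply/measurable_EFinP; exact: measurable_gaussN.
under eq_integral do rewrite gee0_abs ?lee_fin ?expR_ge0//.
by rewrite ge0_integral_gaussN// ltry.
Qed.

Lemma integrable_cos_gaussN n theta (t : 'I_n -> R) p (w : 'I_n -> R) : 0 < p ->
  (leb n).-integrable setT
    (EFin \o (fun u => cos (theta + lform t u) * expR (- (p * qdist w u)))).
Proof.
move=> p0; apply: le_integrable_EFin (integrable_gaussN w p0).
  apply: measurable_funM; last exact: measurable_gaussN.
  apply: (measurableT_comp measurable_cos).
  by apply: measurable_funD => //; exact: measurable_lform.
move=> x; rewrite normrM (ger0_norm (expR_ge0 _)).
by rewrite ler_piMl ?expR_ge0// ler_norml cos_geN1 cos_le1.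
Qed.

(** Induction on n, made possible by the free phase: the contribution of the coordinate split off
    joins theta in the inner integral. *)
Lemma integral_cos_gaussN n theta (t : 'I_n -> R) p (w : 'I_n -> R) : 0 < p ->
  (\int[leb n]_u (cos (theta + lform t u) * expR (- (p * qdist w u)))%:E =
  (cos (theta + \sum_i t i * w i) * Num.sqrt (pi / p) ^+ n
   * expR (- ((\sum_i t i ^+ 2) / (4 * p))))%:E)%E.
Proof.
move=> p0; elim: n theta t w => [|n ih] theta t w.
  rewrite integral_Rn0 /qdist /lform !big_ord0 mulr0 oppr0 expr0 mul0r oppr0.
  by rewrite !expR0 !mulr1.
rewrite integral_RnS; last exact: integrable_cos_gaussN.
pose t' i := t (lift ord0 i); pose w' i := w (lift ord0 i).
set K := Num.sqrt (pi / p).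
have E x : (\int[leb n]_u (cos (theta + lform t (tcons (x, u))) * expR (- (p * qdist w (tcons (x, u)))))%:E =
    (K ^+ n * expR (- ((\sum_i t' i ^+ 2) / (4 * p))))%:E *
    (cos (theta + (\sum_i t' i * w' i) + t ord0 * x) * expR (- (p * (x - w ord0) ^+ 2)))%:E)%E.
  transitivity ((expR (- (p * (x - w ord0) ^+ 2)))%:E *
    (\int[leb n]_u (cos (theta + t ord0 * x + lform t' u) * expR (- (p * qdist w' u)))%:E))%E.
    rewrite -integralZl//; last exact: integrable_cos_gaussN.
    apply: eq_integral => u _; rewrite -EFinM; congr EFin.
    rewrite lformS qdistS mulrCA -expRD addrA; congr (_ * expR _).
    by rewrite mulrDr opprD.
  rewrite ih -!EFinM; congr EFin.
  by rewrite (addrAC theta); ring.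
under eq_integral do rewrite E.
rewrite integralZl//.
  rewrite integral_cos_gauss1// -!EFinM !big_ord_recl; congr EFin.
  have e a b : expR (- ((a + b) / (4 * p))) = expR (- (a / (4 * p))) * expR (- (b / (4 * p))).
    by rewrite mulrDl opprD expRD.
  rewrite /t' /w' /K e (exprS (Num.sqrt _)) (addrC (t ord0 * w ord0)) addrA.
  by ring.
apply: le_integrable_EFin (integrable_gauss1 (w ord0) p0).
  apply: measurable_funM; last exact: measurable_gauss1.
  apply: (measurableT_comp measurable_cos).
  by apply: measurable_funD => //; exact: measurable_funM.
move=> x; rewrite normrM (ger0_norm (expR_ge0 _)).
by rewrite ler_piMl ?expR_ge0// ler_norml cos_geN1 cos_le1.
Qed.
End GaussN.

(** * Gaussian regularization and Tauberian bounds *)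

Section RealDominatedConvergence.
Context d (T : measurableType d) {R : realType} (m : {measure set T -> \bar R}).

Lemma Rdominated_cvg (f_ : nat -> T -> R) (f g : T -> R) :
  (forall k, measurable_fun setT (f_ k)) -> measurable_fun setT f ->
  {ae m, forall x, f_ k x @[k --> \oo] --> f x /\ forall k, `|f_ k x| <= g x} ->
  m.-integrable setT (EFin \o g) ->
  m.-integrable setT (EFin \o f) /\
  \int[m]_x f_ k x @[k --> \oo] --> \int[m]_x f x.
Proof.
move=> mf_ mf fg ig.
have H1 k : measurable_fun setT (EFin \o f_ k) by exact/measurable_EFinP.
have H2 : measurable_fun setT (EFin \o f) by exact/measurable_EFinP.
have H3 : {ae m, forall x, [set: T] x -> (EFin \o f_ k) x @[k --> \oo] --> (EFin \o f) x}.
  apply: filterS fg => x [cvx _] _; exact: cvg_comp cvx _.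
have H4 : {ae m, forall x k, [set: T] x -> (`|(EFin \o f_ k) x| <= (EFin \o g) x)%E}.
  by apply: filterS fg => x [_ ubx] k _ /=; rewrite lee_fin.
have [if1 _ cv] := dominated_convergence measurableT H1 H2 H3 ig H4.
split=> //; apply: fine_cvg; rewrite fineK//.
exact: (integrable_fin_num measurableT if1).
Qed.

Lemma integrableD_EFin (f g : T -> R) :
  m.-integrable setT (EFin \o f) -> m.-integrable setT (EFin \o g) ->
  m.-integrable setT (EFin \o (fun x => f x + g x)).
Proof. by move=> hf hg; have := integrableD measurableT hf hg. Qed.

Lemma integrableB_EFin (f g : T -> R) :
  m.-integrable setT (EFin \o f) -> m.-integrable setT (EFin \o g) ->
  m.-integrable setT (EFin \o (fun x => f x - g x)).
Proof. by move=> hf hg; have := integrableB measurableT hf hg. Qed.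

Lemma integrableZ_EFin (c : R) (f : T -> R) :
  m.-integrable setT (EFin \o f) ->
  m.-integrable setT (EFin \o (fun x => c * f x)).
Proof. by move=> hf; have := integrableZl measurableT c hf. Qed.

End RealDominatedConvergence.

(** * From exponentials to completely monotone functions *)

Section Transfer.
Context {R : realType} {n : nat}.
Local Notation leb := (@lebesgue_Rn R n).
Implicit Types (F : R -> R) (u : n.-tuple R) (x : 'I_n -> R).

Definition nsq u : R := qdist (fun=> 0) u.

Lemma nsq_ge0 u : 0 <= nsq u. Proof. exact: qdist_ge0. Qed.

Lemma measurable_nsq : measurable_fun setT nsq.
Proof. exact: measurable_qdist. Qed.

Lemma measurable_cmono F : cmono F -> measurable_fun setT (F \o nsq).
Proof.
elim=> {F}[s s0|F G _ h _ k|c F c0 _ h|F_ F M _ h _ k].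
- apply: (measurableT_comp (@measurable_expR R)); apply: measurableT_comp => //.
  by apply: measurable_funM => //; exact: measurable_nsq.
- exact: measurable_funD.
- exact: measurable_funM.
- by apply: measurable_fun_cvg h _ => u _; apply: k; exact: nsq_ge0.
Qed.

Lemma cmono_integrable F (psi : n.-tuple R -> R) : cmono F ->
  leb.-integrable setT (EFin \o psi) ->
  leb.-integrable setT (EFin \o (fun u => F (nsq u) * psi u)).
Proof.
move=> cF ipsi; have [M FM] := cmono_bounded cF.
have /integrableP[/measurable_EFinP mpsi _] := ipsi.
have iM : leb.-integrable setT (EFin \o (fun u => M * `|psi u|)).
  by have := integrableZl measurableT M (integrable_abse ipsi).
apply: le_integrable_EFin iM.
  by apply: measurable_funM => //; exact: measurable_cmono.
move=> u; rewrite normrM ler_wpM2r// ger0_norm ?FM ?nsq_ge0//.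
by apply: cmono_ge0 cF _ _; exact: nsq_ge0.
Qed.

(** The functional is linear and nonnegative on exponentials; sums and nonnegative multiples are
    immediate, and the uniform bound M of a limit gives the dominating function M |psi|. This is the
    only place where positivity is passed from exponentials to all of [cmono]. *)
Lemma cmono_functional_ge0 F (psi : n.-tuple R -> R) : cmono F ->
  leb.-integrable setT (EFin \o psi) ->
  (forall s, 0 <= s -> 0 <= \int[leb]_u (expR (- (s * nsq u)) * psi u)) ->
  0 <= \int[leb]_u (F (nsq u) * psi u).
Proof.
move=> cF ipsi H.
elim: cF => {F}[s s0|F G cF h cG k|c F c0 cF h|F_ F M cF h FM cv].
- exact: H.
- under eq_Rintegral do rewrite mulrDl.
  by rewrite RintegralD ?addr_ge0//; exact: cmono_integrable.
- under eq_Rintegral do rewrite -mulrA.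
  by rewrite RintegralZl ?mulr_ge0//; exact: cmono_integrable.
- have /integrableP[/measurable_EFinP mpsi _] := ipsi.
  have iM : leb.-integrable setT (EFin \o (fun u => M * `|psi u|)).
    by have := integrableZl measurableT M (integrable_abse ipsi).
  have cF' : cmono F by exact: cmono_lim FM cv.
  have m1 k : measurable_fun setT (fun u => F_ k (nsq u) * psi u).
    by apply: measurable_funM => //; exact: measurable_cmono.
  have m2 : measurable_fun setT (fun u => F (nsq u) * psi u).
    by apply: measurable_funM => //; exact: measurable_cmono.
  have [|_ c] := Rdominated_cvg m1 m2 _ iM.
    apply: aeW => u; split=> [|k].
      by apply: cvgMr_tmp; apply: cv; exact: nsq_ge0.
    rewrite normrM ler_wpM2r// ger0_norm ?FM ?nsq_ge0//.
    by apply: cmono_ge0 (cF k) _ _; exact: nsq_ge0.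
  by apply: (cvgr_to_ge c); apply: nearW => k; exact: h.
Qed.

(** The quantity J(e, x) of the overview, with the frequency given by its coordinates. *)
Definition heat F (e : R) x : R :=
  \int[leb]_u (F (nsq u) * (cos (lform x u) * expR (- (e * nsq u)))).

(** Fourier transform, without normalizing constant, of exp(-tau |u|^2) at a frequency of squared
    norm X. The function exp(-s r) contributes it at tau = s + e. *)
Definition kap (tau X : R) : R :=
  Num.sqrt (pi / tau) ^+ n * expR (- (X / (4 * tau))).

Definition vsq x : R := \sum_i x i ^+ 2.

Lemma integrable_heat_kernel e x : 0 < e ->
  leb.-integrable setT (EFin \o (fun u => cos (lform x u) * expR (- (e * nsq u)))).
Proof.
move=> e0; have := integrable_cos_gaussN 0 x (fun=> 0) e0.
by under eq_fun do rewrite add0r.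
Qed.

Lemma integral_heat_kernel e x : 0 < e ->
  (\int[leb]_u (cos (lform x u) * expR (- (e * nsq u)))%:E = (kap e (vsq x))%:E)%E.
Proof.
move=> e0; have := integral_cos_gaussN 0 x (fun=> 0) e0.
under eq_integral do rewrite add0r.
move=> ->; rewrite big1 ?addr0 ?cos0 ?mul1r// => i _.
by rewrite mulr0.
Qed.

Lemma heat_exp s e x : 0 <= s -> 0 < e ->
  heat (fun r => expR (- (s * r))) e x = kap (s + e) (vsq x).
Proof.
move=> s0 e0; rewrite /heat /Rintegral.
have E u : expR (- (s * nsq u)) * (cos (lform x u) * expR (- (e * nsq u))) =
    cos (lform x u) * expR (- ((s + e) * nsq u)).
  by rewrite mulrCA -expRD -opprD mulrDl.
under eq_integral do rewrite E.
by rewrite integral_heat_kernel// ltr_wpDl.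
Qed.

(* Both sides are linear in [F], and for [F r = exp (- s r)] the inequality is
   the one assumed between kernels. *)
Lemma heat_transfer F a1 a2 a3 e1 e2 e3 x1 x2 x3 : cmono F ->
  0 < e1 -> 0 < e2 -> 0 < e3 ->
  (forall s, 0 <= s -> a1 * kap (s + e1) (vsq x1) <=
     a2 * kap (s + e2) (vsq x2) + a3 * kap (s + e3) (vsq x3)) ->
  a1 * heat F e1 x1 <= a2 * heat F e2 x2 + a3 * heat F e3 x3.
Proof.
move=> cF e10 e20 e30 H.
pose k e x u := cos (lform x u) * expR (- (e * nsq u)).
pose psi u := (a2 * k e2 x2 u + a3 * k e3 x3 u) - a1 * k e1 x1 u.
have ik a e x : 0 < e -> leb.-integrable setT (EFin \o (fun u => a * k e x u)).
  by move=> e0; exact: (integrableZl measurableT a (integrable_heat_kernel x e0)).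
have ipsi : leb.-integrable setT (EFin \o psi).
  apply: integrableB_EFin; last exact: ik.
  by apply: integrableD_EFin; exact: ik.
have E G : cmono G -> \int[leb]_u (G (nsq u) * psi u) =
    (a2 * heat G e2 x2 + a3 * heat G e3 x3) - a1 * heat G e1 x1.
  move=> cG.
  have ig a e x : 0 < e -> leb.-integrable setT (EFin \o (fun u => G (nsq u) * (a * k e x u))).
    by move=> e0; apply: cmono_integrable => //; exact: ik.
  have hE a e x : 0 < e -> \int[leb]_u (G (nsq u) * (a * k e x u)) = a * heat G e x.
    move=> e0; rewrite /heat -RintegralZl//.
      by apply: eq_Rintegral => u _; rewrite mulrCA.
    by apply: cmono_integrable => //; exact: integrable_heat_kernel.
  rewrite -!hE// -RintegralD ?ig// -RintegralB ?ig//.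
    by apply: eq_Rintegral => u _; rewrite /psi mulrBr mulrDr.
  by apply: integrableD_EFin; exact: ig.
rewrite -subr_ge0 -E//; apply: cmono_functional_ge0 => // s s0.
by rewrite (E (fun r => expR (- (s * r))) (cmono_exp s0)) !heat_exp// subr_ge0 H.
Qed.

Lemma kap_gt0 tau X : 0 < tau -> 0 < kap tau X.
Proof.
by move=> t0; rewrite mulr_gt0 ?expR_gt0// exprn_gt0// sqrtr_gt0 divr_gt0 ?pi_gt0.
Qed.

End Transfer.

(** * Inequalities between Gaussian kernels, uniform in the mixing parameter s *)

Section KernelInequalities.
Context {R : realType} {n : nat}.
Local Notation kap := (@kap R n).

(** Raising tau by d shrinks the prefactor by at most exp(n d / (2 tau)), since 1 + x <= exp(x). The
    gain (X0 - X1) / (4 tau) in the exponent pays for it, whatever tau is; whence the threshold 2 n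
    d. *)
Lemma kap_le_shift (tau d X0 X1 : R) : 0 < tau -> 0 <= d -> 0 <= X1 ->
  2 * n%:R * d <= X0 - X1 -> kap tau X0 <= kap (tau + d) X1.
Proof.
move=> t0 d0 X10 dX; have td0 : 0 < tau + d by rewrite ltr_pwDl.
rewrite /kap.
have -> : Num.sqrt (pi / tau) = Num.sqrt (pi / (tau + d)) * Num.sqrt ((tau + d) / tau) :> R.
  rewrite -sqrtrM ?divr_ge0 ?pi_ge0 ?(ltW td0)//; congr Num.sqrt.
  by field; rewrite !lt0r_neq0.
rewrite exprMn -mulrA ler_wpM2l ?exprn_ge0//.
have sq1 : Num.sqrt ((tau + d) / tau) <= expR (d / (2 * tau)).
  rewrite -ler_sqr ?nnegrE ?expR_ge0// sqr_sqrtr; last by rewrite divr_ge0 ?ltW.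
  rewrite -expRM_natl mulrDl divff ?lt0r_neq0//.
  by rewrite (_ : 2 * _ = d / tau) ?expR_ge1Dx//; field; exact: lt0r_neq0.
apply: (@le_trans _ _ (expR (d / (2 * tau)) ^+ n * expR (- (X0 / (4 * tau))))).
  by rewrite ler_wpM2r ?expR_ge0// lerXn2r// nnegrE ?expR_ge0.
rewrite -expRM_natl -expRD ler_expR.
have le1 : X1 / (4 * (tau + d)) <= X1 / (4 * tau).
  by rewrite ler_wpM2l// lef_pV2 ?posrE ?mulr_gt0// ler_pM2l// lerDl.
apply: (@le_trans _ _ (- (X1 / (4 * tau)))); last by rewrite lerN2.
rewrite -subr_ge0.
have -> : - (X1 / (4 * tau)) - (n%:R * (d / (2 * tau)) - X0 / (4 * tau)) =
   (X0 - X1 - 2 * n%:R * d) / (4 * tau) by field; exact: lt0r_neq0.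
by rewrite divr_ge0 ?subr_ge0// mulr_ge0 ?ltW.
Qed.

Lemma sqrt_pi_div_le (s t c : R) : 0 < s -> 0 < t -> 0 <= c -> t <= c * s ->
  Num.sqrt (pi / s) ^+ n <= Num.sqrt c ^+ n * Num.sqrt (pi / t) ^+ n.
Proof.
move=> s0 t0 c0 tcs; rewrite -exprMn lerXn2r ?nnegrE ?mulr_ge0 ?sqrtr_ge0//.
rewrite -sqrtrM// ler_wsqrtr// mulrCA ler_pM2l ?pi_gt0//.
by rewrite ler_pdivlMr// mulrC ler_pdivrMr.
Qed.

(** If s + c l2 <= (1 + delta)(s + e), the larger squared norm (1 + delta) l2 compensates the larger
    time in the exponent, and the first term suffices. Otherwise s < c l2 / delta, so the time is at
    most c (1 + 1/delta) l2 and the left side is exponentially small; the kernel at squared norm 0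
    absorbs it. *)
Lemma kap_le_far (c delta l2 s e : R) : 0 < c -> c <= 1 -> 0 < delta -> 0 < l2 ->
  0 <= s -> 0 < e -> e <= c * l2 ->
  kap (s + c * l2) ((1 + delta) * l2) <= kap (s + e) l2 +
   Num.sqrt c^-1 ^+ n * expR (- (4 * (c * (1 + delta^-1)))^-1) * kap (s + l2) 0.
Proof.
move=> c0 c1 d0 l0 s0 e0 ec.
have cl0 : 0 < c * l2 by exact: mulr_gt0.
have T0 : 0 < s + c * l2 by rewrite ltr_wpDl.
have se0 : 0 < s + e by rewrite ltr_wpDl.
have sl0 : 0 < s + l2 by rewrite ltr_wpDl.
have [le_d|lt_d] := leP (c * l2 - e) ((s + e) * delta).
  apply: (@le_trans _ _ (kap (s + e) l2)); last first.
    by rewrite lerDl mulr_ge0 ?(ltW (kap_gt0 _ _))// mulr_ge0 ?exprn_ge0 ?expR_ge0.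
  rewrite /kap ler_pM ?exprn_ge0 ?expR_ge0 ?sqrtr_ge0//.
    rewrite lerXn2r ?nnegrE// ler_wsqrtr// ler_pM2l ?pi_gt0//.
    by rewrite lef_pV2 ?posrE// lerD2l.
  rewrite ler_expR lerN2 ler_pdivrMr ?mulr_gt0// mulrAC ler_pdivlMr ?mulr_gt0//.
  nra.
apply: (@le_trans _ _ (Num.sqrt c^-1 ^+ n * expR (- (4 * (c * (1 + delta^-1)))^-1) * kap (s + l2) 0)); last first.
  by rewrite lerDr ltW// kap_gt0.
rewrite /kap mul0r oppr0 expR0 mulr1 [leRHS]mulrAC.
rewrite ler_pM ?exprn_ge0 ?expR_ge0 ?sqrtr_ge0//.
  apply: sqrt_pi_div_le => //; first by rewrite invr_ge0 ltW.
  rewrite mulrDr mulrA mulVf ?mul1r ?lt0r_neq0// lerD2r.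
  by rewrite ler_peMl// invf_ge1.
rewrite ler_expR lerN2.
have dV : 0 < 1 + delta^-1 by rewrite ltr_pwDl// invr_ge0 ltW.
have TT : s + c * l2 <= c * (1 + delta^-1) * l2.
  have : s <= c * l2 / delta by rewrite ler_pdivlMr//; nra.
  by rewrite mulrDr mulr1 mulrDl (mulrAC c delta^-1); lra.
apply: (@le_trans _ _ (l2 / (4 * (s + c * l2)))).
  rewrite ler_pdivlMr ?mulr_gt0// mulrC ler_pdivrMr ?mulr_gt0//.
  by rewrite [leRHS]mulrC -[leRHS]mulrA ler_pM2l.
rewrite ler_wpM2r ?invr_ge0 ?mulr_ge0 ?(ltW T0)//.
by rewrite ler_peMl ?(ltW l0)// lerDl ltW.
Qed.

(** If s >= s1 l2, the exponential of the kernel at squared norm l2 is at least exp(-1/(4 s1)), so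
    it nearly equals the centered one. If s < s1 l2, then s + l2 <= ((1 + s1)/E)(s + E l2) and the
    second term suffices. *)
Lemma kap_le_centered (E s1 l2 s e : R) : 0 < E -> 0 < s1 -> 0 < l2 ->
  0 <= s -> 0 < e -> e <= E * l2 ->
  kap (s + E * l2) 0 <= expR (4 * s1)^-1 * kap (s + e) l2 +
   Num.sqrt ((1 + s1) / E) ^+ n * kap (s + l2) 0.
Proof.
move=> E0 s10 l0 s0 e0 eE.
have El0 : 0 < E * l2 by exact: mulr_gt0.
have T0 : 0 < s + E * l2 by rewrite ltr_wpDl.
have se0 : 0 < s + e by rewrite ltr_wpDl.
have sl0 : 0 < s + l2 by rewrite ltr_wpDl.
rewrite /kap !mul0r !oppr0 !expR0 !mulr1.
have [le_s|lt_s] := leP (s1 * l2) s.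
  rewrite ler_wpDr ?mulr_ge0 ?exprn_ge0//.
  have s2 : 0 < s by apply: lt_le_trans le_s; exact: mulr_gt0.
  rewrite mulrCA -[leLHS]mulr1 ler_pM ?exprn_ge0//.
    rewrite lerXn2r ?nnegrE// ler_wsqrtr// ler_pM2l ?pi_gt0//.
    by rewrite lef_pV2 ?posrE// lerD2l.
  rewrite -expRD -[leLHS]expR0 ler_expR subr_ge0.
  rewrite ler_pdivrMr ?mulr_gt0// [leRHS]mulrC ler_pdivlMr ?mulr_gt0//; lra.
rewrite ler_wpDl ?mulr_ge0 ?expR_ge0 ?exprn_ge0//.
apply: sqrt_pi_div_le => //; first by rewrite divr_ge0 ?ltW// ltr_wpDl.
rewrite mulrAC ler_pdivlMr//; nra.
Qed.

End KernelInequalities.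

(** * Bounds on the spectral density by regularized values *)

Section Sandwich.
Context {R : realType} {n : nat}.
Implicit Types (F : R -> R) (x z : 'I_n -> R).

(** The common form to which the three kinds of spectral density are reduced, with L = (2 pi)^n
    S(x). *)
Definition heat_limit F x (L : R) :=
  heat F (k.+1%:R^-1) x @[k --> \oo] --> L.

Lemma vsq_ge0 x : 0 <= vsq x.
Proof. by apply: sumr_ge0 => i _; exact: sqr_ge0. Qed.

Lemma near_harmonic_le (e : R) : 0 < e ->
  \forall k \near \oo, 0 < (k.+1%:R^-1 : R) <= e.
Proof.
move=> e0; near=> k; rewrite invr_gt0 ltr0n/=.
by near: k; exact: (cvgr_le 0 (@cvg_harmonic R) e e0).
Unshelve. all: by end_near. Qed.

(** Upper bound on L: [kap_le_shift] is applied with d = e - 1/(k+1), once this is nonnegative, and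
    the bound passes to the limit. *)
Lemma heat_limit_le F x0 x1 e L : cmono F -> heat_limit F x0 L -> 0 < e ->
  2 * n%:R * e <= vsq x0 - vsq x1 -> L <= heat F e x1.
Proof.
move=> cF HL e0 ex; apply: (cvgr_to_le HL).
apply: filterS (near_harmonic_le e0) => k /andP[k0 ke].
have := @heat_transfer R n F 1 1 0 k.+1%:R^-1 e e x0 x1 x1 cF k0 e0 e0.
rewrite !mul0r !mul1r !addr0; apply => s s0.
rewrite !mul0r !mul1r !addr0.
have -> : s + e = (s + k.+1%:R^-1) + (e - k.+1%:R^-1) by ring.
apply: kap_le_shift; rewrite ?subr_ge0// ?vsq_ge0//; first by rewrite ltr_wpDl.
apply: le_trans ex; rewrite ler_wpM2l// ?mulr_ge0//.
by rewrite gerBl ltW.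
Qed.

(** Lower bound on L by a value at a slightly larger frequency. The error factor is small as soon as
    c (1 + 1/delta) is. *)
Lemma heat_limit_ge_far F x0 x1 z L (c delta l2 : R) : cmono F ->
  heat_limit F x0 L -> 0 < c -> c <= 1 -> 0 < delta -> 0 < l2 ->
  vsq x0 = l2 -> vsq x1 = (1 + delta) * l2 -> vsq z = 0 ->
  heat F (c * l2) x1 <= L +
   Num.sqrt c^-1 ^+ n * expR (- (4 * (c * (1 + delta^-1)))^-1) * heat F l2 z.
Proof.
move=> cF HL c0 c1 d0 l0 vx0 vx1 vz.
rewrite -lerBlDr; apply: (cvgr_to_ge HL).
have cl0 : 0 < c * l2 by exact: mulr_gt0.
apply: filterS (near_harmonic_le cl0) => k /andP[k0 ke].
rewrite lerBlDr.
have := @heat_transfer R n F 1 1 (Num.sqrt c^-1 ^+ n * expR (- (4 * (c * (1 + delta^-1)))^-1))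
  (c * l2) k.+1%:R^-1 l2 x1 x0 z cF cl0 k0 l0.
rewrite !mul1r; apply => s s0.
by rewrite !mul1r vx0 vx1 vz; exact: kap_le_far.
Qed.

(** Lower bound on L by a value at frequency 0. It is sharp when s1 is large and E is much larger
    than 1 + s1. *)
Lemma heat_limit_ge_centered F x0 z L (E s1 l2 : R) : cmono F ->
  heat_limit F x0 L -> 0 < E -> 0 < s1 -> 0 < l2 ->
  vsq x0 = l2 -> vsq z = 0 ->
  heat F (E * l2) z <= expR (4 * s1)^-1 * L +
   Num.sqrt ((1 + s1) / E) ^+ n * heat F l2 z.
Proof.
move=> cF HL E0 s10 l0 vx0 vz.
rewrite -lerBlDr; apply: (cvgr_to_ge (cvgMl_tmp (a := expR (4 * s1)^-1) HL)).
have El0 : 0 < E * l2 by exact: mulr_gt0.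
apply: filterS (near_harmonic_le El0) => k /andP[k0 ke].
rewrite lerBlDr.
have := @heat_transfer R n F 1 (expR (4 * s1)^-1) (Num.sqrt ((1 + s1) / E) ^+ n)
  (E * l2) k.+1%:R^-1 l2 z x0 z cF El0 k0 l0.
rewrite !mul1r; apply => s s0.
by rewrite !mul1r vx0 vz; exact: kap_le_centered.
Qed.

End Sandwich.

Section Squeeze.
Context {R : realType}.

(** The limits are taken in order: k is fixed first so that the bounds are within eta/2 of ell, then
    r tends to 0. As the bounds depend on x only through r, the conclusion is uniform over all x of
    radius r. *)
Lemma unif_squeeze (X : Type) (rad : X -> R -> Prop) (f : X -> R -> R)
    (lo hi : nat -> R -> R) (l h : nat -> R) (ell : R) :
  (forall k, \forall r \near 0^'+, forall x, rad x r -> lo k r <= f x r <= hi k r) ->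
  (forall k, lo k r @[r --> 0^'+] --> l k) ->
  (forall k, hi k r @[r --> 0^'+] --> h k) ->
  l k @[k --> \oo] --> ell -> h k @[k --> \oo] --> ell ->
  forall eta, 0 < eta ->
  \forall r \near 0^'+, forall x, rad x r -> `|f x r - ell| < eta.
Proof.
move=> lh cl ch ll hl eta eta0.
have e2 : 0 < eta / 2 by rewrite divr_gt0.
have N1 : \forall k \near \oo, ell - eta / 2 < l k.
  by apply: (cvgr_gt ell ll); rewrite ltrBlDr ltrDl.
have N2 : \forall k \near \oo, h k < ell + eta / 2.
  by apply: (cvgr_lt ell hl); rewrite ltrDl.
have [k [k1 k2]] := @filter_ex _ _ _ _ (filterI N1 N2).
have M1 : \forall r \near 0^'+, l k - eta / 2 < lo k r.
  by apply: (cvgr_gt (l k) (cl k)); rewrite ltrBlDr ltrDl.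
have M2 : \forall r \near 0^'+, hi k r < h k + eta / 2.
  by apply: (cvgr_lt (h k) (ch k)); rewrite ltrDl.
apply: filterS3 M1 M2 (lh k) => r r1 r2 H x /H /andP[H1 H2].
rewrite ltr_norml; apply/andP; split; lra.
Qed.

Lemma cvg_exprn_expRN (m : nat) (c : R) : 0 < c ->
  (k.+1%:R ^+ m * expR (- (c * k.+1%:R)) : R) @[k --> \oo] --> (0 : R).
Proof.
move=> c0; pose K : R := m.+1`!%:R / c ^+ m.+1.
apply: (squeeze_cvgr (f := cst 0) (h := fun k => K * k.+1%:R^-1)); last 2 first.
- exact: cvg_cst.
- by rewrite -(mulr0 K); apply: cvgMl_tmp; exact: cvg_harmonic.
apply: nearW => k; rewrite mulr_ge0 ?expR_ge0 ?exprn_ge0//=.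
have x0 : 0 <= c * k.+1%:R :> R by rewrite mulr_ge0// ltW.
rewrite expRN ler_pdivrMr ?expR_gt0//.
have := expR_ge1Dxn m x0; move/(le_trans _) => /(_ ((c * k.+1%:R) ^+ m.+1 / m.+1`!%:R)).
rewrite lerDr ler01 => /(_ isT) H.
have K0 : 0 <= K by rewrite divr_ge0// exprn_ge0// ltW.
apply: (@le_trans _ _ (K * k.+1%:R^-1 * ((c * k.+1%:R) ^+ m.+1 / m.+1`!%:R))).
  rewrite /K exprMn le_eqVlt; apply/orP; left; apply/eqP.
  rewrite [in RHS](exprS k.+1%:R); field.
  by rewrite !lt0r_neq0 ?exprn_gt0 ?ltr0n ?fact_gt0.
by rewrite ler_wpM2l// mulr_ge0 ?invr_ge0.
Qed.

End Squeeze.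

(** * Two Tauberian theorems *)

Section Tauberian.
Context {R : realType} {n : nat}.
Hypothesis n0 : (0 < n)%N.
Variables (F : R -> R) (St : ('I_n -> R) -> R) (N : R -> R) (ell : R).
Hypothesis cF : cmono F.
Hypothesis HS : forall x, 0 < vsq x -> heat_limit F x (St x).
Hypothesis N0 : forall r, 0 < r < 1 -> 0 < N r.

Let zero : 'I_n -> R := fun=> 0.

Let vsq_zero : vsq zero = 0.
Proof. by rewrite /vsq big1// => i _; rewrite expr0n. Qed.

Let near01 : \forall r \near (0 : R)^'+, 0 < r < 1.
Proof.
near=> r; apply/andP; split; first by near: r; exact: nbhs_right_gt.
by near: r; exact: nbhs_right_lt.
Unshelve. all: by end_near. Qed.

Let cvgV : (k.+1%:R^-1 : R) @[k --> \oo] --> (0 : R).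
Proof. exact: cvg_harmonic. Qed.

(** The limit at time c r^2 is the same for every c, so the frequency may be moved to 0 and the time
    multiplied by any constant, at no cost in the limit. *)
Lemma tauberian_centered :
  (forall c, 0 < c -> heat F (c * r ^+ 2) zero / N r @[r --> 0^'+] --> ell) ->
  forall eta, 0 < eta ->
  \forall r \near 0^'+, forall x, vsq x = r ^+ 2 -> `|St x / N r - ell| < eta.
Proof.
move=> HN.
(* Lower bound: s1 tends to infinity so that exp(-1/(4 s1)) tends to 1, and E is chosen so that the
   error factor ((1 + s1)/E)^(n/2) is exactly (k+1)^(-n). The upper bound uses e = r^2/(2 n), the
   largest time [heat_limit_le] allows at frequency 0. *)
pose s1 k : R := k.+1%:R.
pose E k : R := (1 + k.+1%:R) * k.+1%:R ^+ 2.
pose B k : R := (k.+1%:R^-1) ^+ n.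
have E0 k : 0 < E k by rewrite mulr_gt0 ?exprn_gt0// ltr_wpDl.
have BE k : Num.sqrt ((1 + s1 k) / E k) ^+ n = B k.
  rewrite /E /s1 invfM mulrA divff ?mul1r; last by rewrite lt0r_neq0// ltr_wpDl.
  by rewrite -exprVn sqrtr_sqr ger0_norm// invr_ge0.
have cB : B k @[k --> \oo] --> (0 : R).
  apply: (squeeze_cvgr _ (cvg_cst 0) cvgV); apply: nearW => k.
  rewrite exprn_ge0 ?invr_ge0//=.
  by rewrite -[leRHS]expr1 ler_wiXn2l ?invr_ge0// invf_le1// ler1n.
have cE : expR (- (4 * s1 k)^-1) @[k --> \oo] --> (1 : R).
  have c0 : - (4 * s1 k)^-1 @[k --> \oo] --> (0 : R).
    rewrite -[X in _ --> X]oppr0; apply: cvgN; under eq_fun do rewrite invfM.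
    by rewrite -(mulr0 (4^-1)); apply: cvgMl_tmp; exact: cvgV.
  by have := cvg_comp _ _ c0 (@continuous_expR R 0); rewrite expR0.
apply: (unif_squeeze
  (lo := fun k r => expR (- (4 * s1 k)^-1) * (heat F (E k * r ^+ 2) zero / N r - B k * (heat F (1 * r ^+ 2) zero / N r)))
  (hi := fun k r => heat F ((2 * n%:R)^-1 * r ^+ 2) zero / N r)
  (l := fun k => expR (- (4 * s1 k)^-1) * (ell - B k * ell))
  (h := fun k => ell)).
- move=> k; apply: filterS near01 => r r01 x xr; have /andP[r0 _] := r01.
  have Nr := N0 r01.
  have r20 : 0 < r ^+ 2 by rewrite exprn_gt0.
  have vx : 0 < vsq x by rewrite xr.
  have n20 : 0 < 2 * n%:R :> R by rewrite mulr_gt0// ltr0n.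
  apply/andP; split; last first.
    rewrite ler_pM2r ?invr_gt0//; apply: (heat_limit_le cF (HS vx)).
      by rewrite mulr_gt0 ?invr_gt0.
    by rewrite vsq_zero subr0 xr mulrA divff ?mul1r// lt0r_neq0.
  have s10 : 0 < s1 k by rewrite ltr0n.
  have := heat_limit_ge_centered cF (HS vx) (E0 k) s10 r20 xr vsq_zero.
  rewrite BE mul1r => H.
  rewrite [leLHS](_ : _ = expR (- (4 * s1 k)^-1) *
    (heat F (E k * r ^+ 2) zero - B k * heat F (r ^+ 2) zero) / N r); last by ring.
  rewrite ler_pM2r ?invr_gt0// expRN mulrC ler_pdivrMr ?expR_gt0//.
  by rewrite lerBlDr (mulrC (St x)).
- move=> k; apply: cvgMl_tmp; apply: cvgB; first exact: HN.
  by apply: cvgMl_tmp; apply: HN.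
- by move=> k; apply: HN; rewrite invr_gt0 mulr_gt0// ltr0n.
- rewrite [X in _ --> X](_ : _ = 1 * (ell - 0 * ell)); last by rewrite mul0r subr0 mul1r.
  apply: cvgM => //; apply: cvgB; first exact: cvg_cst.
  exact: cvgMr_tmp.
- exact: cvg_cst.
Qed.

(** A representative frequency of squared norm Y; by rotation invariance only the norm matters in
    the kernels. *)
Definition axis (Y : R) : 'I_n -> R := fun i => if (i : nat) == 0%N then Num.sqrt Y else 0.

Lemma vsq_axis Y : 0 <= Y -> vsq (axis Y) = Y.
Proof.
move=> Y0; rewrite /vsq /axis; case: n n0 => // m _.
rewrite big_ord_recl big1 ?addr0; first by rewrite sqr_sqrtr.
by move=> i _; rewrite expr0n.
Qed.

Let power_exp_harmonic :
  (k.+1%:R ^+ n * expR (- (8^-1 * k.+1%:R)) : R) @[k --> \oo] --> (0 : R).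
Proof. by apply: cvg_exprn_expRN; rewrite invr_gt0. Qed.

(** Here the limits [L c Y] genuinely depend on the time c r^2 and on the squared norm Y r^2 of the
    frequency. Both bounds on S are of this form up to an error, and they meet when c tends to 0 and
    Y to 1. *)
Lemma tauberian_shifted (L : R -> R -> R) :
  (forall c Y, 0 < c -> 0 <= Y ->
    heat F (c * r ^+ 2) (axis (Y * r ^+ 2)) / N r @[r --> 0^'+] --> L c Y) ->
  (forall c Y : nat -> R, (forall k, 0 < c k <= 1) -> (forall k, 2^-1 <= Y k <= 2) ->
    c k @[k --> \oo] --> (0 : R) -> Y k @[k --> \oo] --> (1 : R) ->
    L (c k) (Y k) @[k --> \oo] --> ell) ->
  forall eta, 0 < eta ->
  \forall r \near 0^'+, forall x, vsq x = r ^+ 2 -> `|St x / N r - ell| < eta.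
Proof.
move=> HN HL.
(* With delta = 1/(k+1) and c = delta^2, c (1 + 1/delta) = delta^2 + delta <= 2 delta. The error
   factor is then at most (k+1)^n exp(-(k+1)/8), which tends to 0. *)
pose dl k : R := k.+1%:R^-1.
have dl01 k : 0 < dl k <= 1 by rewrite invr_gt0 ltr0n/= invf_le1// ler1n.
pose c k := dl k ^+ 2.
have c01 k : 0 < c k <= 1.
  by have /andP[d0 d1] := dl01 k; rewrite exprn_gt0//= exprn_ile1// ltW.
pose B k := Num.sqrt (c k)^-1 ^+ n * expR (- (4 * (c k * (1 + (dl k)^-1)))^-1).
have n20 : 0 < 2 * n%:R :> R by rewrite mulr_gt0// ltr0n.
have n21 : 1 <= 2 * n%:R :> R by rewrite -natrM ler1n muln_gt0.
(* The upper bound spends exactly what [heat_limit_le] allows: 2 n [cu] = 1 - [Yu]. The index k+2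
   keeps [Yu] at least 1/2. *)
pose cu k := (2 * n%:R)^-1 * k.+2%:R^-1 : R.
have cu01 k : 0 < cu k <= 1.
  have q1 : 1 <= 2 * n%:R * k.+2%:R :> R by apply: mulr_ege1 => //; rewrite ler1n.
  rewrite /cu -invfM invr_gt0 invf_le1 ?q1 ?andbT; exact: lt_le_trans q1.
pose Yu k := 1 - k.+2%:R^-1 : R.
have k2 k : 0 < (k.+2%:R^-1 : R) <= 2^-1.
  by rewrite invr_gt0 ltr0n/= lef_pV2 ?posrE// ler_nat.
have cV2 : (k.+2%:R^-1 : R) @[k --> \oo] --> (0 : R).
  by have := cvgV; rewrite -(cvg_shiftS (fun k => k.+1%:R^-1 : R)).
have cdl : dl k @[k --> \oo] --> (0 : R) by exact: cvgV.
have cc : c k @[k --> \oo] --> (0 : R).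
  rewrite /c -(mulr0 (0 : R)); under eq_fun do rewrite expr2.
  exact: cvgM.
have cB : B k @[k --> \oo] --> (0 : R).
  apply: (squeeze_cvgr _ (cvg_cst 0) power_exp_harmonic); apply: nearW => k.
  have /andP[d0 d1] := dl01 k.
  rewrite /B mulr_ge0 ?exprn_ge0 ?expR_ge0//=.
  rewrite /c -exprVn /dl invrK sqrtr_sqr ger0_norm//.
  rewrite ler_wpM2l ?exprn_ge0// ler_expR lerN2.
  rewrite (mulrC 8^-1) -[leLHS]invrK lef_pV2 ?posrE.
  - rewrite invf_div.
    have -> : (k.+1%:R^-1) ^+ 2 * (1 + k.+1%:R) = dl k ^+ 2 + dl k :> R.
      by rewrite mulrDr mulr1; congr (_ + _); rewrite expr2 -mulrA mulVf ?mulr1.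
    have : dl k ^+ 2 <= dl k by rewrite expr2 ler_piMl// ltW.
    rewrite -/(dl k); lra.
  - by rewrite invr_gt0 divr_gt0.
  - by rewrite !mulr_gt0 ?exprn_gt0 ?invr_gt0// ltr_wpDl.
apply: (unif_squeeze
  (lo := fun k r => heat F (c k * r ^+ 2) (axis ((1 + dl k) * r ^+ 2)) / N r - B k * (heat F (1 * r ^+ 2) (axis (0 * r ^+ 2)) / N r))
  (hi := fun k r => heat F (cu k * r ^+ 2) (axis (Yu k * r ^+ 2)) / N r)
  (l := fun k => L (c k) (1 + dl k) - B k * L 1 0)
  (h := fun k => L (cu k) (Yu k))).
- move=> k; apply: filterS near01 => r r01 x xr; have /andP[r0 _] := r01.
  have Nr := N0 r01.
  have r20 : 0 < r ^+ 2 by rewrite exprn_gt0.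
  have vx : 0 < vsq x by rewrite xr.
  have /andP[d0 d1] := dl01 k; have /andP[ck0 ck1] := c01 k.
  have /andP[cuk0 cuk1] := cu01 k; have /andP[k20 k21] := k2 k.
  have Yu0 : 0 <= Yu k by rewrite subr_ge0 (le_trans k21)// invf_le1// ler1n.
  apply/andP; split; last first.
    rewrite ler_pM2r ?invr_gt0//; apply: (heat_limit_le cF (HS vx)).
      by rewrite mulr_gt0.
    have vy : vsq (axis (Yu k * r ^+ 2)) = Yu k * r ^+ 2.
      by rewrite vsq_axis// mulr_ge0// ltW.
    rewrite vy xr /Yu /cu.
    rewrite le_eqVlt; apply/orP; left; apply/eqP.
    have nn : n%:R != 0 :> R by rewrite pnatr_eq0 -lt0n.
    have kk : k.+2%:R != 0 :> R by rewrite pnatr_eq0.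
    move: (k.+2%:R : R) kk => kk kk0; field.
    by rewrite nn kk0.
  have vd : vsq (axis ((1 + dl k) * r ^+ 2)) = (1 + dl k) * r ^+ 2.
    by rewrite vsq_axis// mulr_ge0// ?(ltW r20)// addr_ge0// ltW.
  have vz : vsq (axis (0 * r ^+ 2)) = 0 by rewrite mul0r vsq_axis.
  have := heat_limit_ge_far cF (HS vx) ck0 ck1 d0 r20 xr vd vz.
  rewrite -/(B k) mul1r => H.
  rewrite (mulrA (B k)) -mulrBl ler_pM2r ?invr_gt0//.
  by rewrite lerBlDr.
- move=> k; have /andP[d0 d1] := dl01 k; have /andP[ck0 ck1] := c01 k.
  apply: cvgB; first by apply: HN => //; rewrite addr_ge0// ltW.
  by apply: cvgMl_tmp; apply: HN.
- move=> k; have /andP[cuk0 cuk1] := cu01 k; have /andP[k20 k21] := k2 k.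
  by apply: HN => //; rewrite subr_ge0 (le_trans k21)// invf_le1// ler1n.
- rewrite [X in _ --> X](_ : _ = ell - 0 * L 1 0); last by rewrite mul0r subr0.
  apply: cvgB; last exact: cvgMr_tmp.
  apply: HL => //.
    by move=> k; have /andP[d0 d1] := dl01 k; apply/andP; split; lra.
  rewrite -[X in _ --> X]addr0; apply: cvgD => //; exact: cvg_cst.
- apply: HL => //.
  + move=> k; have := k2 k; rewrite /Yu.
    by move: (k.+2%:R^-1 : R) => z /andP[z0 z1]; apply/andP; split; lra.
  + by rewrite -(mulr0 ((2 * n%:R)^-1)); apply: cvgMl_tmp.
  + by rewrite -[X in _ --> X]subr0; apply: cvgB => //; exact: cvg_cst.
Qed.

End Tauberian.

(** * Regularization of spectral densities *)

Section SchwartzGaussian.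
Context {R : realType} {n : nat}.
Implicit Types (f g : 'rV[R]_n -> R) (a v x w : 'rV[R]_n).

Lemma is_derive_line f a v (df : R) :
  is_derive (0 : R) (1 : R) (fun h : R => f (h *: v + a)) df ->
  is_derive a v f df.
Proof.
move=> [d1 d2]; apply: DeriveDef; first exact/derivable1P.
rewrite -d2 /derive.
rewrite [X in _ = lim (X @ _)](_ : _ = fun h => h^-1 *: ((f \o shift a) (h *: v) - f a))//.
by apply/funext => h /=; rewrite addr0 scale0r add0r /GRing.scale/= mulr1.
Qed.

Lemma is_derive_coord i a v : is_derive a v (fun x : 'rV[R]_n => x 0 i) (v 0 i).
Proof.
apply: is_derive_line.
rewrite (_ : (fun h => _) = fun h : R => h * v 0 i + a 0 i); last first.
  by apply/funext => h; rewrite !mxE.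
by apply: is_derive_eq; rewrite /GRing.scale/=; ring.
Qed.

Definition rgauss (p : R) w x : R := expR (- (p * \sum_i (x 0 i - w 0 i) ^+ 2)).

Lemma is_derive_rgauss p w i a :
  is_derive a (delta_mx 0 i) (rgauss p w) (- (2 * p) * ((a 0 i - w 0 i) * rgauss p w a)).
Proof.
apply: is_derive_line.
pose c := \sum_(j | j != i) (a 0 j - w 0 j) ^+ 2.
rewrite (_ : (fun h => _) = fun h : R => expR (- (p * ((h + a 0 i - w 0 i) ^+ 2 + c)))); last first.
  apply/funext => h; rewrite /rgauss (bigD1 i)//= !mxE !eqxx mulr1; congr (expR (- (p * (_ + _)))).
  by apply: eq_bigr => j ji; rewrite !mxE (negbTE ji) andbF mulr0 add0r.
have d1 : is_derive (0:R) (1:R) (fun h : R => - (p * ((h + a 0 i - w 0 i) ^+ 2 + c))) (- (2 * p) * (a 0 i - w 0 i)).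
  by apply: is_derive_eq; rewrite /GRing.scale/=; ring.
have d2 := @is_derive1_comp _ expR (fun h : R => - (p * ((h + a 0 i - w 0 i) ^+ 2 + c))) 0 _ _ (is_derive_expR _) d1.
apply: (is_derive_eq d2).
rewrite /rgauss (bigD1 i)//= add0r -/c; ring.
Qed.

(** Polynomials times a Gaussian, as a class stable under partial derivatives: one induction gives
    smoothness of every order, another the decay. *)
Inductive gauss_poly (p : R) w : ('rV[R]_n -> R) -> Prop :=
| gauss_poly_base : gauss_poly p w (rgauss p w)
| gauss_poly_coord i f of gauss_poly p w f : gauss_poly p w (fun x => x 0 i * f x)
| gauss_poly_add f g of gauss_poly p w f & gauss_poly p w g :
    gauss_poly p w (fun x => f x + g x)
| gauss_poly_scale c f of gauss_poly p w f : gauss_poly p w (fun x => c * f x).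

Lemma gauss_poly_derive p w f i : gauss_poly p w f ->
  (forall x, derivable f x (delta_mx 0 i)) /\
  gauss_poly p w (fun x => 'D_(delta_mx 0 i) f x).
Proof.
suff H : gauss_poly p w f -> exists2 df : 'rV[R]_n -> R, gauss_poly p w df &
    forall x, is_derive x (delta_mx 0 i) f (df x).
  move=> /H[df gdf df_f]; split=> [x|]; first by have [] := df_f x.
  rewrite (_ : (fun x => _) = df)//; apply/funext => x.
  exact: derive_val.
elim=> {f}[|j f gf [df gdf fdf]|f g _ [df gdf fdf] _ [dg gdg gdg']|c f _ [df gdf fdf]].
- exists (fun x => - (2 * p) * (x 0 i * rgauss p w x + (- w 0 i) * rgauss p w x)).
    apply/gauss_poly_scale/gauss_poly_add.
      exact/gauss_poly_coord/gauss_poly_base.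
    exact/gauss_poly_scale/gauss_poly_base.
  move=> x; apply: is_derive_eq (is_derive_rgauss p w i x) _.
  by ring.
- exists (fun x => x 0 j * df x + (delta_mx 0 i : 'rV[R]_n) 0 j * f x).
    apply: gauss_poly_add; first exact: gauss_poly_coord.
    exact: gauss_poly_scale.
  move=> x; apply: is_derive_eq (is_deriveM (is_derive_coord j x _) (fdf x)) _.
  by rewrite /GRing.scale/= (mulrC (f x)).
- exists (fun x => df x + dg x); first exact: gauss_poly_add.
  by move=> x; exact: is_deriveD.
- exists (fun x => c * df x); first exact: gauss_poly_scale.
  by move=> x; exact: is_deriveZ.
Qed.

Lemma enormE2 x : enorm x ^+ 2 = \sum_i x 0 i ^+ 2.
Proof.
rewrite sqr_sqrtr; last by apply: sumr_ge0 => i _; rewrite -expr2 sqr_ge0.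
by apply: eq_bigr => i _; rewrite expr2.
Qed.

Lemma enorm_ge0 x : 0 <= enorm x. Proof. exact: sqrtr_ge0. Qed.

Lemma ler_coord_enorm x i : `|x 0 i| <= enorm x.
Proof.
rewrite -ler_sqr ?nnegrE ?enorm_ge0// real_normK ?num_real// enormE2.
by rewrite (bigD1 i)//= lerDl sumr_ge0// => j _; exact: sqr_ge0.
Qed.

Lemma rgauss_decay p w k : 0 < p ->
  exists M, forall x, enorm x ^+ k * `|rgauss p w x| <= M.
Proof.
move=> p0; pose W := \sum_i w 0 i ^+ 2.
(* |x - w|^2 >= |x|^2 / 2 - |w|^2 recenters the Gaussian at the origin, at the price of half the
   decay rate and the factor exp(p W). *)
pose q := p / 2; have q0 : 0 < q by rewrite divr_gt0.
exists (expR (p * W) * (1 + k.+1`!%:R / q ^+ k.+1)) => x.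
have eg : rgauss p w x <= expR (p * W) * expR (- (q * enorm x ^+ 2)).
  rewrite /rgauss -expRD ler_expR enormE2 /q -subr_ge0.
  have -> : p * W - p / 2 * (\sum_i x 0 i ^+ 2) - - (p * \sum_i (x 0 i - w 0 i) ^+ 2) =
      p * \sum_i (w 0 i ^+ 2 - x 0 i ^+ 2 / 2 + (x 0 i - w 0 i) ^+ 2).
    by rewrite big_split/= sumrB -mulr_suml -/W; ring.
  apply: mulr_ge0; first exact: ltW.
  apply: sumr_ge0 => i _.
  rewrite (_ : _ + _ = (x 0 i - 2 * w 0 i) ^+ 2 / 2); last by field.
  by rewrite divr_ge0 ?sqr_ge0.
rewrite ger0_norm ?expR_ge0//.
apply: (@le_trans _ _ (enorm x ^+ k * (expR (p * W) * expR (- (q * enorm x ^+ 2))))).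
  by rewrite ler_wpM2l ?exprn_ge0 ?enorm_ge0.
rewrite mulrCA ler_wpM2l ?expR_ge0//.
set y := enorm x; have y0 : 0 <= y := enorm_ge0 x.
rewrite expRN ler_pdivrMr ?expR_gt0//.
have qy0 : 0 <= q * y ^+ 2 by rewrite mulr_ge0 ?(ltW q0)// exprn_ge0.
have E1 : 1 + (q * y ^+ 2) ^+ k.+1 / k.+1`!%:R <= expR (q * y ^+ 2) by exact: expR_ge1Dxn.
have yk : y ^+ k <= 1 + (y ^+ 2) ^+ k.+1.
  have [y1|y1] := leP y 1.
    by rewrite (le_trans (exprn_ile1 _ y0 y1))// lerDl !exprn_ge0.
  rewrite -exprM ler_wpDl// ler_weXn2l ?(ltW y1)//.
  by rewrite mul2n -addnn addSn leqW// leq_addr.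
set K := k.+1`!%:R / q ^+ k.+1.
have K0 : 0 < K by rewrite divr_gt0 ?exprn_gt0// ltr0n fact_gt0.
have e2 : (q * y ^+ 2) ^+ k.+1 / k.+1`!%:R = (y ^+ 2) ^+ k.+1 / K.
  by rewrite exprMn /K invf_div mulrAC (mulrC _ (q ^+ _ / _)) mulrAC mulrC mulrA.
rewrite e2 in E1.
apply: (le_trans yk); apply: (@le_trans _ _ ((1 + K) * (1 + (y ^+ 2) ^+ k.+1 / K))); last first.
  by rewrite ler_wpM2l// addr_ge0// ltW.
rewrite mulrDr mulr1 mulrDl mul1r mulrCA divff ?lt0r_neq0// mulr1.
have : 0 <= (y ^+ 2) ^+ k.+1 / K by rewrite divr_ge0 ?(ltW K0)// !exprn_ge0.
by move: K0; lra.
Qed.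

Lemma gauss_poly_decay p w f k : 0 < p -> gauss_poly p w f ->
  exists M, forall x, enorm x ^+ k * `|f x| <= M.
Proof.
move=> p0 gf; elim: gf k => {f}[k|j f gf h k|f g _ h1 _ h2 k|c f _ h k].
- exact: rgauss_decay.
- have [M fM] := h k.+1; exists M => x; apply: le_trans (fM x).
  rewrite normrM mulrA exprSr ler_wpM2r// ler_wpM2l ?exprn_ge0 ?enorm_ge0//.
  exact: ler_coord_enorm.
- have [M fM] := h1 k; have [N gN] := h2 k; exists (M + N) => x.
  apply: le_trans (lerD (fM x) (gN x)); rewrite -mulrDr.
  by rewrite ler_wpM2l ?exprn_ge0 ?enorm_ge0// ler_normD.
- have [M fM] := h k; exists (`|c| * M) => x.
  by rewrite normrM mulrCA ler_wpM2l.
Qed.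

Lemma schwartz_gauss_poly p w f : 0 < p -> gauss_poly p w f -> schwartz f.
Proof.
move=> p0 gf.
have H s : gauss_poly p w (iter_partial s f).
  by elim: s => [//|i s ih] /=; have [] := gauss_poly_derive i ih.
split=> [s i x|s k]; first by have [+ _] := gauss_poly_derive i (H s); exact.
exact: gauss_poly_decay (H s).
Qed.

Lemma cschwartz_rgauss p w : 0 < p -> cschwartz (fun x => (rgauss p w x)%:C%C).
Proof.
move=> p0; split => /=; first exact: schwartz_gauss_poly (gauss_poly_base p w).
apply: (schwartz_gauss_poly (w := w) p0).
rewrite (_ : (fun _ => _) = (fun x => 0 * rgauss p w x)).
  exact/gauss_poly_scale/gauss_poly_base.
by apply/funext => x; rewrite mul0r.
Qed.

End SchwartzGaussian.

Section RealFubini.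
Context d1 d2 (T1 : measurableType d1) (T2 : measurableType d2) {R : realType}.
Variables (m1 : {sigma_finite_measure set T1 -> \bar R})
  (m2 : {sigma_finite_measure set T2 -> \bar R}).

Lemma Rfubini (f : T1 -> T2 -> R) :
  (forall x, m2.-integrable setT (EFin \o f x)) ->
  (forall y, m1.-integrable setT (EFin \o f^~ y)) ->
  (m1 \x m2)%E.-integrable setT (fun p => (f p.1 p.2)%:E) ->
  \int[m1]_x \int[m2]_y f x y = \int[m2]_y \int[m1]_x f x y.
Proof.
move=> i2 i1 i12; have := Fubini i12 => /= E.
rewrite /Rintegral; congr fine; transitivity (\int[m1]_x \int[m2]_y (f x y)%:E)%E.
  apply: eq_integral => x _; rewrite fineK//.
  exact: (integrable_fin_num measurableT (i2 x)).
rewrite E; apply: eq_integral => y _; rewrite fineK//.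
exact: (integrable_fin_num measurableT (i1 y)).
Qed.

Lemma integrable_tensor (g1 : T1 -> R) (g2 : T2 -> R) :
  m1.-integrable setT (EFin \o g1) -> m2.-integrable setT (EFin \o g2) ->
  (m1 \x m2)%E.-integrable setT (EFin \o (fun p => g1 p.1 * g2 p.2)).
Proof.
move=> ig1 ig2.
have /integrableP[/measurable_EFinP mg1 fg1] := ig1.
have /integrableP[/measurable_EFinP mg2 fg2] := ig2.
have mg : measurable_fun setT (fun p : T1 * T2 => g1 p.1 * g2 p.2).
  apply: measurable_funM.
    exact: (measurableT_comp mg1 measurable_fst).
  exact: (measurableT_comp mg2 measurable_snd).
have mn1 : measurable_fun setT (fun x => `|(g1 x)%:E|%E).
  by apply: measurableT_comp => //; exact/measurable_EFinP.
have mn2 : measurable_fun setT (fun x => `|(g2 x)%:E|%E).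
  by apply: measurableT_comp => //; exact/measurable_EFinP.
apply/integrableP; split; first exact/measurable_EFinP.
rewrite fubini_tonelli1//; last first.
  by apply: measurableT_comp => //; exact/measurable_EFinP.
rewrite /fubini_F/=.
have E x : (\int[m2]_y `|(g1 x * g2 y)%:E| = `|(g1 x)%:E| * \int[m2]_y `|(g2 y)%:E|)%E.
  by rewrite -ge0_integralZl//; apply: eq_integral => y _; rewrite EFinM abseM.
under eq_integral do rewrite E.
have fi : (\int[m2]_y `|(g2 y)%:E|)%E \is a fin_num.
  by rewrite ge0_fin_numE ?integral_ge0.
rewrite -(fineK fi) ge0_integralZr//; last first.
  by rewrite lee_fin fine_ge0// integral_ge0.
have fi1 : (\int[m1]_y `|(g1 y)%:E|)%E \is a fin_num.
  by rewrite ge0_fin_numE ?integral_ge0.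
by rewrite -(fineK fi1) -EFinM ltry.
Qed.

End RealFubini.

(** * Gaussian averages of the spectral density *)

Section Pairing.
Context {R : realType} {n : nat}.
Local Notation leb := (@lebesgue_Rn R n).
Implicit Types (S C : 'rV[R]_n -> R) (w : 'rV[R]_n) (u : n.-tuple R).

Lemma rgauss_rvec p w u : rgauss p w (rvec u) = expR (- (p * qdist (w 0) u)).
Proof.
rewrite /rgauss /qdist; congr (expR (- (p * _))).
by apply: eq_bigr => i _; rewrite mxE.
Qed.

Lemma dotv_rvec w u : dotv w (rvec u) = lform (w 0) u.
Proof. by apply: eq_bigr => i _; rewrite mxE. Qed.

Lemma enorm_rvec u : enorm (rvec u) ^+ 2 = nsq u.
Proof. by rewrite enormE2; apply: eq_bigr => i _; rewrite mxE subr0. Qed.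

Lemma vsq_enorm w : vsq (w 0) = enorm w ^+ 2.
Proof. by rewrite enormE2. Qed.

Variables (F : R -> R) (C : 'rV[R]_n -> R).
Hypothesis cF : cmono F.
Hypothesis CF : forall u, C (rvec u) = F (nsq u).

(** Parseval's identity against a Gaussian: up to (2 pi)^n, [heat F e] is the convolution of S with
    the heat kernel (4 pi e)^(-n/2) exp(-|v|^2/(4 e)). It makes sense even when C is not
    integrable. *)
Definition gauss_pairing S := forall w (e : R), 0 < e ->
  leb.-integrable setT (EFin \o (fun u => S (rvec u) * rgauss (4 * e)^-1 w (rvec u))) /\
  heat F e (w 0) * Num.sqrt (4 * pi * e) ^+ n =
  (2 * pi) ^+ n * \int[leb]_u (S (rvec u) * rgauss (4 * e)^-1 w (rvec u)).

(** Dominated convergence, with F itself as the dominating function, removes the regularization. *)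
Lemma heat_limit_integrable S w : integrable_Rn C ->
  (S w)%:C%C = fourier (fun t => (C t)%:C%C) w ->
  heat_limit F (w 0) ((2 * pi) ^+ n * S w).
Proof.
move=> iC SE.
have pn0 : ((2 * pi) ^+ n : R) != 0.
  by rewrite expf_neq0// mulf_neq0// ?pnatr_eq0// lt0r_neq0// pi_gt0.
have -> : (2 * pi) ^+ n * S w = \int[leb]_u (F (nsq u) * cos (lform (w 0) u)).
  have := congr1 (@complex.Re R) SE; rewrite /fourier/= mul0r subr0 => ->.
  rewrite mulrA divff// mul1r /integral_Rn; apply: eq_Rintegral => u _ /=.
  by rewrite mulr0 subr0 cosN dotv_rvec CF mulrC.
have iF : leb.-integrable setT (EFin \o (fun u => F (nsq u))).
  by move: iC; rewrite /integrable_Rn; under eq_fun do rewrite CF.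
have F0 u : 0 <= F (nsq u) by apply: cmono_ge0 cF _ _; exact: nsq_ge0.
have mF := measurable_cmono (n := n) cF.
have mcos : measurable_fun setT (fun u : n.-tuple R => cos (lform (w 0) u)).
  by apply: (measurableT_comp measurable_cos); exact: measurable_lform.
have cos1 u : `|cos (lform (w 0) u)| <= 1 by rewrite ler_norml cos_geN1 cos_le1.
have mg e : measurable_fun setT (fun u : n.-tuple R => expR (- (e * nsq u))).
  apply: (measurableT_comp (@measurable_expR R)); apply: measurableT_comp => //.
  by apply: measurable_funM => //; exact: measurable_nsq.
have [||//|_] := @Rdominated_cvg _ _ R leb
   (fun k u => F (nsq u) * (cos (lform (w 0) u) * expR (- (k.+1%:R^-1 * nsq u))))
   (fun u => F (nsq u) * cos (lform (w 0) u)) (F \o nsq) _ _ _ iF; last by [].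
- by move=> k; apply: measurable_funM => //; exact: measurable_funM.
- exact: measurable_funM.
- apply: aeW => u; split.
    rewrite -[X in _ --> X]mulr1 -mulrA; apply: cvgMl_tmp; apply: cvgMl_tmp.
    have c0 : - (k.+1%:R^-1 * nsq u) @[k --> \oo] --> (0 : R).
      rewrite -[X in _ --> X]oppr0; apply: cvgN; rewrite -(mul0r (nsq u)).
      by apply: cvgMr_tmp; exact: cvg_harmonic.
    by have := cvg_comp _ _ c0 (@continuous_expR R 0); rewrite expR0.
  move=> k; rewrite !normrM ger0_norm// ler_piMr//.
  rewrite mulr_ile1// ger0_norm ?expR_ge0// expR_le1 oppr_le0.
  by rewrite mulr_ge0 ?invr_ge0 ?nsq_ge0.
Qed.

(** The test function is the Gaussian centered at w. Its Fourier transform is a Gaussian times a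
    wave, whose real part turns the pairing with C into [heat]. *)
Lemma gauss_pairing_generalized S :
  (forall phi : 'rV[R]_n -> R[i], cschwartz phi ->
     cintegrable_Rn (fun w => ((S w)%:C * phi w)%C) /\
     cintegral_Rn (fun w => ((S w)%:C * phi w)%C) =
     cintegral_Rn (fun t => ((C t)%:C * fourier phi t)%C)) -> gauss_pairing S.
Proof.
move=> H w e e0; have p0 : 0 < (4 * e)^-1 by rewrite invr_gt0 mulr_gt0.
have [[iRe _] E] := H _ (cschwartz_rgauss w p0); split.
  move: iRe; rewrite /integrable_Rn/=.
  by under eq_fun do rewrite mul0r subr0.
have := congr1 (@complex.Re R) E; rewrite /= /integral_Rn.
under eq_Rintegral do rewrite /= mul0r subr0.
move=> ->.
have K0 : ((2 * pi) ^+ n : R) != 0.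
  by rewrite expf_neq0// mulf_neq0// ?pnatr_eq0// lt0r_neq0// pi_gt0.
have FE u : complex.Re (fourier (fun x => (rgauss (4 * e)^-1 w x)%:C%C) (rvec u)) =
    ((2 * pi) ^+ n)^-1 * (Num.sqrt (4 * pi * e) ^+ n * (cos (lform (w 0) u) * expR (- (e * nsq u)))).
  rewrite /fourier/= mul0r subr0 /integral_Rn; congr (_ * _).
  transitivity (\int[leb]_v (cos (0 + lform (tnth u) v) * expR (- ((4 * e)^-1 * qdist (w 0) v)))).
    apply: eq_Rintegral => v _ /=; rewrite mulr0 subr0 cosN rgauss_rvec add0r.
    by congr (cos _ * _); apply: eq_bigr => i _; rewrite !mxE.
  rewrite /Rintegral integral_cos_gaussN//= add0r.
  have h1 : Num.sqrt (pi / (4 * e)^-1) = Num.sqrt (4 * pi * e) :> R.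
    by rewrite invrK; congr Num.sqrt; ring.
  have h2 : \sum_i tnth u i * w 0 i = lform (w 0) u.
    by apply: eq_bigr => i _; rewrite mulrC.
  have h3 : (\sum_i tnth u i ^+ 2) / (4 * (4 * e)^-1) = e * nsq u.
    rewrite (_ : 4 * (4 * e)^-1 = e^-1); last by field; exact: lt0r_neq0.
    rewrite invrK mulrC; congr (_ * _); apply: eq_bigr => i _.
    by rewrite subr0.
  by rewrite h1 h2 h3; ring.
have ih := cmono_integrable cF (integrable_heat_kernel (w 0) e0).
transitivity ((2 * pi) ^+ n * \int[leb]_u ((((2 * pi) ^+ n)^-1 * Num.sqrt (4 * pi * e) ^+ n) *
    (F (nsq u) * (cos (lform (w 0) u) * expR (- (e * nsq u)))))).
  by rewrite RintegralZl// !mulrA divff// mul1r mulrC.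
congr (_ * _); apply: eq_Rintegral => u _.
move: (FE u); rewrite /fourier/= /integral_Rn/= !mul0r !subr0 => ->.
by rewrite CF; ring.
Qed.

(** Inserting C(u) = \int exp(i v.u) S(v) dv into [heat] and exchanging the integrals leaves, for
    each v, the Gaussian integral in u at frequency v - w. *)
Lemma gauss_pairing_inversion S : integrable_Rn S ->
  (forall t, (C t)%:C%C = cintegral_Rn (fun w => (expi (dotv w t) * (S w)%:C)%C)) ->
  gauss_pairing S.
Proof.
move=> iS SE w e e0; have p0 : 0 < (4 * e)^-1 by rewrite invr_gt0 mulr_gt0.
have mS : measurable_fun setT (fun v => S (rvec v)).
  by have /integrableP[/measurable_EFinP] := iS.
have iS' : leb.-integrable setT (EFin \o (fun v => S (rvec v))) by exact: iS.
have iabs : leb.-integrable setT (EFin \o (fun v => `|S (rvec v)|)).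
  by have := integrable_abse iS.
have mrg : measurable_fun setT (fun v => rgauss (4 * e)^-1 w (rvec v)).
  by under eq_fun do rewrite rgauss_rvec; exact: measurable_gaussN.
split.
  apply: le_integrable_EFin iabs; first exact: measurable_funM.
  move=> u; rewrite normrM ler_piMr// rgauss_rvec ger0_norm ?expR_ge0//.
  by rewrite expR_le1 oppr_le0 mulr_ge0 ?qdist_ge0// ltW.
pose L (u v : n.-tuple R) := \sum_i (tnth v i - w 0 i) * tnth u i.
have LE u v : L u v = dotv (rvec v) (rvec u) - lform (w 0) u.
  by rewrite /L /dotv /lform -sumrB; apply: eq_bigr => i _; rewrite !mxE mulrBl.
have mL : measurable_fun setT (fun p : n.-tuple R * n.-tuple R => L p.1 p.2).
  apply: measurable_sum => i; apply: measurable_funM.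
    apply: measurable_funB => //.
    exact: (measurableT_comp (measurable_tnth i) measurable_snd).
  exact: (measurableT_comp (measurable_tnth i) measurable_fst).
have mL1 u : measurable_fun setT (L u).
  by apply: measurable_sum => i; apply: measurable_funM => //; apply: measurable_funB => //; exact: measurable_tnth.
pose D u v := dotv (rvec v) (rvec u).
have mD u : measurable_fun setT (D u).
  rewrite (_ : D u = fun v => L u v + lform (w 0) u); first exact: measurable_funD.
  by apply/funext => v; rewrite LE subrK.
have bound (g : n.-tuple R -> R) : measurable_fun setT g -> (forall v, `|g v| <= 1) ->
    leb.-integrable setT (EFin \o (fun v => g v * S (rvec v))).
  move=> mg g1; apply: le_integrable_EFin iabs; first exact: measurable_funM.
  by move=> v; rewrite normrM ler_piMl.
have cos1 (x : R) : `|cos x| <= 1 by rewrite ler_norml cos_geN1 cos_le1.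
have sin1 (x : R) : `|sin x| <= 1 by rewrite ler_norml sin_geN1 sin_le1.
have icos u : leb.-integrable setT (EFin \o (fun v => cos (D u v) * S (rvec v))).
  by apply: bound => //; exact: (measurableT_comp measurable_cos).
have isin u : leb.-integrable setT (EFin \o (fun v => sin (D u v) * S (rvec v))).
  by apply: bound => //; exact: (measurableT_comp measurable_sin).
have Cc u : C (rvec u) = \int[leb]_v (cos (D u v) * S (rvec v)).
  have := congr1 (@complex.Re R) (SE (rvec u)) => /= ->.
  by apply: eq_Rintegral => v _ /=; rewrite mulr0 subr0.
(* C is real, so the sine part vanishes. This allows cos(v.u - w.u) to be expanded in v.u and only
   the term cos(w.u) C(u) to survive. *)
have Cs u : 0 = \int[leb]_v (sin (D u v) * S (rvec v)).
  have := congr1 (@complex.Im R) (SE (rvec u)) => /= ->.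
  by apply: eq_Rintegral => v _ /=; rewrite mulr0 add0r.
pose f u v := (cos (L u v) * S (rvec v)) * expR (- (e * nsq u)).
have CE u : F (nsq u) * (cos (lform (w 0) u) * expR (- (e * nsq u))) =
    \int[leb]_v f u v.
  rewrite /f; under eq_Rintegral do rewrite mulrC.
  rewrite RintegralZl//; last first.
    by apply: bound => //; exact: (measurableT_comp measurable_cos).
  rewrite -CF mulrA mulrC; congr (_ * _).
  transitivity (cos (lform (w 0) u) * C (rvec u) + sin (lform (w 0) u) * 0).
    by rewrite mulr0 addr0 mulrC.
  rewrite [in X in _ + X](Cs u) Cc -!RintegralZl// -RintegralD//; last 2 first.
  - exact: integrableZ_EFin.
  - exact: integrableZ_EFin.
  by apply: eq_Rintegral => v _; rewrite LE cosB -/(D u v); ring.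
have ifv u : leb.-integrable setT (EFin \o f u).
  rewrite /f; under eq_fun do rewrite mulrC.
  apply: integrableZ_EFin.
  by apply: bound => //; exact: (measurableT_comp measurable_cos).
have fE u v : f u v = S (rvec v) * (cos (lform (fun i => tnth v i - w 0 i) u) * expR (- (e * nsq u))).
  by rewrite /f /L -/(lform (fun i => tnth v i - w 0 i) u); ring.
have ifu v : leb.-integrable setT (EFin \o f^~ v).
  under eq_fun do rewrite fE.
  exact/integrableZ_EFin/integrable_heat_kernel.
have ifp : (leb \x leb)%E.-integrable setT (fun p => (f p.1 p.2)%:E).
  have ig := integrable_tensor (integrable_gaussN ((fun=> 0) : 'I_n -> R) e0) iabs.
  apply: (@le_integrable_EFin R _ _ _ (fun p => f p.1 p.2) _ _ _ ig).
    apply: measurable_funM; last first.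
      exact: (measurableT_comp (measurable_gaussN e ((fun=> 0) : 'I_n -> R)) measurable_fst).
    apply: measurable_funM; first exact: (measurableT_comp measurable_cos).
    exact: (measurableT_comp mS measurable_snd).
  move=> [u v]; rewrite /f/= !normrM (ger0_norm (expR_ge0 _)) mulrC.
  by rewrite ler_wpM2l ?expR_ge0// ler_piMl.
have -> : heat F e (w 0) = \int[leb]_v (S (rvec v) * @kap R n e (qdist (w 0) v)).
  rewrite /heat; under eq_Rintegral do rewrite CE.
  rewrite (Rfubini ifv ifu ifp); apply: eq_Rintegral => v _.
  under eq_Rintegral do rewrite fE.
  rewrite RintegralZl//; last exact: integrable_heat_kernel.
  by rewrite /Rintegral integral_heat_kernel.
have irg : leb.-integrable setT (EFin \o (fun u => S (rvec u) * rgauss (4 * e)^-1 w (rvec u))).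
  apply: le_integrable_EFin iabs; first exact: measurable_funM.
  move=> u; rewrite normrM ler_piMr// rgauss_rvec ger0_norm ?expR_ge0//.
  by rewrite expR_le1 oppr_le0 mulr_ge0 ?qdist_ge0// ltW.
have -> : \int[leb]_v (S (rvec v) * @kap R n e (qdist (w 0) v)) =
    \int[leb]_v (Num.sqrt (pi / e) ^+ n * (S (rvec v) * rgauss (4 * e)^-1 w (rvec v))).
  apply: eq_Rintegral => v _.
  by rewrite /kap rgauss_rvec mulrCA (mulrC (qdist _ _)).
rewrite RintegralZl// mulrAC -exprMn; congr (_ ^+ n * _).
rewrite -sqrtrM ?divr_ge0 ?pi_ge0 ?ltW//.
have -> : pi / e * (4 * pi * e) = (2 * pi) ^+ 2 :> R by field; exact: lt0r_neq0.
by rewrite sqrtr_sqr ger0_norm// mulr_ge0// pi_ge0.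
Qed.

End Pairing.

(** * Recovering S(w) from its Gaussian averages *)

Section ApproximateIdentity.
Context {R : realType} {n : nat}.
Local Notation leb := (@lebesgue_Rn R n).

(* The Gaussians [rgauss (4 * e)^-1 w] concentrate at [w] as [e] tends to 0; far
   from [w] they are negligible against the one for [e = 1], which is paired
   with [S] integrably. *)
Lemma gauss_pairing_limit (F : R -> R) (S : 'rV[R]_n -> R) (w : 'rV[R]_n) :
  gauss_pairing F S -> {for w, continuous S} ->
  heat_limit F (w 0) ((2 * pi) ^+ n * S w).
Proof.
move=> HP cS.
pose G e u := rgauss (4 * e)^-1 w (@rvec R n u).
pose K e : R := Num.sqrt (4 * pi * e) ^+ n.
pose I e := \int[leb]_u (S (rvec u) * G e u).
have K0 e : 0 < e -> 0 < K e.
  by move=> e0; rewrite exprn_gt0// sqrtr_gt0 !mulr_gt0// pi_gt0.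
have p0 e : 0 < e -> 0 < (4 * e)^-1 :> R by move=> e0; rewrite invr_gt0 mulr_gt0.
have h0 k : 0 < (k.+1%:R^-1 : R) by rewrite invr_gt0.
have iG e : 0 < e -> leb.-integrable setT (EFin \o G e).
  move=> e0; have := integrable_gaussN (w 0) (p0 e e0).
  by rewrite /G; under [in X in _ -> X]eq_fun do rewrite /= rgauss_rvec.
have GK e : 0 < e -> \int[leb]_u G e u = K e.
  move=> e0; rewrite /Rintegral.
  under eq_integral do rewrite /G rgauss_rvec.
  rewrite ge0_integral_gaussN ?p0//= /K invrK; congr (Num.sqrt _ ^+ n).
  by ring.
have iSG e : 0 < e -> leb.-integrable setT (EFin \o (fun u => S (rvec u) * G e u)).
  by move=> e0; have [] := HP w e e0.
have hE k : heat F k.+1%:R^-1 (w 0) = (2 * pi) ^+ n * (I k.+1%:R^-1 / K k.+1%:R^-1).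
  have [_ E] := HP w _ (h0 k).
  by rewrite mulrA -[X in X / _]E mulfK// lt0r_neq0// K0.
rewrite /heat_limit; under eq_fun do rewrite hE.
apply: cvgMl_tmp.
pose D e u := (S (rvec u) - S w) * G e u.
have iD e : 0 < e -> leb.-integrable setT (EFin \o D e).
  move=> e0; rewrite /D; under eq_fun do rewrite mulrBl.
  by apply: integrableB_EFin; [exact: iSG|exact/integrableZ_EFin/iG].
have DE e : 0 < e -> \int[leb]_u D e u = I e - S w * K e.
  move=> e0; rewrite /D; under eq_Rintegral do rewrite mulrBl.
  rewrite RintegralB ?iSG//; last exact/integrableZ_EFin/iG.
  by rewrite RintegralZl ?iG// GK.
have iDabs e : 0 < e -> leb.-integrable setT (EFin \o (fun u => `|D e u|)).
  by move=> e0; have := integrable_abse (iD e e0).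
pose M := \int[leb]_u `|D 1 u|.
have M0 : 0 <= M by apply: Rintegral_ge0.
apply/cvgrPdist_le => eta eta0.
have e2 : 0 < eta / 2 by rewrite divr_gt0.
have [dl dl0 Hdl] : exists2 dl : R, 0 < dl & forall y : 'rV[R]_n,
    (forall i, `|w 0 i - y 0 i| < dl) -> `|S w - S y| <= eta / 2.
  have /cvgrPdist_le /(_ _ e2) := cS.
  move=> /nbhs_ballP[dl /= dl0 H]; exists dl => // y Hy; apply: H.
  by split=> // i j; rewrite (ord1 i); exact: Hy.
(* The exponents are (k+1)/4 for e = 1/(k+1) and 1/4 for e = 1. Outside the ball of radius dl the
   quotient of the two Gaussians is therefore at most exp(-dl^2 k / 4), with k and not k+1. *)
pose r k : R := expR (- (dl ^+ 2 / 4 * k%:R)).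
have ptw k u : `|D k.+1%:R^-1 u| <= eta / 2 * G k.+1%:R^-1 u + r k * `|D 1 u|.
  rewrite /D !normrM.
  have G0 e : 0 <= G e u by rewrite expR_ge0.
  rewrite !(ger0_norm (G0 _)).
  have [qd|qd] := ltP (qdist (w 0) u) (dl ^+ 2).
    rewrite -[leLHS]addr0; apply: lerD; last by rewrite !mulr_ge0 ?expR_ge0.
    rewrite ler_wpM2r// distrC; apply: Hdl => i.
    rewrite -ltr_sqr ?nnegrE ?(ltW dl0)// real_normK ?num_real//.
    apply: le_lt_trans qd; rewrite /qdist (bigD1 i)//= mxE -[leLHS]sqrrN opprB.
    by rewrite lerDl sumr_ge0// => j _; exact: sqr_ge0.
  rewrite -[leLHS]add0r; apply: lerD; first by rewrite mulr_ge0 ?(ltW e2).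
  rewrite mulrCA ler_wpM2l// /G !rgauss_rvec /r -expRD ler_expR.
  rewrite mulr1 invfM invrK -[k.+1%:R]natr1.
  have := ler_wpM2r (ler0n R k) qd.
  lra.
(* The normalization grows only polynomially in k (as 4 pi >= 1), so the exponential [r k] beats
   it. *)
have K1 k : (K k.+1%:R^-1)^-1 <= k.+1%:R ^+ n.
  rewrite /K -exprVn lerXn2r ?nnegrE ?invr_ge0//.
  rewrite -sqrtrV ?mulr_ge0 ?pi_ge0// -[leRHS]ger0_norm// -sqrtr_sqr ler_wsqrtr//.
  rewrite invfM invrK expr2 ler_wpM2r//.
  apply: (@le_trans _ _ 1); last by rewrite ler1n.
  rewrite invf_le1 ?mulr_gt0 ?pi_gt0//.
  by have := @pi_ge2 R; lra.
have est k : `|S w - I k.+1%:R^-1 / K k.+1%:R^-1| <=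
    eta / 2 + M * expR (dl ^+ 2 / 4) * (k.+1%:R ^+ n * expR (- (dl ^+ 2 / 4 * k.+1%:R))).
  have Kk := K0 _ (h0 k).
  have -> : S w - I k.+1%:R^-1 / K k.+1%:R^-1 = - (\int[leb]_u D k.+1%:R^-1 u) / K k.+1%:R^-1.
    by rewrite DE//; field; rewrite lt0r_neq0.
  rewrite normrM normrN (gtr0_norm (_ : 0 < (K _)^-1)) ?invr_gt0//.
  have ub : `|\int[leb]_u D k.+1%:R^-1 u| <= eta / 2 * K k.+1%:R^-1 + r k * M.
    apply: (le_trans (le_normr_Rintegral measurableT (iD _ (h0 k)))).
    rewrite -GK// /M -!RintegralZl ?iG ?iDabs// -RintegralD//; last 2 first.
    - exact/integrableZ_EFin/iG.
    - exact/integrableZ_EFin/iDabs.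
    apply: le_Rintegral => //; first exact: iDabs.
    apply: integrableD_EFin; first exact/integrableZ_EFin/iG.
    exact/integrableZ_EFin/iDabs.
  apply: (@le_trans _ _ ((eta / 2 * K k.+1%:R^-1 + r k * M) / K k.+1%:R^-1)).
    by rewrite ler_wpM2r// invr_ge0 ltW.
  rewrite mulrDl mulfK ?lt0r_neq0// lerD2l.
  have -> : r k = expR (dl ^+ 2 / 4) * expR (- (dl ^+ 2 / 4 * k.+1%:R)).
    by rewrite -expRD /r -[k.+1%:R]natr1; congr expR; ring.
  rewrite [leLHS](_ : _ = M * expR (dl ^+ 2 / 4) * ((K k.+1%:R^-1)^-1 * expR (- (dl ^+ 2 / 4 * k.+1%:R)))); last by ring.
  by rewrite ler_wpM2l ?mulr_ge0 ?expR_ge0// ler_wpM2r ?expR_ge0.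
have c0 : 0 < dl ^+ 2 / 4 by rewrite divr_gt0// exprn_gt0.
have cv : M * expR (dl ^+ 2 / 4) * (k.+1%:R ^+ n * expR (- (dl ^+ 2 / 4 * k.+1%:R))) @[k --> \oo] --> (0 : R).
  by rewrite -(mulr0 (M * expR (dl ^+ 2 / 4))); apply: cvgMl_tmp; exact: cvg_exprn_expRN.
have H := cvgr_le 0 cv (eta / 2) e2.
near=> k; apply: (le_trans (est k)).
rewrite [leRHS](splitr eta) lerD2l.
by near: k; exact: H.
Unshelve. all: by end_near. Qed.

End ApproximateIdentity.

(** * The Gamma function and radial integrals *)

Section TonelliOnDomains.
Context d1 d2 (T1 : measurableType d1) (T2 : measurableType d2) {R : realType}.
Variables (m1 : {sigma_finite_measure set T1 -> \bar R})
  (m2 : {sigma_finite_measure set T2 -> \bar R}).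
Local Open Scope ereal_scope.

Lemma tonelli_dom (D1 : set T1) (D2 : set T2) (f : T1 -> T2 -> R) :
  measurable D1 -> measurable D2 ->
  measurable_fun setT (fun p : T1 * T2 => f p.1 p.2) ->
  (forall x y, D1 x -> D2 y -> (0 <= f x y)%R) ->
  \int[m1]_(x in D1) \int[m2]_(y in D2) (f x y)%:E =
  \int[m2]_(y in D2) \int[m1]_(x in D1) (f x y)%:E.
Proof.
move=> mD1 mD2 mf f0.
pose g := (fun p : T1 * T2 => (f p.1 p.2)%:E) \_ (D1 `*` D2).
have g0 p : 0 <= g p.
  rewrite /g patchE; case: ifPn => // /set_mem[/= ? ?].
  by rewrite lee_fin f0.
have mg : measurable_fun setT g.
  apply/(measurable_restrictT _ (measurableX mD1 mD2)).
  by apply: measurable_funTS; exact/measurable_EFinP.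
transitivity (\int[m1]_x \int[m2]_y g (x, y)).
  rewrite integral_mkcond; apply: eq_integral => x _; rewrite patchE.
  case: ifPn => [/set_mem xD|xD].
    rewrite integral_mkcond; apply: eq_integral => y _; rewrite /g !patchE.
    by congr (if _ then _ else _); apply/idP/idP => [/set_mem yD|/set_mem[_ /= yD]]; exact/mem_set.
  rewrite integral0_eq// => y _; rewrite /g patchE ifN//.
  by apply: contra xD => /set_mem[/= xD _]; exact/mem_set.
rewrite fubini_tonelli//.
rewrite [RHS]integral_mkcond; apply: eq_integral => y _; rewrite patchE.
case: ifPn => [/set_mem yD|yD].
  rewrite [RHS]integral_mkcond; apply: eq_integral => x _; rewrite /g !patchE.
  by congr (if _ then _ else _); apply/idP/idP => [/set_mem[/= xD _]|/set_mem xD]; exact/mem_set.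
rewrite integral0_eq// => x _; rewrite /g patchE ifN//.
by apply: contra yD => /set_mem[_ /= xD]; exact/mem_set.
Qed.

End TonelliOnDomains.

Section GammaIntegrals.
Context {R : realType}.
Local Notation mu := (@lebesgue_measure R).
Local Notation pos := (`]0%R, +oo[%classic : set R).

Lemma ge0_integral_dil0y (c : R) (f : R -> \bar R) : 0 < c ->
  measurable_fun setT f -> (forall x, 0 < x -> (0 <= f x)%E) ->
  (\int[mu]_(x in pos) f x = c%:E * \int[mu]_(x in pos) f (c * x)%R)%E.
Proof.
move=> c0 mf f0.
have f0' x : (0 <= (f \_ pos) x)%E.
  by rewrite patchE; case: ifPn => // /set_mem /=; rewrite in_itv/= andbT => /f0.
have mfp : measurable_fun setT (f \_ pos).
  have mp : measurable pos by exact: measurable_itv.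
  by apply/(measurable_restrictT _ mp); exact: measurable_funTS.
rewrite integral_mkcond (ge0_integral_affine 0 c0 mfp f0'); congr (_ * _)%E.
rewrite [RHS]integral_mkcond; apply: eq_integral => x _.
rewrite !patchE addr0; congr (if _ then _ else _).
by apply/idP/idP => /set_mem /=; rewrite in_itv/= andbT => H; apply/mem_set;
   rewrite /= in_itv/= andbT; move: H; rewrite pmulr_rgt0.
Qed.

Lemma integral_expR_tail (c a : R) : 0 < c ->
  (\int[mu]_(u in `]a, +oo[) (c * expR (- (c * u)))%:E = (expR (- (c * a)))%:E)%E.
Proof.
move=> c0; pose F u : R := - expR (- (c * u)).
have dF (u : R) : is_derive u (1 : R) F (c * expR (- (c * u))).
  have d1 : is_derive u (1 : R) (fun u : R => - (c * u)) (- c).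
    by apply: is_derive_eq; rewrite /GRing.scale/=; ring.
  have d2 := @is_derive1_comp _ expR (fun u : R => - (c * u)) u _ _ (is_derive_expR _) d1.
  by apply: is_derive_eq (is_deriveN d2) _; rewrite mulrN opprK mulrC.
have cf : continuous (fun u : R => c * expR (- (c * u))).
  move=> u; apply: cvgMl_tmp; apply: (cvg_comp _ expR); last exact: continuous_expR.
  by apply: cvgN; apply: cvgMl_tmp; exact: cvg_id.
have mf : measurable_fun setT (fun u : R => (c * expR (- (c * u)))%:E).
  by apply/measurable_EFinP; exact: continuous_measurable_fun.
rewrite integral_itv_obnd_cbnd; last exact: measurable_funTS.
rewrite (@ge0_continuous_FTC2y _ _ F a 0).
- by rewrite /F -EFinB sub0r opprK.
- by move=> u _; rewrite mulr_ge0 ?expR_ge0// ltW.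
- exact: continuous_subspaceT.
- rewrite -oppr0; apply: cvgN.
  apply: (cvg_comp (fun u => c * u) (fun v => expR (- v)) (G := +oo)); last exact: cvgr_expR.
  by apply: gt0_cvgMry => //; exact: cvg_id.
- by move=> u _; exact: ex_derive.
- apply: cvg_at_right_filter; apply: differentiable_continuous.
  by apply/derivable1_diffP; exact: ex_derive.
- by move=> u _; rewrite derive1E; exact: derive_val.
Qed.

Lemma powRN_cvg0 (y : R) : 0 < y -> u `^ (- y) @[u --> +oo] --> (0 : R).
Proof.
move=> y0; apply/cvgrPdist_le => e e0; near=> u.
have u0 : (e^-1) `^ (y^-1) <= u by near: u; exact: nbhs_pinfty_ge.
have v0 : 0 < (e^-1) `^ (y^-1) by rewrite powR_gt0// invr_gt0.
rewrite sub0r normrN ger0_norm ?powR_ge0// powRN -[leRHS]invrK.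
rewrite lef_pV2 ?posrE ?invr_gt0// ?powR_gt0 ?(lt_le_trans v0)//.
apply: (@le_trans _ _ (((e^-1) `^ (y^-1)) `^ y)).
  by rewrite -powRrM mulVf ?lt0r_neq0// powRr1// invr_ge0 ltW.
by rewrite ge0_ler_powR ?nnegrE ?(ltW y0) ?(ltW v0)// (le_trans (ltW v0)).
Unshelve. all: by end_near. Qed.

Lemma integral_powR_tail (y a : R) : 0 < y -> 0 < a ->
  (\int[mu]_(u in `]a, +oo[) (u `^ (- y - 1))%:E = (a `^ (- y) / y)%:E)%E.
Proof.
move=> y0 a0; pose F u : R := - y^-1 * u `^ (- y).
have dF (u : R) : 0 < u -> is_derive u (1 : R) F (u `^ (- y - 1)).
  move=> u0; have d1 := is_derive1_powR (- y) u0.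
  apply: is_derive_eq (is_deriveZ (- y^-1) d1) _.
  by rewrite /GRing.scale/= mulrA mulrNN mulVf ?mul1r// lt0r_neq0.
rewrite integral_itv_obnd_cbnd; last first.
  by apply/measurable_EFinP; apply: measurable_funTS; exact: measurable_powR.
rewrite (@ge0_continuous_FTC2y _ _ F a 0).
- by rewrite /F -EFinB sub0r mulNr opprK mulrC.
- by move=> u _; exact: powR_ge0.
- apply: continuous_in_subspaceT => u; rewrite inE/= in_itv/= andbT => au.
  apply: differentiable_continuous; apply/derivable1_diffP.
  apply: ex_derive; exact: (is_derive1_powR (- y - 1) (lt_le_trans a0 au)).
- by rewrite -(mulr0 (- y^-1)); apply: cvgMl_tmp; exact: powRN_cvg0.
- by move=> u au; apply: ex_derive; apply: dF; exact: lt_trans au.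
- apply: cvg_at_right_filter; apply: differentiable_continuous.
  by apply/derivable1_diffP; apply: ex_derive; exact: dF.
- move=> u; rewrite in_itv/= andbT => au; rewrite derive1E; apply: derive_val.
  by apply: dF; exact: lt_trans au.
Qed.

(** Euler's integral kept in the extended reals, so that Tonelli's theorem can be used on it before
    its finiteness is known. *)
Definition eGamma (x : R) : \bar R :=
  (\int[mu]_(t in pos) (t `^ (x - 1) * expR (- t))%:E)%E.

Lemma measurable_powRM_expR (x c : R) :
  measurable_fun setT (fun t : R => t `^ x * expR (- (c * t))).
Proof.
apply: measurable_funM; first exact: measurable_powR.
apply: (measurableT_comp (@measurable_expR R)); apply: measurableT_comp => //.
Qed.

Lemma eGamma_scale (x u : R) : 0 < u ->
  (\int[mu]_(s in pos) (s `^ (x - 1) * expR (- (u * s)))%:E =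
   (u `^ (- x))%:E * eGamma x)%E.
Proof.
move=> u0.
have mf : measurable_fun setT (fun t : R => (t `^ (x - 1) * expR (- t))%:E).
  apply/measurable_EFinP; have := measurable_powRM_expR (x - 1) 1.
  by under eq_fun do rewrite mul1r.
rewrite /eGamma (ge0_integral_dil0y u0 mf); last first.
  by move=> t _; rewrite lee_fin mulr_ge0 ?powR_ge0 ?expR_ge0.
have E (s : R) : 0 < s -> (((u * s) `^ (x - 1) * expR (- (u * s)))%:E =
    (u `^ (x - 1))%:E * (s `^ (x - 1) * expR (- (u * s)))%:E)%E.
  by move=> s0; rewrite powRM ?(ltW u0) ?(ltW s0)// -EFinM mulrA.
have -> : (\int[mu]_(x0 in pos) ((u * x0) `^ (x - 1) * expR (- (u * x0)))%:E =
   \int[mu]_(s in pos) ((u `^ (x - 1))%:E * (s `^ (x - 1) * expR (- (u * s)))%:E))%E.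
  by apply: eq_integral => s /set_mem/=; rewrite in_itv/= andbT => /E.
rewrite ge0_integralZl//.
- rewrite !muleA -!EFinM -[u in (_ * u * _)%R]powRr1 ?(ltW u0)//.
  rewrite -!powRD; last 2 first.
  + by rewrite (gt_eqF u0) implybT.
  + by rewrite (gt_eqF u0) implybT.
  rewrite (_ : - x + 1 + (x - 1) = 0); last by ring.
  by rewrite powRr0 mul1e.
- by apply/measurable_EFinP; apply: measurable_funTS; exact: measurable_powRM_expR.
- by move=> s _; rewrite lee_fin mulr_ge0 ?powR_ge0 ?expR_ge0.
- by rewrite lee_fin powR_ge0.
Qed.

End GammaIntegrals.

(** * Gamma and Beta integrals by exchange of integrals *)

Section GammaFunction.
Context {R : realType}.
Local Notation mu := (@lebesgue_measure R).
Local Notation pos := (`]0%R, +oo[%classic : set R).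

Lemma eGamma_ge0 (x : R) : (0 <= eGamma x)%E.
Proof.
by apply: integral_ge0 => t _; rewrite lee_fin mulr_ge0 ?powR_ge0 ?expR_ge0.
Qed.

(** In place of integration by parts: s^(x-1) exp(-s) = \int_1^oo s^x exp(-s u) du. Exchanging the
    integrals leaves Gamma(x+1) \int_1^oo u^(-x-1) du, and the last integral is 1/x. *)
Lemma eGamma_rec (x : R) : 0 < x -> (eGamma x = (x^-1)%:E * eGamma (x + 1))%E.
Proof.
move=> x0; pose f (s u : R) := s `^ x * expR (- (s * u)).
have mf : measurable_fun setT (fun p : R * R => f p.1 p.2).
  apply: measurable_funM.
    exact: (measurableT_comp (measurable_powR x) measurable_fst).
  apply: (measurableT_comp (@measurable_expR R)); apply: measurableT_comp => //.
  by apply: measurable_funM; [exact: measurable_fst|exact: measurable_snd].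
have f0 s u : 0 <= f s u by rewrite mulr_ge0 ?powR_ge0 ?expR_ge0.
transitivity (\int[mu]_(s in pos) \int[mu]_(u in `]1%R, +oo[) (f s u)%:E)%E.
  apply: eq_integral => s /set_mem/=; rewrite in_itv/= andbT => s0.
  transitivity ((s `^ (x - 1))%:E * \int[mu]_(u in `]1%R, +oo[) (s * expR (- (s * u)))%:E)%E.
    by rewrite integral_expR_tail// mulr1.
  rewrite -ge0_integralZl//.
  - apply: eq_integral => u _; rewrite -EFinM mulrA; congr ((_ * _)%:E).
    by rewrite -[s in _ * s]powRr1 ?(ltW s0)// -powRD ?subrK// (gt_eqF s0) implybT.
  - apply/measurable_EFinP; apply: measurable_funTS; apply: measurable_funM => //.
    apply: (measurableT_comp (@measurable_expR R)); apply: measurableT_comp => //.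
  - by move=> u _; rewrite lee_fin mulr_ge0 ?expR_ge0// ltW.
  - by rewrite lee_fin powR_ge0.
rewrite tonelli_dom//.
transitivity (\int[mu]_(u in `]1%R, +oo[) (eGamma (x + 1) * (u `^ (- x - 1))%:E))%E.
  apply: eq_integral => u /set_mem/=; rewrite in_itv/= andbT => u1.
  have u0 : 0 < u by exact: lt_trans u1.
  rewrite muleC -opprD -[RHS](eGamma_scale (x + 1) u0).
  by apply: eq_integral => s _; rewrite /f addrK (mulrC u).
rewrite ge0_integralZl ?eGamma_ge0//.
- by rewrite integral_powR_tail// powR1 mul1r muleC.
- by apply/measurable_EFinP; apply: measurable_funTS; exact: measurable_powR.
- by move=> u _; rewrite lee_fin powR_ge0.
Qed.

Lemma exprn_le_expR (m : nat) (y : R) : 0 <= y -> y ^+ m.+1 <= m.+1`!%:R * expR y.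
Proof.
move=> y0; rewrite mulrC -ler_pdivrMr ?ltr0n ?fact_gt0//.
by apply: le_trans (expR_ge1Dxn m y0); rewrite lerDr.
Qed.

(** The recurrence reduces to arguments >= 1, where no singularity at 0 is left and t^(y-1) <= (1 +
    t)^(m+1) is at most a constant times exp(t/2). *)
Lemma eGamma_lty (x : R) : 0 < x -> (eGamma x < +oo)%E.
Proof.
suff H (y : R) : 1 <= y -> (eGamma y < +oo)%E.
  move=> x0; rewrite eGamma_rec// lte_mul_pinfty//.
    by rewrite lee_fin invr_ge0 ltW.
  by apply: H; rewrite lerDr ltW.
move=> y1; pose m := Num.truncn (y - 1).
have ym : y - 1 <= m.+1%:R by rewrite ltW// truncnS_gt.
pose K : R := 2 ^+ m.+1 * (m.+1`!%:R * expR 2^-1) * 2.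
have K0 : 0 <= K by rewrite !mulr_ge0 ?exprn_ge0 ?expR_ge0.
apply: (@le_lt_trans _ _ (K%:E * \int[mu]_(t in pos) (2^-1 * expR (- (2^-1 * t)))%:E)%E); last first.
  by rewrite integral_expR_tail ?invr_gt0// -EFinM ltry.
have mexp : measurable_fun setT (fun t : R => 2^-1 * expR (- (2^-1 * t))).
  apply: measurable_funM => //.
  by apply: (measurableT_comp (@measurable_expR R)); apply: measurableT_comp.
rewrite -ge0_integralZl//; last first.
  by apply/measurable_EFinP; exact: measurable_funTS.
apply: ge0_le_integral => //.
- by move=> t _; rewrite lee_fin mulr_ge0 ?powR_ge0 ?expR_ge0.
- apply/measurable_EFinP; apply: measurable_funTS.
  have := measurable_powRM_expR (y - 1) 1.
  by under eq_fun do rewrite mul1r.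
- apply: measurable_funTS; apply: emeasurable_funM => //.
  exact/measurable_EFinP.
move=> t; rewrite /= in_itv/= andbT => t0.
rewrite lee_fin.
have t1 : 0 <= 1 + t by rewrite addr_ge0// ltW.
have b1 : t `^ (y - 1) <= (1 + t) ^+ m.+1.
  apply: (@le_trans _ _ ((1 + t) `^ (y - 1))).
    by rewrite ge0_ler_powR ?nnegrE ?subr_ge0 ?(ltW t0)// lerDr.
  rewrite -powR_mulrn// ler_powR// lerDl; exact: ltW.
have b2 : (1 + t) ^+ m.+1 <= 2 ^+ m.+1 * (m.+1`!%:R * expR ((1 + t) / 2)).
  rewrite -[in leLHS](mulfVK (_ : 2 != 0) (1 + t))// mulrC exprMn.
  by rewrite ler_wpM2l ?exprn_ge0// exprn_le_expR// divr_ge0.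
apply: (@le_trans _ _ (2 ^+ m.+1 * (m.+1`!%:R * expR ((1 + t) / 2)) * expR (- t))).
  by rewrite ler_wpM2r ?expR_ge0// (le_trans b1).
rewrite /K -!mulrA -!expRD !ler_wpM2l ?exprn_ge0//.
rewrite (mulrA 2) divff// mul1r -expRD ler_expR; lra.
Qed.

Lemma eGamma_gt0 (x : R) : (0 < eGamma x)%E.
Proof.
(* Lower bound of the integrand on ]1, 2]: there 0 <= ln t <= 1, so t^(x-1) >= exp(-|x-1|), and
   exp(-t) >= exp(-2). *)
pose c : R := expR (- `|x - 1|) * expR (- 2).
apply: (@lt_le_trans _ _ (\int[mu]_(t in `]1%R, 2%R]) c%:E)%E).
  rewrite integral_cst//= lebesgue_measure_itv/= lte_fin.
  have -> : 1 < 2 :> R by lra.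
  by rewrite -EFinB -EFinM lte_fin !mulr_gt0 ?expR_gt0// subr_gt0; lra.
apply: (@le_trans _ _ (\int[mu]_(t in `]1%R, 2%R]) (t `^ (x - 1) * expR (- t))%:E)%E).
  apply: ge0_le_integral => //.
  - by move=> t _; rewrite lee_fin mulr_ge0 ?expR_ge0.
  - apply/measurable_EFinP; apply: measurable_funTS.
    have := measurable_powRM_expR (x - 1) 1.
    by under eq_fun do rewrite mul1r.
  - move=> t; rewrite /= in_itv/= => /andP[t1 t2].
    have t0 : 0 < t by exact: lt_trans t1.
    rewrite lee_fin /c ler_pM ?expR_ge0//; last by rewrite ler_expR lerN2.
    rewrite /powR gt_eqF// ler_expR.
    have l0 : 0 <= ln t by rewrite ln_ge0// ltW.
    have l1 : ln t <= 1.
      have := le_ln1Dx (_ : -1 < t - 1); rewrite (addrC 1) subrK => /(_ ltac:(lra)).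
      lra.
    have := ler_norm (- (x - 1)); rewrite normrN => h.
    have : - `|x - 1| <= - `|x - 1| * ln t.
      by rewrite mulNr lerN2 -[leRHS]mulr1 ler_wpM2l.
    move/le_trans; apply; rewrite ler_wpM2r//; lra.
apply: ge0_subset_integral => //.
- apply/measurable_EFinP; apply: measurable_funTS.
  have := measurable_powRM_expR (x - 1) 1.
  by under eq_fun do rewrite mul1r.
- by move=> t _; rewrite lee_fin mulr_ge0 ?powR_ge0 ?expR_ge0.
- move=> t; rewrite /= !in_itv/= => /andP[t1 _]; rewrite andbT; exact: lt_trans t1.
Qed.

Lemma EFin_Gamma (x : R) : 0 < x -> (Gamma x)%:E = eGamma x.
Proof.
move=> x0; rewrite /Gamma /Rintegral fineK// ge0_fin_numE ?eGamma_ge0//.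
exact: eGamma_lty.
Qed.

Lemma Gamma_gt0 (x : R) : 0 < x -> 0 < Gamma x.
Proof. by move=> x0; rewrite -lte_fin EFin_Gamma// eGamma_gt0. Qed.

Lemma Gamma_rec (x : R) : 0 < x -> Gamma (x + 1) = x * Gamma x.
Proof.
move=> x0; have x1 : 0 < x + 1 by rewrite addr_gt0.
have := eGamma_rec x0; rewrite -!EFin_Gamma// -EFinM => -[->].
by rewrite mulrA divff ?mul1r// lt0r_neq0.
Qed.

Lemma Gamma_scale (x u : R) : 0 < x -> 0 < u ->
  (\int[mu]_(s in pos) (s `^ (x - 1) * expR (- (u * s)))%:E =
   (u `^ (- x) * Gamma x)%:E)%E.
Proof. by move=> x0 u0; rewrite eGamma_scale// -EFin_Gamma. Qed.

(** Gamma(x+y) (1 + s)^(-(x+y)) is itself a Gamma integral in u. Once the integrals are exchanged,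
    the s-integral gives u^(-x) Gamma(x) and the remaining u-integral Gamma(y). *)
Lemma integral_beta (x y : R) : 0 < x -> 0 < y ->
  (\int[mu]_(s in pos) (s `^ (x - 1) * (1 + s) `^ (- (x + y)))%:E =
   (Gamma x * Gamma y / Gamma (x + y))%:E)%E.
Proof.
move=> x0 y0; have xy0 : 0 < x + y by exact: addr_gt0.
pose f (s u : R) := s `^ (x - 1) * (u `^ (x + y - 1) * expR (- ((1 + s) * u))).
have mf : measurable_fun setT (fun p : R * R => f p.1 p.2).
  apply: measurable_funM.
    exact: (measurableT_comp (measurable_powR _) measurable_fst).
  apply: measurable_funM.
    exact: (measurableT_comp (measurable_powR _) measurable_snd).
  apply: (measurableT_comp (@measurable_expR R)); apply: measurableT_comp => //.
  apply: measurable_funM; last exact: measurable_snd.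
  by apply: measurable_funD => //; exact: measurable_fst.
have f0 s u : 0 <= f s u by rewrite !mulr_ge0 ?powR_ge0 ?expR_ge0.
have mb : measurable_fun setT (fun s : R => s `^ (x - 1) * (1 + s) `^ (- (x + y))).
  apply: measurable_funM; first exact: measurable_powR.
  by apply: (measurableT_comp (measurable_powR _)); exact: measurable_funD.
have E : ((Gamma (x + y))%:E * \int[mu]_(s in pos) (s `^ (x - 1) * (1 + s) `^ (- (x + y)))%:E =
    (Gamma x * Gamma y)%:E)%E.
  rewrite -ge0_integralZl//; last 3 first.
  - by apply/measurable_EFinP; exact: measurable_funTS.
  - by move=> s _; rewrite lee_fin mulr_ge0 ?powR_ge0.
  - by rewrite lee_fin ltW// Gamma_gt0.
  transitivity (\int[mu]_(s in pos) \int[mu]_(u in pos) (f s u)%:E)%E.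
    apply: eq_integral => s /set_mem/=; rewrite in_itv/= andbT => s0.
    transitivity ((s `^ (x - 1))%:E * \int[mu]_(u in pos) (u `^ (x + y - 1) * expR (- ((1 + s) * u)))%:E)%E.
      by rewrite Gamma_scale ?addr_gt0// -!EFinM; congr EFin; ring.
    rewrite -ge0_integralZl//.
    - by apply/measurable_EFinP; apply: measurable_funTS; exact: measurable_powRM_expR.
    - by move=> u _; rewrite lee_fin mulr_ge0 ?powR_ge0 ?expR_ge0.
    - by rewrite lee_fin powR_ge0.
  rewrite tonelli_dom//.
  transitivity (\int[mu]_(u in pos) ((Gamma x)%:E * (u `^ (y - 1) * expR (- (1 * u)))%:E))%E.
    apply: eq_integral => u /set_mem/=; rewrite in_itv/= andbT => u0.
    transitivity ((u `^ (x + y - 1) * expR (- u))%:E * \int[mu]_(s in pos) (s `^ (x - 1) * expR (- (u * s)))%:E)%E.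
      rewrite -[RHS]ge0_integralZl//.
      - apply: eq_integral => s _; rewrite -EFinM; congr EFin; rewrite /f.
        have -> : expR (- ((1 + s) * u)) = expR (- u) * expR (- (u * s)).
          by rewrite -expRD; congr expR; ring.
        by ring.
      - by apply/measurable_EFinP; apply: measurable_funTS; exact: measurable_powRM_expR.
      - by move=> s _; rewrite lee_fin mulr_ge0 ?powR_ge0 ?expR_ge0.
      - by rewrite lee_fin mulr_ge0 ?powR_ge0 ?expR_ge0.
    rewrite Gamma_scale// -!EFinM; congr EFin; rewrite mul1r.
    have -> : u `^ (y - 1) = u `^ (x + y - 1) * u `^ (- x).
      rewrite -powRD; last by rewrite (gt_eqF u0) implybT.
      by congr (_ `^ _); ring.
    by ring.
  rewrite ge0_integralZl//.
  - by rewrite Gamma_scale// powR1 mul1r.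
  - by apply/measurable_EFinP; apply: measurable_funTS; exact: measurable_powRM_expR.
  - by move=> s _; rewrite lee_fin mulr_ge0 ?powR_ge0 ?expR_ge0.
  - by rewrite lee_fin ltW// Gamma_gt0.
have G0 := Gamma_gt0 xy0.
have : ((Gamma (x + y))^-1%:E * ((Gamma (x + y))%:E * \int[mu]_(s in pos) (s `^ (x - 1) * (1 + s) `^ (- (x + y)))%:E) = (Gamma (x + y))^-1%:E * (Gamma x * Gamma y)%:E)%E by rewrite E.
by rewrite muleA -EFinM mulVf ?lt0r_neq0// mul1e -EFinM mulrC.
Qed.

Lemma integral_pos_indic (c v : R) (g : R -> R) : 0 < c -> 0 < v ->
  (\int[mu]_(s in pos) (g s * \1_(`]c, +oo[) (v * s))%:E =
   \int[mu]_(s in `](c / v)%R, +oo[) (g s)%:E)%E.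
Proof.
move=> c0 v0; rewrite [LHS]integral_mkcond [RHS]integral_mkcond.
apply: eq_integral => s _; rewrite !patchE indicE.
have -> : (v * s \in `]c, +oo[%classic) = (s \in `](c / v)%R, +oo[%classic).
  by apply/idP/idP => /set_mem /=; rewrite in_itv/= andbT => H; apply/mem_set;
    rewrite /= in_itv/= andbT; move: H; rewrite ltr_pdivrMr// mulrC.
case: ifPn => [sp|sp]; case: ifPn => [sc|sc]; rewrite ?mulr1 ?mulr0//.
exfalso; move/negP: sp; apply; apply/mem_set; move/set_mem: sc => /=.
rewrite !in_itv/= !andbT; apply: lt_trans; exact: divr_gt0.
Qed.

(** The substitution of 1/s for s is avoided by writing exp(-c/s) as \int_(c/s)^oo exp(-u) du. After
    exchange, the s-integral is a power tail starting at c/u, and Gamma(y+1)/y = Gamma(y). *)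
Lemma integral_inv_gamma (y c : R) : 0 < y -> 0 < c ->
  (\int[mu]_(s in pos) (s `^ (- y - 1) * expR (- (c / s)))%:E =
   (c `^ (- y) * Gamma y)%:E)%E.
Proof.
move=> y0 c0.
pose f (s u : R) := s `^ (- y - 1) * expR (- u) * \1_(`]c, +oo[) (s * u).
have mprod : measurable_fun setT (fun p : R * R => p.1 * p.2).
  by apply: measurable_funM; [exact: measurable_fst|exact: measurable_snd].
have mf : measurable_fun setT (fun p : R * R => f p.1 p.2).
  apply: measurable_funM; last first.
    by apply: (measurableT_comp _ mprod); exact: measurable_indic.
  apply: measurable_funM.
    exact: (measurableT_comp (measurable_powR _) measurable_fst).
  apply: (measurableT_comp (@measurable_expR R)).
  by apply: measurableT_comp => //; exact: measurable_snd.
have f0 s u : 0 <= f s u by rewrite !mulr_ge0 ?powR_ge0 ?expR_ge0.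
transitivity (\int[mu]_(s in pos) \int[mu]_(u in pos) (f s u)%:E)%E.
  apply: eq_integral => s /set_mem/=; rewrite in_itv/= andbT => s0.
  rewrite (integral_pos_indic (fun u => s `^ (- y - 1) * expR (- u)))//.
  transitivity ((s `^ (- y - 1))%:E * \int[mu]_(u in `](c / s)%R, +oo[) (1 * expR (- (1 * u)))%:E)%E.
    by rewrite integral_expR_tail// mul1r.
  rewrite -ge0_integralZl//.
  - by apply: eq_integral => u _; rewrite !mul1r.
  - apply/measurable_EFinP; apply: measurable_funTS; apply: measurable_funM => //.
    apply: (measurableT_comp (@measurable_expR R)); apply: measurableT_comp => //.
  - by rewrite lee_fin powR_ge0.
rewrite tonelli_dom//.
transitivity (\int[mu]_(u in pos) ((c `^ (- y) / y)%:E * (u `^ (y + 1 - 1) * expR (- (1 * u)))%:E))%E.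
  apply: eq_integral => u /set_mem/=; rewrite in_itv/= andbT => u0.
  have -> : (\int[mu]_(s in pos) (f s u)%:E = \int[mu]_(s in pos) (s `^ (- y - 1) * expR (- u) * \1_(`]c, +oo[) (u * s))%:E)%E.
    by apply: eq_integral => s _; rewrite /f (mulrC s u).
  rewrite (integral_pos_indic (fun s => s `^ (- y - 1) * expR (- u)))//.
  under eq_integral do rewrite mulrC EFinM.
  rewrite ge0_integralZl//.
  - rewrite integral_powR_tail ?divr_gt0// -!EFinM; congr EFin.
    rewrite addrK mul1r powRM ?invr_ge0 ?(ltW c0) ?(ltW u0)//.
    by rewrite -[u^-1]powR_inv1 ?(ltW u0)// -powRrM mulN1r opprK; ring.
  - by apply/measurable_EFinP; apply: measurable_funTS; exact: measurable_powR.
  - by move=> s _; rewrite lee_fin powR_ge0.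
rewrite ge0_integralZl//.
- rewrite Gamma_scale ?addr_gt0// powR1 mul1r Gamma_rec// -EFinM; congr EFin.
  by field; exact: lt0r_neq0.
- by apply/measurable_EFinP; apply: measurable_funTS; exact: measurable_powRM_expR.
- by move=> s _; rewrite lee_fin mulr_ge0 ?powR_ge0 ?expR_ge0.
- by rewrite lee_fin divr_ge0 ?powR_ge0// ltW.
Qed.

End GammaFunction.

Lemma measurable_integral_dom d1 d2 (T1 : measurableType d1)
    (T2 : measurableType d2) (R : realType)
    (m2 : {sigma_finite_measure set T2 -> \bar R}) (D2 : set T2) (f : T1 -> T2 -> R) :
  measurable D2 -> measurable_fun setT (fun p : T1 * T2 => f p.1 p.2) ->
  (forall x y, 0 <= f x y) ->
  measurable_fun setT (fun x => \int[m2]_(y in D2) (f x y)%:E)%E.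
Proof.
move=> mD2 mf f0; pose g p := ((f p.1 p.2) * \1_D2 p.2)%:E.
have mg : measurable_fun setT g.
  apply/measurable_EFinP; apply: measurable_funM => //.
  by apply: (measurableT_comp _ measurable_snd); exact: measurable_indic.
have g0 p : (0 <= g p)%E by rewrite lee_fin mulr_ge0.
have := @measurable_fun_fubini_tonelli_F _ _ _ _ R m2 g mg g0.
congr (measurable_fun _ _); apply/funext => x; rewrite /fubini_F.
rewrite [RHS]integral_mkcond; apply: eq_integral => y _.
by rewrite patchE /g indicE/=; case: ifPn; rewrite ?mulr1 ?mulr0.
Qed.

(** * Radial integrals over R^n without polar coordinates *)

Section RadialIntegrals.
Context {R : realType} {n : nat}.
Local Notation mu := (@lebesgue_measure R).
Local Notation leb := (@lebesgue_Rn R n).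
Local Notation pos := (`]0%R, +oo[%classic : set R).
Local Notation nsq := (@nsq R n).

Lemma nsq_dil (c : R) u : nsq (dil c u) = c ^+ 2 * nsq u.
Proof.
rewrite /nsq /qdist mulr_sumr; apply: eq_bigr => i _.
by rewrite tnth_dil !subr0 exprMn.
Qed.

(** The indicator of the origin is below exp(-(pi/d^2)|u|^2), whose integral is d^n. With d <= 1 and
    n > 0 this is at most d, which may be taken arbitrarily small. *)
Lemma ae_nsq_gt0 : (0 < n)%N -> {ae leb, forall u, 0 < nsq u}.
Proof.
move=> n0; exists [set u | nsq u <= 0]; split.
- rewrite (_ : [set u | _] = nsq @^-1` `]-oo, 0]); last first.
    by apply/seteqP; split => u /=; rewrite in_itv.
  by rewrite -[X in measurable X]setTI; exact: measurable_nsq.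
- apply/eqP; rewrite eq_le measure_ge0 andbT.
  apply/lee_addgt0Pr => e e0; rewrite add0e.
  pose d := Num.min e 1; have d0 : 0 < d by rewrite lt_min e0 ltr01.
  have mA : measurable [set u | nsq u <= 0].
    rewrite (_ : [set u | _] = nsq @^-1` `]-oo, 0]); last first.
      by apply/seteqP; split => u /=; rewrite in_itv.
    by rewrite -[X in measurable X]setTI; exact: measurable_nsq.
  have p0 : 0 < pi / d ^+ 2 by rewrite divr_gt0 ?pi_gt0// exprn_gt0.
  apply: (@le_trans _ _ (\int[leb]_u (expR (- (pi / d ^+ 2 * qdist (fun=> 0) u)))%:E)%E).
    rewrite -[X in leb X]setIT -integral_indic//.
    apply: ge0_le_integral => //.
    + by apply/measurable_EFinP.
    + by apply/measurable_EFinP; exact: measurable_gaussN.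
    + move=> u _; rewrite lee_fin indicE; case: (boolP (u \in _)) => [/set_mem/= u0|_].
        have -> : qdist (fun=> 0) u = 0.
          by apply/eqP; rewrite eq_le u0 (nsq_ge0 u).
        by rewrite mulr0 oppr0 expR0.
      by rewrite expR_ge0.
  rewrite ge0_integral_gaussN// lee_fin.
  have -> : pi / (pi / d ^+ 2) = d ^+ 2 :> R by rewrite invf_div mulrCA divff ?mulr1// lt0r_neq0// pi_gt0.
  rewrite sqrtr_sqr gtr0_norm//.
  apply: (@le_trans _ _ d); last by rewrite ge_min lexx.
  by rewrite -[leRHS]expr1 ler_wiXn2l ?(ltW d0)// ge_min lexx orbT.
- by move=> u /= /negP; rewrite -leNgt.
Qed.

Lemma measurable_nsq_powR (b : R) : measurable_fun setT (fun u => nsq u `^ b).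
Proof. exact: (measurableT_comp (measurable_powR b) measurable_nsq). Qed.

Lemma measurable_exp_nsq (s : R) : measurable_fun setT (fun u => expR (- (s * nsq u))).
Proof. exact: measurable_gaussN. Qed.

(* From [Gamma b * q^(- b) = \int_0^oo s^(b - 1) exp (- s q) ds]. *)
Lemma integral_power_mixture (b : R) (psi : n.-tuple R -> R) (k : R -> R) :
  (0 < n)%N -> 0 < b -> measurable_fun setT psi -> (forall u, 0 <= psi u) ->
  (forall s, 0 < s -> (\int[leb]_u (expR (- (s * nsq u)) * psi u)%:E = (k s)%:E)%E) ->
  ((Gamma b)%:E * \int[leb]_u (nsq u `^ (- b) * psi u)%:E =
   \int[mu]_(s in pos) (s `^ (b - 1) * k s)%:E)%E.
Proof.
move=> n0 b0 mpsi psi0 Hk.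
pose f u (s : R) := s `^ (b - 1) * (expR (- (s * nsq u)) * psi u).
have mf : measurable_fun setT (fun p : n.-tuple R * R => f p.1 p.2).
  apply: measurable_funM.
    exact: (measurableT_comp (measurable_powR _) measurable_snd).
  apply: measurable_funM; last exact: (measurableT_comp mpsi measurable_fst).
  apply: (measurableT_comp (@measurable_expR R)); apply: measurableT_comp => //.
  apply: measurable_funM; first exact: measurable_snd.
  exact: (measurableT_comp measurable_nsq measurable_fst).
have f0 u s : 0 <= f u s by rewrite !mulr_ge0 ?powR_ge0 ?expR_ge0.
have mnp : measurable_fun setT (fun u => nsq u `^ (- b) * psi u).
  by apply: measurable_funM => //; exact: measurable_nsq_powR.
rewrite -ge0_integralZl//; last 3 first.
- exact/measurable_EFinP.
- by move=> u _; rewrite lee_fin mulr_ge0 ?powR_ge0.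
- by rewrite lee_fin ltW// Gamma_gt0.
transitivity (\int[leb]_u \int[mu]_(s in pos) (f u s)%:E)%E.
  apply: ge0_ae_eq_integral => //.
  - apply: emeasurable_funM => //; exact/measurable_EFinP.
  - exact: (@measurable_integral_dom _ _ _ _ R mu pos f).
  - by move=> u _; rewrite mule_ge0// lee_fin ?mulr_ge0 ?powR_ge0// ltW// Gamma_gt0.
  - by move=> u _; apply: integral_ge0 => s _; rewrite lee_fin.
  apply: filterS (ae_nsq_gt0 n0) => u u0 _.
  transitivity ((psi u)%:E * \int[mu]_(s in pos) (s `^ (b - 1) * expR (- (nsq u * s)))%:E)%E.
    by rewrite Gamma_scale// -!EFinM; congr EFin; ring.
  rewrite -ge0_integralZl//.
  - by apply: eq_integral => s _; rewrite -EFinM; congr EFin; rewrite /f (mulrC s); ring.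
  - by apply/measurable_EFinP; apply: measurable_funTS; exact: measurable_powRM_expR.
  - by move=> s _; rewrite lee_fin mulr_ge0 ?powR_ge0 ?expR_ge0.
  - by rewrite lee_fin.
rewrite (@tonelli_dom _ _ _ _ R leb mu setT pos f)//.
apply: eq_integral => s /set_mem/=; rewrite in_itv/= andbT => s0.
rewrite EFinM -Hk// -ge0_integralZl//.
- apply/measurable_EFinP; apply: measurable_funM => //; exact: measurable_exp_nsq.
- by move=> u _; rewrite lee_fin mulr_ge0 ?expR_ge0.
- by rewrite lee_fin powR_ge0.
Qed.

Definition ball_volume : \bar R := (\int[leb]_u (\1_(`]-oo, 1[) (nsq u))%:E)%E.

Lemma measurable_indic_nsq (r : R) : measurable_fun setT (fun u => \1_(`]-oo, r[%classic) (nsq u) : R).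
Proof.
by apply: (measurableT_comp _ measurable_nsq); exact: measurable_indic.
Qed.

Lemma integral_ball (r : R) : 0 < r ->
  (\int[leb]_u (\1_(`]-oo, r[) (nsq u))%:E = (r `^ (n%:R / 2))%:E * ball_volume)%E.
Proof.
move=> r0; have sr0 : 0 < Num.sqrt r by rewrite sqrtr_gt0.
rewrite (ge0_integral_dil sr0); last 2 first.
- by apply/measurable_EFinP; exact: measurable_indic_nsq.
- by move=> u; rewrite lee_fin.
congr (_%:E * _)%E.
  by rewrite -powR12_sqrt ?(ltW r0)// -powR_mulrn ?powR_ge0// -powRrM mulrC.
apply: eq_integral => u _; rewrite nsq_dil sqr_sqrtr ?(ltW r0)//; congr EFin.
rewrite !indicE; congr (nat_of_bool _)%:R.
by apply/idP/idP => /set_mem /=; rewrite in_itv/= => H; apply/mem_set;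
  rewrite /= in_itv/=; move: H; rewrite -ltr_pdivlMl// mulVf ?lt0r_neq0.
Qed.

(* Layer cake: [exp (- z)] is the mass of [{v | z < v}] under [exp (- v) dv]. *)
Lemma integral_expR_nsq_powR (a l : R) : 0 < a -> 0 < l ->
  (\int[leb]_u (expR (- (l * nsq u `^ a)))%:E =
   (l `^ (- (n%:R / (2 * a))) * Gamma (n%:R / (2 * a) + 1))%:E * ball_volume)%E.
Proof.
move=> a0 l0.
pose f u (v : R) := expR (- v) * \1_(`]0, +oo[) (v - l * nsq u `^ a).
have ml : measurable_fun setT (fun u : n.-tuple R => l * nsq u `^ a).
  by apply: measurable_funM => //; exact: measurable_nsq_powR.
have mf : measurable_fun setT (fun p : n.-tuple R * R => f p.1 p.2).
  apply: measurable_funM.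
    apply: (measurableT_comp (@measurable_expR R)).
    by apply: measurableT_comp => //; exact: measurable_snd.
  apply: measurableT_comp; first exact: measurable_indic.
  apply: measurable_funB; first exact: measurable_snd.
  exact: (measurableT_comp ml measurable_fst).
have f0 u v : 0 <= f u v by rewrite mulr_ge0 ?expR_ge0.
transitivity (\int[leb]_u \int[mu]_(v in pos) (f u v)%:E)%E.
  apply: eq_integral => u _.
  have z0 : 0 <= l * nsq u `^ a by rewrite mulr_ge0 ?powR_ge0 ?ltW.
  have := integral_expR_tail (l * nsq u `^ a) (@ltr01 R); rewrite mul1r => <-.
  rewrite [LHS]integral_mkcond [RHS]integral_mkcond; apply: eq_integral => v _.
  rewrite !patchE /f indicE !mul1r.
  have -> : (v - l * nsq u `^ a \in `]0, +oo[%classic) = (v \in `](l * nsq u `^ a)%R, +oo[%classic).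
    by apply/idP/idP => /set_mem /=; rewrite in_itv/= andbT => H; apply/mem_set;
      rewrite /= in_itv/= andbT; move: H; rewrite subr_gt0.
  case: ifPn => [vz|vz]; case: ifPn => [vp|vp]; rewrite ?mulr1 ?mulr0//.
  exfalso; move/negP: vp; apply; apply/mem_set; move/set_mem: vz => /=.
  by rewrite !in_itv/= !andbT; exact: le_lt_trans.
rewrite (@tonelli_dom _ _ _ _ R leb mu setT pos f)//.
pose c := n%:R / (2 * a).
transitivity (\int[mu]_(v in pos) ((l `^ (- c))%:E * ball_volume * (v `^ (c + 1 - 1) * expR (- (1 * v)))%:E))%E.
  apply: eq_integral => v /set_mem/=; rewrite in_itv/= andbT => v0.
  pose r := (v / l) `^ a^-1.
  have vl0 : 0 < v / l by exact: divr_gt0.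
  have r0 : 0 < r by rewrite powR_gt0.
  have E u : f u v = expR (- v) * \1_(`]-oo, r[) (nsq u).
    rewrite /f !indicE; congr (_ * (nat_of_bool _)%:R).
    have eqv : (0 < v - l * nsq u `^ a) = (nsq u < r).
      rewrite subr_gt0 -ltr_pdivlMl// (mulrC _ v).
      have -> : v / l = r `^ a by rewrite -powRrM mulVf ?lt0r_neq0// powRr1// ltW.
      apply/idP/idP => [|H]; last by rewrite gt0_ltr_powR ?nnegrE ?nsq_ge0// ltW.
      apply: contraTT; rewrite -!leNgt => H.
      by rewrite ge0_ler_powR ?nnegrE ?nsq_ge0// ltW.
    by apply/idP/idP => /set_mem /=; rewrite in_itv/= ?andbT => H; apply/mem_set;
      rewrite /= in_itv/= ?andbT; move: H; rewrite eqv.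
  under eq_integral do rewrite E EFinM.
  have mi := measurable_indic_nsq r.
  rewrite ge0_integralZl//; last exact/measurable_EFinP.
  rewrite integral_ball// muleA -EFinM muleAC -EFinM; congr (_%:E * _)%E.
  rewrite addrK mul1r /r -powRrM.
  rewrite (_ : a^-1 * (n%:R / 2) = c); last by rewrite /c invfM; ring.
  rewrite powRM ?invr_ge0 ?(ltW v0) ?(ltW l0)//.
  by rewrite -[l^-1]powR_inv1 ?(ltW l0)// -powRrM mulN1r; ring.
have bv0 : (0 <= ball_volume)%E by apply: integral_ge0 => u _; rewrite lee_fin.
rewrite ge0_integralZl//.
- have c0 : 0 <= c by rewrite divr_ge0// mulr_ge0// ltW.
  rewrite Gamma_scale ?ltr_wpDl// powR1 mul1r EFinM muleAC//.
- by apply/measurable_EFinP; apply: measurable_funTS; exact: measurable_powRM_expR.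
- by move=> s _; rewrite lee_fin mulr_ge0 ?powR_ge0 ?expR_ge0.
- by rewrite mule_ge0// lee_fin powR_ge0.
Qed.

(** For a = l = 1 the layer-cake formula evaluates a Gaussian integral already known, which
    determines the volume of the ball. *)
Lemma ball_volumeE :
  (ball_volume = (Num.sqrt pi ^+ n / Gamma (n%:R / 2 + 1))%:E)%E.
Proof.
have := integral_expR_nsq_powR (@ltr01 R) (@ltr01 R).
rewrite powR1 mul1r mulr1.
have -> : (\int[leb]_u (expR (- (1 * nsq u `^ 1)))%:E = (Num.sqrt pi ^+ n)%:E)%E.
  have := @ge0_integral_gaussN R n 1 (fun=> 0) ltr01; rewrite divr1 => <-.
  by apply: eq_integral => u _; rewrite powRr1// nsq_ge0.
have g0 : 0 < Gamma (n%:R / 2 + 1 : R) by apply: Gamma_gt0; rewrite ltr_wpDl// divr_ge0.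
move=> H; have : ((Gamma (n%:R / 2 + 1))^-1%:E * (Num.sqrt pi ^+ n)%:E = (Gamma (n%:R / 2 + 1))^-1%:E * ((Gamma (n%:R / 2 + 1))%:E * ball_volume))%E by rewrite H.
by rewrite muleA -!EFinM mulVf ?lt0r_neq0// mul1e mulrC => ->.
Qed.

End RadialIntegrals.

(** * Asymptotics for the Cauchy covariance *)

(* Otherwise [done] and [ring] unfold the integral. *)
Opaque Gamma.

(** * The integrable case, alpha beta > n *)

Section CauchyIntegrable.
Context {R : realType} {n : nat}.
Hypothesis n0 : (0 < n)%N.
Local Notation mu := (@lebesgue_measure R).
Local Notation leb := (@lebesgue_Rn R n).
Local Notation pos := (`]0%R, +oo[%classic : set R).
Local Notation nsq := (@nsq R n).
Local Notation zero := ((fun=> 0) : ordinal n -> R).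

Definition cauchy (a b r : R) : R := (1 + r `^ a) `^ (- b).

Lemma cauchy_ge0 a b r : 0 <= cauchy a b r.
Proof. exact: powR_ge0. Qed.

Lemma heat0 (F : R -> R) e :
  heat F e zero = \int[leb]_u (F (nsq u) * expR (- (e * nsq u))).
Proof.
rewrite /heat; apply: eq_Rintegral => u _.
by rewrite /lform big1 ?cos0 ?mul1r// => i _; rewrite mul0r.
Qed.

Lemma measurable_cauchy_nsq a b :
  measurable_fun setT (fun u : n.-tuple R => cauchy a b (nsq u)).
Proof.
apply: (measurableT_comp (measurable_powR _)); apply: measurable_funD => //.
exact: measurable_nsq_powR.
Qed.

(* From [Gamma b * (1 + z)^(- b) = \int_0^oo s^(b - 1) exp (- (1 + z) s) ds]. *)
Lemma integral_cauchy_nsq (a b : R) : 0 < a -> n%:R / (2 * a) < b ->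
  (\int[leb]_u (cauchy a b (nsq u))%:E =
   (Gamma (n%:R / (2 * a) + 1) * Gamma (b - n%:R / (2 * a)) / Gamma b
     * (Num.sqrt pi ^+ n / Gamma (n%:R / 2 + 1)))%:E)%E.
Proof.
move=> a0 nb; set c := n%:R / (2 * a) in nb *.
have c0 : 0 <= c by rewrite divr_ge0// mulr_ge0// ltW.
have b0 : 0 < b by exact: le_lt_trans nb.
pose f (u : n.-tuple R) (s : R) := s `^ (b - 1) * expR (- ((1 + nsq u `^ a) * s)).
have mf : measurable_fun setT (fun p : n.-tuple R * R => f p.1 p.2).
  apply: measurable_funM.
    exact: (measurableT_comp (measurable_powR _) measurable_snd).
  apply: (measurableT_comp (@measurable_expR R)); apply: measurableT_comp => //.
  apply: measurable_funM; last exact: measurable_snd.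
  apply: measurable_funD => //.
  exact: (measurableT_comp (measurable_nsq_powR a) measurable_fst).
have H : ((Gamma b)%:E * \int[leb]_u (cauchy a b (nsq u))%:E =
    (Gamma (c + 1) * Gamma (b - c) * (Num.sqrt pi ^+ n / Gamma (n%:R / 2 + 1)))%:E)%E.
  rewrite -ge0_integralZl//; last 3 first.
  - by apply/measurable_EFinP; exact: measurable_cauchy_nsq.
  - by move=> u _; rewrite lee_fin cauchy_ge0.
  - by rewrite lee_fin ltW// Gamma_gt0.
  transitivity (\int[leb]_u \int[mu]_(s in pos) (f u s)%:E)%E.
    apply: eq_integral => u _.
    by rewrite Gamma_scale// ?ltr_wpDr ?powR_ge0// -EFinM mulrC.
  rewrite (@tonelli_dom _ _ _ _ R leb mu setT pos f)//; last first.
    by move=> u s _ _; rewrite mulr_ge0 ?powR_ge0 ?expR_ge0.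
  transitivity (\int[mu]_(s in pos) ((Gamma (c + 1))%:E * @ball_volume R n * (s `^ (b - c - 1) * expR (- (1 * s)))%:E))%E.
    apply: eq_integral => s /set_mem/=; rewrite in_itv/= andbT => s0.
    transitivity ((s `^ (b - 1) * expR (- s))%:E * \int[leb]_u (expR (- (s * nsq u `^ a)))%:E)%E.
      rewrite -ge0_integralZl; [|exact: measurableT| | |].
      - apply: eq_integral => u _; rewrite -EFinM /f -mulrA -expRD; congr ((_ * expR _)%:E); ring.
      - apply/measurable_EFinP; apply: (measurableT_comp (@measurable_expR R)).
        by apply: measurableT_comp => //; apply: measurable_funM => //; exact: measurable_nsq_powR.
      - by move=> u _; rewrite lee_fin expR_ge0.
      - by move: (powR_ge0 s (b - 1)) (expR_ge0 (- s)) => p0 e0; rewrite lee_fin; exact: mulr_ge0.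
    rewrite integral_expR_nsq_powR// muleA -EFinM muleAC -EFinM; congr (_%:E * _)%E.
    rewrite (_ : b - c - 1 = (b - 1) - c); last by ring.
    rewrite -/c mul1r [s `^ (b - 1 - c)]powRB ?lt0r_neq0 ?implybT// powRN; ring.
  rewrite ball_volumeE -EFinM ge0_integralZl//.
  - rewrite Gamma_scale ?subr_gt0// powR1 mul1r -EFinM; congr EFin; move: (_ ^+ n / _) => K; ring.
  - by apply/measurable_EFinP; apply: measurable_funTS; exact: measurable_powRM_expR.
  - by move=> s _; rewrite lee_fin mulr_ge0 ?powR_ge0 ?expR_ge0.
  - by rewrite lee_fin mulr_ge0// ?divr_ge0// ltW// ?Gamma_gt0// ltr_wpDl// divr_ge0.
move: H; move: (\int[leb]_u _)%E => I /(congr1 (mule (Gamma b)^-1%:E)).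
by rewrite muleA -!EFinM mulVf ?lt0r_neq0 ?Gamma_gt0// mul1e => ->; congr EFin; move: (_ ^+ n / _) => K; ring.
Qed.

Lemma cvg_heat_integrable (F : R -> R) (c : R) : cmono F -> 0 < c ->
  leb.-integrable setT (fun u => (F (nsq u))%:E) ->
  heat F (c * r ^+ 2) zero @[r --> 0^'+] --> \int[leb]_u F (nsq u).
Proof.
move=> cF c0 iF; apply/cvg_at_rightP => u [u0 cu]; under eq_fun do rewrite heat0.
have mF := @measurable_cmono R n _ cF.
apply: (@Rdominated_cvg _ _ _ _ _ _ (fun u => F (nsq u)) _ _ _ iF).2 => //.
  by move=> k; apply: measurable_funM => //; exact: measurable_exp_nsq.
apply: aeW => x; split.
  rewrite -[X in _ --> X]mulr1; apply: cvgMl_tmp.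
  have c1 : - (c * u k ^+ 2 * nsq x) @[k --> \oo] --> (0 : R).
    rewrite -[X in _ --> X](_ : - (c * 0 ^+ 2 * nsq x) = 0); last by rewrite expr0n mulr0 mul0r oppr0.
    by apply: cvgN; apply: cvgMr_tmp; apply: cvgMl_tmp; apply: cvgM.
  by have := cvg_comp _ _ c1 (@continuous_expR R 0); rewrite expR0.
move=> k; have F0 := cmono_ge0 cF (nsq_ge0 x).
rewrite normrM ger0_norm// ger0_norm ?expR_ge0// ler_piMr//.
by rewrite -expR0 ler_expR oppr_le0 !mulr_ge0 ?nsq_ge0 ?sqr_ge0 ?ltW.
Qed.

Lemma tauberian_cauchy_integrable (a b : R) (St : ('I_n -> R) -> R) :
  0 < a <= 1 -> n%:R / (2 * a) < b ->
  (forall x, 0 < vsq x -> heat_limit (cauchy a b) x (St x)) ->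
  forall eta, 0 < eta -> \forall r \near 0^'+, forall x, vsq x = r ^+ 2 ->
    `|St x / 1 - Gamma (n%:R / (2 * a) + 1) * Gamma (b - n%:R / (2 * a)) / Gamma b
     * (Num.sqrt pi ^+ n / Gamma (n%:R / 2 + 1))| < eta.
Proof.
move=> /andP[a0 a1] nb HS.
have b0 : 0 <= b by apply: (le_trans _ (ltW nb)); rewrite divr_ge0// mulr_ge0// ltW.
have cF : cmono (cauchy a b) by apply: cmono_cauchy => //; rewrite a0.
have IF := integral_cauchy_nsq a0 nb.
apply: (tauberian_centered n0 (N := fun=> 1) cF HS) => // c c0.
under eq_fun do rewrite divr1.
have <- : \int[leb]_u cauchy a b (nsq u) = Gamma (n%:R / (2 * a) + 1) * Gamma (b - n%:R / (2 * a)) / Gamma b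
     * (Num.sqrt pi ^+ n / Gamma (n%:R / 2 + 1)) by rewrite /Rintegral IF.
apply: cvg_heat_integrable => //; apply/integrableP; split.
  by apply/measurable_EFinP; exact: measurable_cauchy_nsq.
under eq_integral do rewrite gee0_abs ?lee_fin ?cauchy_ge0//.
by rewrite IF ltry.
Qed.

End CauchyIntegrable.

(** * The integral that produces the logarithm *)

Section Logarithmic.
Context {R : realType}.
Local Notation mu := (@lebesgue_measure R).
Local Notation pos := (`]0%R, +oo[%classic : set R).

Lemma integral_derivative_pos (F f : R -> R) (a b : R) : 0 < a < b ->
  (forall v : R, 0 < v -> is_derive v 1 F (f v)) ->
  (forall v : R, 0 < v -> {for v, continuous f}) ->
  (\int[mu]_(v in `[a, b]) (f v)%:E = (F b - F a)%:E)%E.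
Proof.
move=> /andP[a0 ab] dF cf.
have cF v : 0 < v -> {for v, continuous F}.
  move=> v0; apply: differentiable_continuous; apply/derivable1_diffP.
  by apply: ex_derive; exact: dF.
rewrite (@continuous_FTC2 _ f F)//.
- apply: continuous_in_subspaceT => u; rewrite inE/= in_itv/= => /andP[au _].
  exact/cf/(lt_le_trans a0).
- split.
  + move=> u; rewrite in_itv/= => /andP[au _]; apply: ex_derive; apply: dF; exact: lt_trans au.
  + by apply: cvg_at_right_filter; exact: cF.
  + by apply: cvg_at_left_filter; apply: cF; exact: lt_trans ab.
- move=> u; rewrite in_itv/= => /andP[au _]; rewrite derive1E; apply: derive_val.
  by apply: dF; exact: lt_trans au.
Qed.

Lemma integral_powR_shift (s y e : R) : 0 <= s -> 0 < e ->
  (\int[mu]_(v in `[e, (1 + e)%R]) (y * (s + v) `^ (- y - 1))%:E =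
   ((s + e) `^ (- y) - (s + (1 + e)) `^ (- y))%:E)%E.
Proof.
move=> s0 e0.
have sv (v : R) : 0 < v -> 0 < s + v by exact: ltr_wpDl.
have d1 v : is_derive v (1 : R) (fun v => s + v) 1.
  by apply: is_derive_eq (is_deriveD (is_derive_cst s v 1) (is_derive_id v 1)) _; rewrite add0r.
have dp (z v : R) : 0 < v -> is_derive v (1 : R) (fun v => (s + v) `^ z) (z * (s + v) `^ (z - 1)).
  move=> v0; have := is_derive1_comp (is_derive1_powR z (sv _ v0)) (d1 v).
  by move=> H; apply: is_derive_eq H _; rewrite /GRing.scale/= mulr1.
have ab : 0 < e < 1 + e by rewrite e0 ltrDr ltr01.
have dF (v : R) : 0 < v ->
    is_derive v 1 (fun v => - (s + v) `^ (- y)) (y * (s + v) `^ (- y - 1)).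
  by move=> v0; apply: is_derive_eq (is_deriveN (dp (- y) v v0)) _; rewrite -mulNr opprK.
rewrite (integral_derivative_pos ab dF); first by congr EFin; rewrite opprK addrC.
move=> v v0; apply: differentiable_continuous; apply/derivable1_diffP.
by apply: ex_derive; exact: (is_deriveZ y (dp (- y - 1) v v0)).
Qed.

(** Scaling by v reduces to the Beta integral with parameters y and 1, that is 1/y. *)
Lemma integral_beta_shift (y v : R) : 0 < y -> 0 < v ->
  (\int[mu]_(s in pos) (s `^ (y - 1) * (s + v) `^ (- y - 1))%:E = ((y * v)^-1)%:E)%E.
Proof.
move=> y0 v0.
have mf : measurable_fun setT (fun s : R => (s `^ (y - 1) * (s + v) `^ (- y - 1))%:E).
  apply/measurable_EFinP; apply: measurable_funM; first exact: measurable_powR.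
  by apply: (measurableT_comp (measurable_powR _)); exact: measurable_funD.
rewrite (ge0_integral_dil0y v0 mf); last by move=> s _; rewrite lee_fin mulr_ge0 ?powR_ge0.
transitivity (v%:E * \int[mu]_(s in pos) ((v ^+ 2)^-1%:E * (s `^ (y - 1) * (1 + s) `^ (- (y + 1)))%:E))%E.
  congr (_ * _)%E; apply: eq_integral => s /set_mem/=; rewrite in_itv/= andbT => s0.
  rewrite -EFinM; congr EFin.
  rewrite (_ : v * s + v = v * (1 + s)); last by ring.
  rewrite !powRM ?(ltW v0) ?(ltW s0) ?addr_ge0 ?(ltW s0)//.
  have -> : (v ^+ 2)^-1 = v `^ (y - 1) * v `^ (- y - 1).
    rewrite -powRD ?lt0r_neq0 ?implybT// (_ : y - 1 + (- y - 1) = - 2%:R); last by ring.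
    by rewrite powRN powR_mulrn// ltW.
  rewrite (_ : - (y + 1) = - y - 1); ring.
have v2 : 0 <= (v ^+ 2)^-1 by rewrite invr_ge0 sqr_ge0.
rewrite ge0_integralZl//; first last.
- by move=> s _; rewrite lee_fin mulr_ge0 ?powR_ge0.
- apply/measurable_EFinP; apply: measurable_funTS.
  apply: measurable_funM; first exact: measurable_powR.
  by apply: (measurableT_comp (measurable_powR _)); exact: measurable_funD.
rewrite integral_beta// Gamma_rec// muleA -!EFinM; congr EFin.
have g1 : Gamma (1 : R) = 1.
  have := Gamma_scale (@ltr01 R) (@ltr01 R); rewrite powR1 mul1r.
  have := integral_expR_tail (0 : R) (@ltr01 R); rewrite mulr0 oppr0 expR0 => E.
  rewrite (_ : (\int[mu]_(s in pos) _)%E = 1%:E); first by move=> -[].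
  by rewrite -E; apply: eq_integral => s _; rewrite subrr powRr0.
have := Gamma_gt0 y0; rewrite g1; move: (Gamma y) => g gy.
by field; rewrite !lt0r_neq0.
Qed.

Lemma integral_inv (e : R) : 0 < e ->
  (\int[mu]_(v in `[e, (1 + e)%R]) (v^-1)%:E = (ln ((1 + e) / e))%:E)%E.
Proof.
move=> e0; have ab : 0 < e < 1 + e by rewrite e0 ltrDr ltr01.
rewrite (integral_derivative_pos ab (@is_derive1_ln R)).
  by rewrite ln_div// posrE// addr_gt0.
by move=> v v0; apply: continuousV (lt0r_neq0 v0) (@cvg_id _ _).
Qed.

(** An integral of Frullani type: the difference of powers is the integral over v in [e, 1+e] of y
    (s + v)^(-y-1). After exchange the s-integral contributes 1/v, whatever y is. *)
Lemma integral_powR_difference (y e : R) : 0 < y -> 0 < e ->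
  (\int[mu]_(s in pos) (s `^ (y - 1) * ((s + e) `^ (- y) - (s + (1 + e)) `^ (- y)))%:E =
   (ln ((1 + e) / e))%:E)%E.
Proof.
move=> y0 e0.
pose f (s v : R) := s `^ (y - 1) * (y * (s + v) `^ (- y - 1)).
have f0 s v : 0 <= f s v by rewrite !mulr_ge0 ?powR_ge0 ?ltW.
have mp (z : R) : measurable_fun setT (fun s : R => y * (s + z) `^ (- y - 1)).
  apply: measurable_funM => //.
  by apply: (measurableT_comp (measurable_powR _)); exact: measurable_funD.
have mp' (s : R) : measurable_fun setT (fun v : R => y * (s + v) `^ (- y - 1)).
  by apply: eq_measurable_fun (mp s) => v _; rewrite addrC.
have mf : measurable_fun setT (fun p : R * R => f p.1 p.2).
  apply: measurable_funM.
    exact: (measurableT_comp (measurable_powR _) measurable_fst).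
  apply: measurable_funM => //; apply: (measurableT_comp (measurable_powR _)).
  by apply: measurable_funD; [exact: measurable_fst|exact: measurable_snd].
transitivity (\int[mu]_(s in pos) \int[mu]_(v in `[e, (1 + e)%R]) (f s v)%:E)%E.
  apply: eq_integral => s /set_mem/=; rewrite in_itv/= andbT => s0.
  rewrite EFinM -integral_powR_shift ?(ltW s0)// -ge0_integralZl//.
  - by apply/measurable_EFinP; apply: measurable_funTS; exact: mp'.
  - by move=> v _; rewrite lee_fin mulr_ge0 ?powR_ge0 ?(ltW y0).
  - by rewrite lee_fin powR_ge0.
rewrite (@tonelli_dom _ _ _ _ R mu mu pos `[e, (1 + e)%R] f)// -integral_inv//.
apply: eq_integral => v /set_mem/=; rewrite in_itv/= => /andP[ev _].
have v0 : 0 < v by exact: lt_le_trans ev.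
transitivity (\int[mu]_(s in pos) (y%:E * (s `^ (y - 1) * (s + v) `^ (- y - 1))%:E))%E.
  by apply: eq_integral => s _; rewrite -EFinM; congr EFin; rewrite /f; ring.
rewrite ge0_integralZl//; last 3 first.
- apply/measurable_EFinP; apply: measurable_funTS.
  apply: measurable_funM; first exact: measurable_powR.
  by apply: (measurableT_comp (measurable_powR _)); exact: measurable_funD.
- by move=> s _; rewrite lee_fin mulr_ge0 ?powR_ge0.
- by rewrite lee_fin ltW.
by rewrite integral_beta_shift// -EFinM; congr EFin; field; rewrite !lt0r_neq0.
Qed.

End Logarithmic.

(** * The critical case, alpha beta = n *)

Section CauchyCritical.
Context {R : realType} {n : nat}.
Hypothesis n0 : (0 < n)%N.
Local Notation mu := (@lebesgue_measure R).
Local Notation leb := (@lebesgue_Rn R n).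
Local Notation pos := (`]0%R, +oo[%classic : set R).
Local Notation nsq := (@nsq R n).
Local Notation zero := ((fun=> 0) : ordinal n -> R).

Lemma sqrt_pi_divX (p : R) : 0 < p ->
  Num.sqrt (pi / p) ^+ n = Num.sqrt pi ^+ n * p `^ (- (n%:R / 2)).
Proof.
move=> p0; rewrite sqrtrM ?pi_ge0// exprMn; congr (_ * _).
rewrite -powR_mulrn ?sqrtr_ge0// -powR12_sqrt ?invr_ge0 ?(ltW p0)//.
by rewrite -powR_inv1 ?(ltW p0)// -!powRrM; congr powR; field.
Qed.

Let y : R := n%:R / 2.
Let y0 : 0 < y. Proof. by rewrite divr_gt0// ltr0n. Qed.

(** It has the tail q^(-n/2) of the critical covariance, while the factor 1 - exp(-q) restores
    integrability at the origin. Multiplied by exp(-e q) it becomes q^(-n/2) times a difference of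
    two exponentials, which can be integrated in closed form. *)
Definition log_profile (q : R) : R := q `^ (- y) * (1 - expR (- q)).

Lemma log_profile_ge0 q : 0 <= q -> 0 <= log_profile q.
Proof. by move=> q0; rewrite mulr_ge0 ?powR_ge0// subr_ge0 expR_le1 oppr_le0. Qed.

Lemma log_profile_heat e q :
  log_profile q * expR (- (e * q)) =
  q `^ (- y) * (expR (- (e * q)) - expR (- ((1 + e) * q))).
Proof.
rewrite /log_profile -mulrA mulrBl mul1r -expRD; congr (_ * (_ - expR _)); ring.
Qed.

(** Writing q^(-y) as a mixture of exponentials leaves Gaussian integrals in u, hence the difference
    of powers whose s-integral is the logarithm. *)
Lemma ge0_integral_log_profile e : 0 < e ->
  (\int[leb]_u (log_profile (nsq u) * expR (- (e * nsq u)))%:E =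
   (Num.sqrt pi ^+ n / Gamma y * ln ((1 + e) / e))%:E)%E.
Proof.
move=> e0.
pose psi (u : n.-tuple R) := expR (- (e * nsq u)) - expR (- ((1 + e) * nsq u)).
pose k (s : R) := Num.sqrt pi ^+ n * ((s + e) `^ (- y) - (s + (1 + e)) `^ (- y)).
have mpsi : measurable_fun setT psi.
  by apply: measurable_funB; exact: measurable_exp_nsq.
have psi0 u : 0 <= psi u.
  by rewrite subr_ge0 ler_expR lerN2 ler_wpM2r ?nsq_ge0// lerDr.
have kE s : 0 < s -> (\int[leb]_u (expR (- (s * nsq u)) * psi u)%:E = (k s)%:E)%E.
  move=> s0; have se0 : 0 < s + e by rewrite addr_gt0.
  have se1 : 0 < s + (1 + e) by rewrite !addr_gt0.
  have i1 := integrable_gaussN (fun=> 0 : R) se0 : leb.-integrable setT _.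
  have i2 := integrable_gaussN (fun=> 0 : R) se1 : leb.-integrable setT _.
  transitivity (\int[leb]_u ((expR (- ((s + e) * nsq u)))%:E - (expR (- ((s + (1 + e)) * nsq u)))%:E))%E.
    apply: eq_integral => u _; rewrite -EFinB /psi mulrBr -!expRD.
    by congr ((expR _ - expR _)%:E); ring.
  rewrite integralB//= !ge0_integral_gaussN// -EFinB !sqrt_pi_divX// -mulrBr//.
have := integral_power_mixture n0 y0 mpsi psi0 kE.
have mpow : measurable_fun setT (fun s : R => s `^ (y - 1) * ((s + e) `^ (- y) - (s + (1 + e)) `^ (- y))).
  apply: measurable_funM; first exact: measurable_powR.
  by apply: measurable_funB; apply: (measurableT_comp (measurable_powR _)); exact: measurable_funD.
have -> : (\int[mu]_(s in pos) (s `^ (y - 1) * k s)%:E =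
    (Num.sqrt pi ^+ n)%:E * (ln ((1 + e) / e))%:E)%E.
  rewrite -(integral_powR_difference y0 e0) -ge0_integralZl//.
  - by apply: eq_integral => s _; rewrite -EFinM /k mulrCA.
  - by apply/measurable_EFinP; exact: measurable_funTS.
  - move=> s; rewrite /= in_itv/= andbT => s0.
    rewrite lee_fin mulr_ge0 ?powR_ge0// subr_ge0 !powRN lef_pV2 ?posrE ?powR_gt0 ?addr_gt0//.
    by rewrite ge0_ler_powR ?nnegrE ?(ltW y0)// ?ltW ?addr_gt0// ltrD2l ltrDr.
have -> : (\int[leb]_u (nsq u `^ (- y) * psi u)%:E =
    \int[leb]_u (log_profile (nsq u) * expR (- (e * nsq u)))%:E)%E.
  by apply: eq_integral => u _; rewrite log_profile_heat.
have := Gamma_gt0 y0; move: (Gamma y) (\int[leb]_u _)%E (_ ^+ n) => g I K g0.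
move=> /(congr1 (mule g^-1%:E)); rewrite muleA -!EFinM mulVf ?lt0r_neq0// mul1e => ->.
by congr EFin; rewrite mulrA (mulrC K).
Qed.

Lemma measurable_log_profile e :
  measurable_fun setT (fun u : n.-tuple R => log_profile (nsq u) * expR (- (e * nsq u))).
Proof.
apply: measurable_funM; last exact: measurable_exp_nsq.
apply: measurable_funM; first exact: measurable_nsq_powR.
apply: measurable_funB => //; apply: (measurableT_comp (@measurable_expR R)).
by apply: measurableT_comp => //; exact: measurable_nsq.
Qed.

Lemma log_profile_heat_ge0 e (u : n.-tuple R) :
  0 <= log_profile (nsq u) * expR (- (e * nsq u)).
Proof. by rewrite mulr_ge0 ?expR_ge0// log_profile_ge0// nsq_ge0. Qed.

Lemma integral_log_profile e : 0 < e ->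
  \int[leb]_u (log_profile (nsq u) * expR (- (e * nsq u))) =
  Num.sqrt pi ^+ n / Gamma y * ln ((1 + e) / e).
Proof. by move=> e0; rewrite /Rintegral ge0_integral_log_profile. Qed.

Lemma integrable_log_profile e : 0 < e ->
  leb.-integrable setT (EFin \o (fun u => log_profile (nsq u) * expR (- (e * nsq u)))).
Proof.
move=> e0; apply/integrableP; split.
  by apply/measurable_EFinP; exact: measurable_log_profile.
under eq_integral do rewrite /= ger0_norm ?log_profile_heat_ge0//.
by rewrite ge0_integral_log_profile// ltry.
Qed.

Lemma cvg_inv_ln : (- ln r)^-1 @[r --> (0 : R)^'+] --> (0 : R).
Proof.
apply/cvgrVy.
  near=> r; rewrite invr_gt0 oppr_gt0 ln_lt0//; apply/andP; split; near: r.
    exact: nbhs_right_gt.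
  exact: nbhs_right_lt.
have H : - ln r @[r --> (0 : R)^'+] --> +oo.
  by have /cvgNry := @lnNy R.
by apply: cvg_trans H; apply: near_eq_cvg; apply: nearW => r; exact/esym/invrK.
Unshelve. all: by end_near. Qed.

(** The numerator is -2 ln r + O(1), so the limit is the same for every c, as [tauberian_centered]
    demands. *)
Lemma cvg_log_ratio (c : R) : 0 < c ->
  ln ((1 + c * r ^+ 2) / (c * r ^+ 2)) / (- ln r) @[r --> (0 : R)^'+] --> (2 : R).
Proof.
move=> c0.
have c1 : ln (1 + c * r ^+ 2) @[r --> (0 : R)^'+] --> (0 : R).
  have h : 1 + c * r ^+ 2 @[r --> (0 : R)] --> (1 : R).
    rewrite -[X in _ --> X](_ : 1 + c * 0 ^+ 2 = 1); last by rewrite expr0n mulr0 addr0.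
    by apply: cvgD; [exact: cvg_cst|apply: cvgMl_tmp; apply: cvgM].
  have := cvg_comp _ _ h (continuous_ln ltr01); rewrite ln1.
  by move=> H; apply: cvg_at_right_filter.
have H : (ln (1 + c * r ^+ 2) - ln c) * (- ln r)^-1 + 2 @[r --> (0 : R)^'+] --> (2 : R).
  rewrite -[X in _ --> X](_ : (0 - ln c) * 0 + 2 = 2); last by rewrite mulr0 add0r.
  apply: cvgD; last exact: cvg_cst.
  by apply: cvgM; [apply: cvgB => //; exact: cvg_cst|exact: cvg_inv_ln].
apply: cvg_trans H; apply: near_eq_cvg; near=> r.
have r0 : 0 < r by near: r; exact: nbhs_right_gt.
have r1 : r < 1 by near: r; exact: nbhs_right_lt.
have ln0 : ln r < 0 by rewrite ln_lt0// r0.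
have r20 : 0 < r ^+ 2 by rewrite exprn_gt0.
have cr0 : 0 < c * r ^+ 2 by rewrite mulr_gt0.
rewrite ln_div ?posrE ?addr_gt0//.
have -> : ln (c * r ^+ 2) = ln c + 2 * ln r.
  by rewrite lnM ?posrE// lnXn// mulr_natl.
by move: (ln r) (ln c) (ln (1 + _)) ln0 => z *; field; rewrite lt_eqF.
Unshelve. all: by end_near. Qed.

Variables a b : R.
Hypotheses (a0 : 0 < a) (b0 : 0 < b) (ab : a * b = y).

Lemma cvg_cauchy_log_profile :
  cauchy a b q / log_profile q @[q --> +oo] --> (1 : R).
Proof.
have h1 : (1 + q `^ (- a)) `^ (- b) @[q --> +oo] --> (1 : R).
  have h : 1 + q `^ (- a) @[q --> +oo] --> (1 : R).
    rewrite -[X in _ --> X]addr0; apply: cvgD; [exact: cvg_cst|exact: powRN_cvg0].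
  have cp : {for (1 : R), continuous (fun x => x `^ (- b))}.
    apply: differentiable_continuous; apply/derivable1_diffP; apply: ex_derive.
    exact: (is_derive1_powR (- b) ltr01).
  by have := cvg_comp _ _ h cp; rewrite powR1.
have h2 : (1 - expR (- q))^-1 @[q --> +oo] --> (1 : R).
  rewrite -[X in _ --> X]invr1; apply: cvgV; first exact: oner_neq0.
  by rewrite -[X in _ --> X]subr0; apply: cvgB; [exact: cvg_cst|exact: cvgr_expR].
have : (1 + q `^ (- a)) `^ (- b) * (1 - expR (- q))^-1 @[q --> +oo] --> (1 : R).
  by rewrite -[X in _ --> X]mulr1; exact: cvgM.
apply: cvg_trans; apply: near_eq_cvg; near=> q.
have q0 : 0 < q by near: q; exact: nbhs_pinfty_gt.
rewrite /cauchy /log_profile.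
move: (1 - expR (- q)) => E.
rewrite [in RHS]invfM [RHS]mulrA; congr (_ * _).
rewrite (_ : 1 + q `^ a = q `^ a * (1 + q `^ (- a))); last first.
  by rewrite mulrDr mulr1 powRN mulfV 1?addrC// lt0r_neq0// powR_gt0.
rewrite powRM ?powR_ge0 ?addr_ge0 ?powR_ge0// -powRrM mulrN ab mulrAC divff ?mul1r//.
by rewrite lt0r_neq0// powR_gt0.
Unshelve. all: by end_near. Qed.

(** Beyond |R0| the ratio of the two profiles is within eta of 1. Below it, M = exp(|R0|) makes M
    exp(-q) >= 1, so the corrective terms take over, using that the Cauchy profile is at most 1.
    Both corrections are integrable over R^n. *)
Lemma cauchy_log_profile_le (eta : R) : 0 < eta -> exists2 M, 0 <= M &
  forall q, 0 <= q ->
    cauchy a b q <= (1 + eta) * log_profile q + M * expR (- q) /\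
    (1 - eta) * log_profile q <= cauchy a b q + M * (log_profile q * expR (- q)).
Proof.
move=> eta0; have /cvgrPdist_lt/(_ _ eta0)[R0 [_ HR]] := cvg_cauchy_log_profile.
have e0 := expR_ge0 (`|R0| : R).
exists (expR `|R0|) => // q q0; have G0 := log_profile_ge0 q0.
have F0 := cauchy_ge0 a b q.
have [Rq|qR] := ltP `|R0| q.
  have qp : 0 < q by apply: le_lt_trans Rq.
  have Gp : 0 < log_profile q.
    by rewrite mulr_gt0 ?powR_gt0// subr_gt0 expR_lt1 oppr_lt0.
  have := HR q (le_lt_trans (ler_norm _) Rq).
  rewrite ltr_distlC => /andP[]; rewrite ltr_pdivlMr// ltr_pdivrMr// => h1 h2; split.
    by apply: (le_trans (ltW h2)); rewrite lerDl mulr_ge0 ?expR_ge0.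
  apply: (le_trans (ltW h1)); rewrite lerDl.
  by apply: mulr_ge0 => //; apply: mulr_ge0 => //; exact: expR_ge0.
have M1 : 1 <= expR `|R0| * expR (- q).
  by rewrite -expRD -expR0 ler_expR subr_ge0.
split.
  apply: (@le_trans _ _ 1).
    rewrite /cauchy powRN invf_le1 ?powR_gt0 ?ltr_pwDl ?powR_ge0//.
    by rewrite -[leLHS](powRr0 (1 + q `^ a)) ler_powR ?(ltW b0)// lerDl powR_ge0.
  by apply: (le_trans M1); rewrite lerDr mulr_ge0// addr_ge0// ltW.
apply: (@le_trans _ _ (log_profile q)).
  by rewrite -[leRHS]mul1r ler_wpM2r// gerBl ltW.
apply: (@le_trans _ _ (log_profile q * (expR `|R0| * expR (- q)))).
  by rewrite -[leLHS]mulr1 ler_wpM2l.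
by rewrite mulrCA lerDr.
Qed.

Hypothesis a1 : a <= 1.

Let cF : cmono (cauchy a b).
Proof. by apply: cmono_cauchy; rewrite ?a0// ltW. Qed.

(** The corrections are integrated against exp(-e q) <= 1, which bounds them by constants
    independent of e. Compared with the logarithm they are negligible as e tends to 0. *)
Lemma heat_cauchy_critical_le (eta : R) : 0 < eta -> exists C1 C2 : R,
  forall e, 0 < e ->
    heat (cauchy a b) e zero <=
      (1 + eta) * (Num.sqrt pi ^+ n / Gamma y * ln ((1 + e) / e)) + C1 /\
    (1 - eta) * (Num.sqrt pi ^+ n / Gamma y * ln ((1 + e) / e)) <=
      heat (cauchy a b) e zero + C2.
Proof.
move=> eta0; have [M M0 HM] := cauchy_log_profile_le eta0.
pose g e (u : n.-tuple R) := expR (- (e * nsq u)).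
pose G e (u : n.-tuple R) := log_profile (nsq u) * g e u.
have ig e : 0 < e -> leb.-integrable setT (EFin \o g e).
  by move=> e0; exact: (integrable_gaussN (fun=> 0 : R) e0).
have iG e : 0 < e -> leb.-integrable setT (EFin \o G e).
  by move=> e0; exact: integrable_log_profile.
have iF e : 0 < e -> leb.-integrable setT (EFin \o (fun u => cauchy a b (nsq u) * g e u)).
  by move=> e0; apply: cmono_integrable => //; exact: ig.
exists (M * \int[leb]_u g 1 u), (M * \int[leb]_u G 1 u) => e e0.
rewrite heat0 -integral_log_profile//.
have le1 u : g e u <= 1 by rewrite expR_le1 oppr_le0 mulr_ge0 ?nsq_ge0 ?(ltW e0).
rewrite -!RintegralZl ?ig ?iG//.
have iZ := integrableZ_EFin.
rewrite -!RintegralD//; [|exact: iF|exact/iZ/iG|exact/iZ/iG|exact/iZ/ig].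
have gg u : expR (- nsq u) = g 1 u by rewrite /g mul1r.
split; apply: le_Rintegral => //.
- exact: iF.
- by apply: integrableD_EFin; [exact/iZ/iG|exact/iZ/ig].
- move=> u _; have [H _] := HM _ (nsq_ge0 u); rewrite gg in H.
  have g0 : 0 <= g e u by exact: expR_ge0.
  apply: (le_trans (ler_wpM2r g0 H)); rewrite mulrDl -[X in X + _]mulrA lerD2l.
  by rewrite -[leRHS]mulr1; apply: ler_wpM2l => //; rewrite mulr_ge0// expR_ge0.
- exact/iZ/iG.
- by apply: integrableD_EFin; [exact: iF|exact/iZ/iG].
- move=> u _; have [_ H] := HM _ (nsq_ge0 u); rewrite gg in H.
  have g0 : 0 <= g e u by exact: expR_ge0.
  rewrite [leLHS]mulrA; apply: (le_trans (ler_wpM2r g0 H)); rewrite mulrDl lerD2l.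
  rewrite -[leRHS]mulr1; apply: ler_wpM2l => //; apply: mulr_ge0 => //.
  by apply: mulr_ge0; [apply: log_profile_ge0; exact: nsq_ge0|exact: expR_ge0].
Qed.

Lemma cvg_heat_cauchy_critical (c : R) : 0 < c ->
  heat (cauchy a b) (c * r ^+ 2) zero / - ln r @[r --> 0^'+] -->
  Num.sqrt pi ^+ n / Gamma y * 2.
Proof.
move=> c0; set K := _ / _; apply/cvgrPdist_lt => eta eta0.
have /choice[D HD] (k : nat) : exists C : R * R, forall e, 0 < e ->
    heat (cauchy a b) e zero <= (1 + k.+1%:R^-1) * (K * ln ((1 + e) / e)) + C.1 /\
    (1 - k.+1%:R^-1) * (K * ln ((1 + e) / e)) <= heat (cauchy a b) e zero + C.2.
  have k0 : (0 : R) < k.+1%:R^-1 by rewrite invr_gt0.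
  by have [C1 [C2 H]] := heat_cauchy_critical_le k0; exists (C1, C2).
pose L r := ln ((1 + c * r ^+ 2) / (c * r ^+ 2)) / - ln r.
have cL : K * L r @[r --> 0^'+] --> K * 2.
  by apply: cvgMl_tmp; exact: cvg_log_ratio.
(* There is no dependence on a point here, hence the type [unit]. The index k sets the precision eta
   = 1/(k+1), whose constants [D k] are divided by -ln r and vanish before k grows. *)
have := @unif_squeeze R unit (fun _ _ => True)
  (fun _ r => heat (cauchy a b) (c * r ^+ 2) zero / - ln r)
  (fun k r => (1 - k.+1%:R^-1) * (K * L r) - (D k).2 * (- ln r)^-1)
  (fun k r => (1 + k.+1%:R^-1) * (K * L r) + (D k).1 * (- ln r)^-1)
  (fun k => (1 - k.+1%:R^-1) * (K * 2)) (fun k => (1 + k.+1%:R^-1) * (K * 2)) (K * 2).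
move=> H; have {H} : \forall r \near 0^'+, forall x : unit, True ->
    `|heat (cauchy a b) (c * r ^+ 2) zero / - ln r - K * 2| < eta.
  apply: H eta0.
  - move=> k; near=> r => _ _.
    have r0 : 0 < r by near: r; exact: nbhs_right_gt.
    have ln0 : 0 < - ln r.
      by rewrite oppr_gt0 ln_lt0// r0; near: r; exact: nbhs_right_lt.
    have e0 : 0 < c * r ^+ 2 by rewrite mulr_gt0// exprn_gt0.
    have [h1 h2] := HD k _ e0; rewrite /L.
    have iln : 0 <= (- ln r)^-1 by rewrite invr_ge0 ltW.
    move: (heat _ _ _) (ln (_ / _)) (k.+1%:R^-1) (- ln r)^-1 iln h1 h2 => J l h w w0 h1 h2.
    rewrite -lerBlDr in h2; apply/andP; split.
      apply: le_trans (ler_wpM2r w0 h2); rewrite le_eqVlt; apply/orP; left; apply/eqP; ring.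
    apply: (le_trans (ler_wpM2r w0 h1)); rewrite le_eqVlt; apply/orP; left; apply/eqP; ring.
  - move=> k; rewrite -[X in _ --> X]subr0; apply: cvgB; first exact: cvgMl_tmp.
    by rewrite -[X in _ --> X](mulr0 (D k).2); apply: cvgMl_tmp; exact: cvg_inv_ln.
  - move=> k; rewrite -[X in _ --> X]addr0; apply: cvgD; first exact: cvgMl_tmp.
    by rewrite -[X in _ --> X](mulr0 (D k).1); apply: cvgMl_tmp; exact: cvg_inv_ln.
  - rewrite -[X in _ --> X]mul1r; apply: cvgMr_tmp; rewrite -[X in _ --> X]subr0.
    by apply: cvgB; [exact: cvg_cst|exact: cvg_harmonic].
  - rewrite -[X in _ --> X]mul1r; apply: cvgMr_tmp; rewrite -[X in _ --> X]addr0.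
    by apply: cvgD; [exact: cvg_cst|exact: cvg_harmonic].
by apply: filterS => r /(_ tt I); rewrite distrC.
Unshelve. all: by end_near. Qed.

Lemma tauberian_cauchy_critical (St : ('I_n -> R) -> R) :
  (forall x, 0 < vsq x -> heat_limit (cauchy a b) x (St x)) ->
  forall eta, 0 < eta -> \forall r \near 0^'+, forall x, vsq x = r ^+ 2 ->
    `|St x / - ln r - Num.sqrt pi ^+ n / Gamma y * 2| < eta.
Proof.
move=> HS; apply: (tauberian_centered n0 (N := fun r => - ln r) cF HS).
  by move=> r r01; rewrite oppr_gt0 ln_lt0.
exact: cvg_heat_cauchy_critical.
Qed.

End CauchyCritical.

(** * The long-memory case, alpha beta < n *)

Section CauchyLongMemory.
Context {R : realType} {n : nat}.
Hypothesis n0 : (0 < n)%N.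
Local Notation mu := (@lebesgue_measure R).
Local Notation leb := (@lebesgue_Rn R n).
Local Notation pos := (`]0%R, +oo[%classic : set R).
Local Notation nsq := (@nsq R n).
Local Notation zero := ((fun=> 0) : ordinal n -> R).

Let y : R := n%:R / 2.

(* The kernel [kap], with powers in place of roots and inverses to make its
   measurability immediate. *)
Definition kap_powR (tau Y : R) : R :=
  Num.sqrt pi ^+ n * (tau `^ (- y) * expR (- (Y / 4 * tau `^ (- 1)))).

Lemma kapE tau Y : 0 < tau -> @kap R n tau Y = kap_powR tau Y.
Proof.
move=> t0; rewrite /kap sqrt_pi_divX// -mulrA /kap_powR powR_inv1 ?(ltW t0)//.
by congr (_ * (_ * expR (- _))); rewrite invfM; ring.
Qed.

Lemma kap_powR_ge0 tau Y : 0 <= kap_powR tau Y.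
Proof. by rewrite /kap_powR mulr_ge0 ?exprn_ge0// mulr_ge0 ?powR_ge0 ?expR_ge0. Qed.

Lemma measurable_kap_powR c Y : measurable_fun setT (fun s : R => kap_powR (s + c) Y).
Proof.
have mp z : measurable_fun setT (fun s : R => (s + c) `^ z).
  by apply: (measurableT_comp (measurable_powR _)); exact: measurable_funD.
apply: measurable_funM => //; apply: measurable_funM => //.
apply: (measurableT_comp (@measurable_expR R)); apply: measurableT_comp => //.
exact: measurable_funM.
Qed.

(** With v = 1/(s+c), the kernel is v^y exp(-Y v / 4) up to a constant. As c <= 1, v^y <=
    ((1+v)/(1+s))^y, and (1+v)^y is at most a constant times exp(v/8), which exp(-Y v / 4) cancels
    because Y >= 1/2. Keeping Y away from 0 is what makes the bound uniform as c tends to 0. *)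
Lemma kap_powR_dominated : exists M, forall c Y s, 0 < c <= 1 -> 2^-1 <= Y -> 0 < s ->
  kap_powR (s + c) Y <= M * (1 + s) `^ (- y).
Proof.
have y0 : 0 < y by rewrite divr_gt0// ltr0n.
exists (Num.sqrt pi ^+ n * ((8 * y) `^ y * expR (8^-1))) => c Y s /andP[c0 c1] hY s0.
have t0 : 0 < s + c by rewrite addr_gt0.
rewrite /kap_powR -[leRHS]mulrA ler_wpM2l ?exprn_ge0//.
rewrite powR_inv1 ?(ltW t0)//; set v := (s + c)^-1.
have v0 : 0 < v by rewrite invr_gt0.
have y8 : 0 < 8 * y by rewrite mulr_gt0.
have v1 : 0 <= 1 + v by rewrite addr_ge0// ltW.
have h1 : (1 + v) `^ y <= (8 * y) `^ y * expR (8^-1 + v / 8).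
  have -> : expR (8^-1 + v / 8) = expR ((1 + v) / (8 * y)) `^ y.
    by rewrite /powR gt_eqF ?expR_gt0// expRK; congr expR; field; rewrite lt0r_neq0.
  rewrite -powRM ?expR_ge0 ?(ltW y8)// ge0_ler_powR ?nnegrE ?(ltW y0)//.
    by rewrite mulr_ge0 ?expR_ge0// ltW.
  rewrite -ler_pdivrMl// mulrC.
  by apply: le_trans (expR_ge1Dx _); rewrite lerDr.
have h2 : v `^ y <= (1 + v) `^ y * (1 + s) `^ (- y).
  rewrite powRN ler_pdivlMr ?powR_gt0 ?addr_gt0//.
  rewrite -powRM ?(ltW v0) ?addr_ge0 ?(ltW s0)//.
  rewrite ge0_ler_powR ?nnegrE ?(ltW y0)// ?mulr_ge0 ?(ltW v0) ?addr_ge0 ?(ltW s0)//.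
  rewrite (_ : 1 + v = v * ((s + c) + 1)).
    by rewrite ler_wpM2l ?(ltW v0)// addrC lerD2r lerDl ltW.
  by rewrite mulrDr mulr1 /v mulVf ?lt0r_neq0.
have -> : (s + c) `^ (- y) = v `^ y.
  by rewrite /v -powR_inv1 ?(ltW t0)// -powRrM mulN1r.
have e1 : expR (- (Y / 4 * v)) <= expR (- (v / 8)).
  rewrite ler_expR lerN2; have : 2^-1 * v <= Y * v by rewrite ler_wpM2r// ltW.
  lra.
apply: (@le_trans _ _ (((8 * y) `^ y * expR (8^-1 + v / 8) * (1 + s) `^ (- y)) * expR (- (v / 8)))).
  apply: ler_pM => //; rewrite ?powR_ge0 ?expR_ge0//.
  by apply: (le_trans h2); rewrite ler_wpM2r ?powR_ge0.
have E : expR (v / 8) * expR (- (v / 8)) = 1 by rewrite -expRD subrr expR0.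
rewrite expRD; move: (expR (v / 8)) (expR (- (v / 8))) E => e e' E.
by rewrite le_eqVlt; apply/orP; left; apply/eqP; ring: E.
Qed.

Variables (a b : R).
Let p := a * b.
Hypotheses (a0 : 0 < a) (a1 : a <= 1) (b0 : 0 < b) (py : p < y).

Let p0 : 0 < p. Proof. exact: mulr_gt0. Qed.
Let y0 : 0 < y. Proof. by rewrite divr_gt0// ltr0n. Qed.

(** The regularized transform of |u|^(-alpha beta), as alpha beta = 2 p. The profile q^(-p) is
    unbounded near 0, hence outside [cmono], and is treated directly as a mixture. *)
Definition long_memory_limit (c Y : R) : R :=
  \int[leb]_u (nsq u `^ (- p) * (cos (lform (axis Y) u) * expR (- (c * nsq u)))).

Let mker c Y : measurable_fun setT (fun s : R => s `^ (p - 1) * kap_powR (s + c) Y).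
Proof.
by apply: measurable_funM; [exact: measurable_powR|exact: measurable_kap_powR].
Qed.

Let ker_ge0 c Y (s : R) : 0 <= s `^ (p - 1) * kap_powR (s + c) Y.
Proof. by apply: mulr_ge0; [exact: powR_ge0|exact: kap_powR_ge0]. Qed.

Lemma integral_beta_lty (M : R) : 0 <= M ->
  (\int[mu]_(s in pos) (M * (s `^ (p - 1) * (1 + s) `^ (- y)))%:E < +oo)%E.
Proof.
move=> M0; under eq_integral do rewrite EFinM.
rewrite ge0_integralZl//; first last.
- by move=> s _; rewrite lee_fin mulr_ge0 ?powR_ge0.
- apply/measurable_EFinP; apply: measurable_funTS.
  apply: measurable_funM; first exact: measurable_powR.
  by apply: (measurableT_comp (measurable_powR _)); exact: measurable_funD.
have yp : 0 < y - p by rewrite subr_gt0.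
have := integral_beta p0 yp; rewrite (_ : p + (y - p) = y); last by rewrite addrC subrK.
by move=> ->; rewrite -EFinM ltry.
Qed.

Lemma integral_kap_powR_lty (c Y : R) : 0 < c -> 0 <= Y ->
  (\int[mu]_(s in pos) (s `^ (p - 1) * kap_powR (s + c) Y)%:E < +oo)%E.
Proof.
move=> c0 Y0; pose m := Num.min 1 c.
have m0 : 0 < m by rewrite lt_min ltr01.
have M0 : 0 <= Num.sqrt pi ^+ n * m `^ (- y) :> R by rewrite mulr_ge0 ?exprn_ge0 ?powR_ge0.
apply: le_lt_trans (integral_beta_lty M0); apply: ge0_le_integral => //.
- by move=> s _; rewrite lee_fin.
- by apply/measurable_EFinP; apply: measurable_funTS; exact: mker.
- apply/measurable_EFinP; apply: measurable_funTS; apply: measurable_funM => //.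
  apply: measurable_funM; first exact: measurable_powR.
  by apply: (measurableT_comp (measurable_powR _)); exact: measurable_funD.
move=> s; rewrite /= in_itv/= andbT => s0; rewrite lee_fin [leRHS]mulrCA ler_wpM2l ?powR_ge0//.
have sc0 : 0 < s + c by rewrite addr_gt0.
rewrite /kap_powR -[leRHS]mulrA ler_wpM2l ?exprn_ge0//.
apply: (@le_trans _ _ ((s + c) `^ (- y))).
  by rewrite ler_piMr ?powR_ge0// expR_le1 oppr_le0 mulr_ge0 ?powR_ge0 ?divr_ge0.
rewrite -powRM ?(ltW m0) ?addr_ge0 ?(ltW s0)// !powRN lef_pV2 ?posrE ?powR_gt0 ?mulr_gt0 ?addr_gt0//.
rewrite ge0_ler_powR ?nnegrE ?(ltW y0) ?mulr_ge0 ?(ltW m0) ?addr_ge0 ?(ltW s0) ?(ltW c0)//.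
rewrite mulrDr mulr1 addrC lerD//; last by rewrite ge_min lexx orbT.
by rewrite ler_piMl ?(ltW s0)// ge_min lexx.
Qed.

Let i_heat c Y : 0 < c -> leb.-integrable setT
  (EFin \o (fun u : n.-tuple R => cos (lform (axis Y) u) * expR (- (c * nsq u)))).
Proof. exact: integrable_heat_kernel. Qed.

Lemma integral_nsq_powR_exp c : 0 < c ->
  ((Gamma p)%:E * \int[leb]_u (nsq u `^ (- p) * expR (- (c * nsq u)))%:E =
   \int[mu]_(s in pos) (s `^ (p - 1) * kap_powR (s + c) 0)%:E)%E.
Proof.
move=> c0.
have kE s : 0 < s -> (\int[leb]_u (expR (- (s * nsq u)) * expR (- (c * nsq u)))%:E =
    (kap_powR (s + c) 0)%:E)%E.
  move=> s0; have sc : 0 < s + c by rewrite addr_gt0.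
  have -> : kap_powR (s + c) 0 = @kap R n (s + c) (vsq (axis 0 : 'I_n -> R)).
    by rewrite vsq_axis// kapE.
  rewrite -(integral_heat_kernel _ sc).
  apply: eq_integral => u _; rewrite -expRD /lform big1.
    by rewrite cos0 mul1r; congr ((expR _)%:E); ring.
  by move=> i _; rewrite /axis sqrtr0 if_same mul0r.
have e0 (u : n.-tuple R) : 0 <= expR (- (c * nsq u)) by exact: expR_ge0.
exact: (integral_power_mixture n0 p0 (measurable_exp_nsq c) e0 kE).
Qed.

Lemma integrable_nsq_powR_exp c : 0 < c -> leb.-integrable setT
  (EFin \o (fun u : n.-tuple R => nsq u `^ (- p) * expR (- (c * nsq u)))).
Proof.
move=> c0; apply/integrableP; split.
  apply/measurable_EFinP; apply: measurable_funM; first exact: measurable_nsq_powR.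
  exact: measurable_exp_nsq.
under eq_integral do rewrite /= ger0_norm ?mulr_ge0 ?powR_ge0 ?expR_ge0//.
have := integral_kap_powR_lty c0 (lexx 0); rewrite -integral_nsq_powR_exp//.
have := Gamma_gt0 p0; move: (Gamma p) => g g0.
have I0 : (0 <= \int[leb]_u (nsq u `^ (- p) * expR (- (c * nsq u)))%:E)%E.
  by apply: integral_ge0 => u _; rewrite lee_fin mulr_ge0 ?powR_ge0 ?expR_ge0.
move: (\int[leb]_u _)%E I0 => I; case: I => [r _|_|//]; first by rewrite !ltry.
by rewrite gt0_muley ?lte_fin.
Qed.

Lemma long_memory_limitE c Y : 0 < c -> 0 <= Y ->
  Gamma p * long_memory_limit c Y =
  \int[mu]_(s in pos) (s `^ (p - 1) * kap_powR (s + c) Y).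
Proof.
move=> c0 Y0.
(* The mixture formula asks for a nonnegative weight, so 1 + cos replaces cos. The part coming from
   1 is the same formula at frequency 0; it is finite and is subtracted at the end. *)
pose psi (u : n.-tuple R) := (1 + cos (lform (axis Y) u)) * expR (- (c * nsq u)).
have mpsi : measurable_fun setT psi.
  apply: measurable_funM; last exact: measurable_exp_nsq.
  apply: measurable_funD => //; apply: (measurableT_comp measurable_cos).
  exact: measurable_lform.
have psi0 u : 0 <= psi u.
  by rewrite mulr_ge0 ?expR_ge0// -lerBlDl sub0r cos_geN1.
have kE s : 0 < s -> (\int[leb]_u (expR (- (s * nsq u)) * psi u)%:E =
    (kap_powR (s + c) 0 + kap_powR (s + c) Y)%:E)%E.
  move=> s0; have sc : 0 < s + c by rewrite addr_gt0.
  transitivity (\int[leb]_u ((cos (lform (axis 0) u) * expR (- ((s + c) * nsq u)))%:E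
     + (cos (lform (axis Y) u) * expR (- ((s + c) * nsq u)))%:E))%E.
    apply: eq_integral => u _; rewrite -EFinD -mulrDl.
    rewrite [lform (axis 0) u]big1 ?cos0; last by move=> i _; rewrite /axis sqrtr0 if_same mul0r.
    by rewrite /psi mulrCA -expRD; congr ((_ * expR _)%:E); ring.
  rewrite integralD//; [|exact: i_heat..].
  by rewrite !integral_heat_kernel// !vsq_axis// -EFinD !kapE.
have := integral_power_mixture n0 p0 mpsi psi0 kE.
have i1 := integrable_nsq_powR_exp c0.
have m2 : measurable_fun setT (fun u : n.-tuple R =>
    nsq u `^ (- p) * (cos (lform (axis Y) u) * expR (- (c * nsq u)))).
  apply: measurable_funM; first exact: measurable_nsq_powR.
  apply: measurable_funM; last exact: measurable_exp_nsq.
  by apply: (measurableT_comp measurable_cos); exact: measurable_lform.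
have i2 : leb.-integrable setT (EFin \o (fun u : n.-tuple R =>
    nsq u `^ (- p) * (cos (lform (axis Y) u) * expR (- (c * nsq u))))).
  apply: le_integrable_EFin i1 => // u.
  rewrite !normrM (ger0_norm (powR_ge0 _ _)) (ger0_norm (expR_ge0 _)).
  by rewrite ler_wpM2l ?powR_ge0// ler_piMl ?expR_ge0// cos_max.
have -> : (\int[leb]_u (nsq u `^ (- p) * psi u)%:E =
    \int[leb]_u (nsq u `^ (- p) * expR (- (c * nsq u)))%:E + (long_memory_limit c Y)%:E)%E.
  rewrite /long_memory_limit /Rintegral fineK; last exact: integrable_fin_num i2.
  rewrite -integralD//; apply: eq_integral => u _; rewrite /= -EFinD.
  by congr EFin; rewrite /psi; ring.
have -> : (\int[mu]_(s in pos) (s `^ (p - 1) * (kap_powR (s + c) 0 + kap_powR (s + c) Y))%:E =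
   \int[mu]_(s in pos) (s `^ (p - 1) * kap_powR (s + c) 0)%:E +
   \int[mu]_(s in pos) (s `^ (p - 1) * kap_powR (s + c) Y)%:E)%E.
  under eq_integral do rewrite mulrDr EFinD.
  rewrite ge0_integralD//.
  - by move=> s _; rewrite lee_fin.
  - by apply/measurable_EFinP; apply: measurable_funTS; exact: mker.
  - by move=> s _; rewrite lee_fin.
  - by apply/measurable_EFinP; apply: measurable_funTS; exact: mker.
rewrite -integral_nsq_powR_exp// /Rintegral.
have : (\int[leb]_u (nsq u `^ (- p) * expR (- (c * nsq u)))%:E)%E \is a fin_num.
  exact: integrable_fin_num i1.
have := integral_kap_powR_lty c0 Y0.
have : (0 <= \int[mu]_(s in pos) (s `^ (p - 1) * kap_powR (s + c) Y)%:E)%E.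
  by apply: integral_ge0 => s _; rewrite lee_fin.
move: (\int[mu]_(s in pos) _)%E (\int[leb]_u _)%E (Gamma p) => J I g.
case: J => // j _ _; case: I => // i _.
by rewrite -EFinD -!EFinM => -[] /=; rewrite mulrDr => /addrI.
Qed.

(** At c = 0 the u-integral no longer converges absolutely, so the limit is taken in the mixture
    over s, where the kernels are uniformly dominated. The limit s^(p-1-y) exp(-1/(4 s)) is an
    inverse Gamma integrand with parameter y - p > 0. *)
Lemma cvg_long_memory_limit (c Y : nat -> R) :
  (forall k, 0 < c k <= 1) -> (forall k, 2^-1 <= Y k <= 2) ->
  c k @[k --> \oo] --> (0 : R) -> Y k @[k --> \oo] --> (1 : R) ->
  long_memory_limit (c k) (Y k) @[k --> \oo] -->
  Num.sqrt pi ^+ n * ((1 / 4) `^ (- (y - p)) * Gamma (y - p)) / Gamma p.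
Proof.
move=> c01 Y12 cc cY.
have c0 k : 0 < c k by have /andP[] := c01 k.
have Y0 k : 0 <= Y k by have /andP[h _] := Y12 k; apply: le_trans h; rewrite invr_ge0.
have g0 := Gamma_gt0 p0.
have -> : (fun k => long_memory_limit (c k) (Y k)) = (fun k =>
   (\int[mu]_s (((fun s => s `^ (p - 1) * kap_powR (s + c k) (Y k)) \_ pos) s)) / Gamma p).
  apply/funext => k; rewrite -Rintegral_mkcond -long_memory_limitE//.
  by rewrite mulrAC divff ?mul1r// lt0r_neq0.
have -> : Num.sqrt pi ^+ n * ((1 / 4) `^ (- (y - p)) * Gamma (y - p)) =
   \int[mu]_s (((fun s => s `^ (p - 1) * kap_powR s 1) \_ pos) s).
  rewrite -Rintegral_mkcond /Rintegral.
  have yp : 0 < y - p by rewrite subr_gt0.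
  have q0 : 0 < 1 / 4 :> R by rewrite divr_gt0.
  have K0 : 0 <= Num.sqrt pi ^+ n :> R by rewrite exprn_ge0.
  transitivity (fine ((Num.sqrt pi ^+ n)%:E * \int[mu]_(s in pos) (s `^ (- (y - p) - 1) * expR (- ((1 / 4) / s)))%:E)%E).
    by rewrite integral_inv_gamma.
  congr fine; rewrite -ge0_integralZl//.
  - apply: eq_integral => s /set_mem/=; rewrite in_itv/= andbT => s0.
    rewrite -EFinM /kap_powR powR_inv1 ?(ltW s0)//.
    rewrite (_ : - (y - p) - 1 = (p - 1) + (- y)); last by ring.
    by rewrite powRD ?lt0r_neq0 ?implybT//; congr EFin; ring.
  - apply: (eq_measurable_fun (fun s : R => (s `^ (- (y - p) - 1) * expR (- (1 / 4 * s `^ (- 1))))%:E)).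
      by move=> s /set_mem/=; rewrite in_itv/= andbT => s0; rewrite powR_inv1 ?ltW.
    apply/measurable_EFinP; apply: measurable_funTS; apply: measurable_funM.
      exact: measurable_powR.
    apply: (measurableT_comp (@measurable_expR R)); apply: measurableT_comp => //.
    by apply: measurable_funM => //; exact: measurable_powR.
  - by move=> s _; rewrite lee_fin mulr_ge0 ?powR_ge0 ?expR_ge0.
have [M HM] := kap_powR_dominated.
have M0 : 0 <= M.
  have h1 : 0 < (1 : R) <= 1 by rewrite ltr01 lexx.
  have h2 : 2^-1 <= 2^-1 :> R by [].
  have := le_trans (kap_powR_ge0 _ _) (HM _ _ _ h1 h2 ltr01).
  by rewrite pmulr_lge0// powR_gt0.
apply: cvgMr_tmp.
apply: (@Rdominated_cvg _ _ _ mu _ _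
  ((fun s => M * (s `^ (p - 1) * (1 + s) `^ (- y))) \_ pos) _ _ _ _).2.
- by move=> k; apply/(measurable_restrictT _ _).1 => //; apply: measurable_funTS; exact: mker.
- apply/(measurable_restrictT _ _).1 => //; apply: measurable_funTS.
  by apply: eq_measurable_fun (mker 0 1) => s _; rewrite addr0.
- apply: aeW => s.
  rewrite /patch.
  have [/set_mem/=|_] := boolP (s \in pos); last first.
    by split => [|k]; [exact: cvg_cst|rewrite normr0].
  rewrite in_itv/= andbT => s0; split => [|k].
    have cont (z : R) : (s + c k) `^ z @[k --> \oo] --> s `^ z.
      have cp : {for s, continuous (fun x => x `^ z)}.
        apply: differentiable_continuous; apply/derivable1_diffP; apply: ex_derive.
        exact: (is_derive1_powR z s0).
      have h : s + c k @[k --> \oo] --> s.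
        by rewrite -[X in _ --> X]addr0; apply: cvgD => //; exact: cvg_cst.
      exact: (cvg_comp _ _ h cp).
    rewrite /kap_powR; apply: cvgMl_tmp; apply: cvgMl_tmp; apply: cvgM => //.
    have h : - (Y k / 4 * (s + c k) `^ (- 1)) @[k --> \oo] --> - (1 / 4 * s `^ (- 1)).
      by apply: cvgN; apply: cvgM => //; exact: cvgMr_tmp.
    exact: (cvg_comp _ _ h (@continuous_expR R _)).
  rewrite ger0_norm; last by apply: mulr_ge0; [exact: powR_ge0|exact: kap_powR_ge0].
  rewrite [leRHS]mulrCA ler_wpM2l ?powR_ge0//.
  by have /andP[hY _] := Y12 k; exact: HM.
have mb : measurable_fun setT (fun s : R => M * (s `^ (p - 1) * (1 + s) `^ (- y))).
  apply: measurable_funM => //; apply: measurable_funM; first exact: measurable_powR.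
  by apply: (measurableT_comp (measurable_powR _)); exact: measurable_funD.
have mr : measurable_fun setT ((fun s : R => M * (s `^ (p - 1) * (1 + s) `^ (- y))) \_ pos).
  by apply/(measurable_restrictT _ _).1 => //; exact: measurable_funTS.
apply/integrableP; split; first exact/measurable_EFinP.
rewrite (_ : (\int[mu]_x _)%E = (\int[mu]_(s in pos) (M * (s `^ (p - 1) * (1 + s) `^ (- y)))%:E)%E).
  exact: integral_beta_lty.
rewrite [RHS]integral_mkcond; apply: eq_integral => s _; rewrite /= !patchE.
by case: ifPn => _; rewrite ?normr0// ger0_norm// !mulr_ge0 ?powR_ge0.
Qed.

Let cF : cmono (cauchy a b).
Proof. by apply: cmono_cauchy; rewrite ?a0// ltW. Qed.

Lemma lform_axis_dil (r Y : R) (u : n.-tuple R) : 0 < r -> 0 <= Y ->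
  lform (axis (Y * r ^+ 2)) (dil r^-1 u) = lform (axis Y) u.
Proof.
move=> r0 Y0; rewrite /lform; apply: eq_bigr => i _; rewrite tnth_dil /axis.
case: ifPn => _; last by rewrite !mul0r.
rewrite sqrtrM// sqrtr_sqr ger0_norm ?(ltW r0)//.
by field; rewrite lt0r_neq0.
Qed.

(** Rescaling u by 1/r produces r^(-n) from the volume and r^(2p) from the covariance, whose profile
    becomes (r^(2a) + q^a)^(-b) and approaches q^(-p) as r tends to 0. *)
Lemma heat_cauchy_dil (c Y r : R) : 0 < c -> 0 <= Y -> 0 < r ->
  @heat R n (cauchy a b) (c * r ^+ 2) (axis (Y * r ^+ 2)) / r `^ (2 * p - n%:R) =
  \int[leb]_u ((r `^ (2 * a) + nsq u `^ a) `^ (- b) *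
               (cos (lform (axis Y) u) * expR (- (c * nsq u)))).
Proof.
move=> c0 Y0 r0; have rV0 : 0 < r^-1 by rewrite invr_gt0.
have cr0 : 0 < c * r ^+ 2 by rewrite mulr_gt0// exprn_gt0.
pose f (u : n.-tuple R) := cauchy a b (nsq u) *
  (cos (lform (axis (Y * r ^+ 2)) u) * expR (- (c * r ^+ 2 * nsq u))).
have iF : leb.-integrable setT (EFin \o f).
  by apply: cmono_integrable => //; exact: integrable_heat_kernel.
have [iD ED] := integral_dil rV0 iF.
have fE u : (r `^ (2 * a) + nsq u `^ a) `^ (- b) *
    (cos (lform (axis Y) u) * expR (- (c * nsq u))) =
    r `^ (- (2 * p)) * f (dil r^-1 u).
  have E2 : c * r ^+ 2 * (r^-1 ^+ 2 * nsq u) = c * nsq u by field; rewrite lt0r_neq0.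
  have E1 : (r `^ (2 * a) + nsq u `^ a) `^ (- b) =
      r `^ (- (2 * p)) * cauchy a b (r^-1 ^+ 2 * nsq u).
    rewrite /cauchy powRM ?sqr_ge0 ?nsq_ge0// -powR_mulrn ?(ltW rV0)//.
    rewrite -[r^-1]powR_inv1 ?(ltW r0)// -!powRrM.
    have ra0 : 0 < r `^ (2 * a) by rewrite powR_gt0.
    rewrite (_ : -1 * (2 * a) = - (2 * a)) ?mulN1r//.
    rewrite (_ : r `^ (- (2 * p)) = (r `^ (2 * a)) `^ (- b)); last first.
      by rewrite -powRrM; congr powR; rewrite /p; ring.
    rewrite -powRM ?(ltW ra0) ?addr_ge0 ?mulr_ge0 ?powR_ge0//.
    by rewrite mulrDr mulr1 mulrA [r `^ (- (2 * a))]powRN mulfV ?mul1r// lt0r_neq0.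
  by rewrite /f lform_axis_dil// nsq_dil E2 E1 [RHS]mulrA.
under eq_Rintegral do rewrite fE.
have iD' : leb.-integrable setT (EFin \o (fun u => f (dil r^-1 u))) by exact: iD.
rewrite RintegralZl//.
rewrite /heat -/f {1}/Rintegral ED fineM//; last exact: integrable_fin_num iD'.
rewrite -/(Rintegral _ _ _) /=.
rewrite powRB ?lt0r_neq0 ?implybT// powRN powR_mulrn ?(ltW r0)// exprVn.
rewrite (_ : Rintegral _ _ _ = \int[leb]_u f (dil r^-1 u))//.
have h1 : r ^+ n != 0 by rewrite lt0r_neq0// exprn_gt0.
have h2 : r `^ (2 * p) != 0 by rewrite lt0r_neq0// powR_gt0.
by move: (\int[leb]_u _) (r ^+ n) (r `^ _) h1 h2 => I x z h1 h2; field; rewrite h1 h2.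
Qed.

(** Since r^(2a) + q^a >= q^a, the rescaled profile is dominated by q^(-p). Convergence holds off
    the origin, hence almost everywhere. *)
Lemma cvg_heat_long_memory (c Y : R) : 0 < c -> 0 <= Y ->
  @heat R n (cauchy a b) (c * r ^+ 2) (axis (Y * r ^+ 2)) / r `^ (2 * p - n%:R)
    @[r --> 0^'+] --> long_memory_limit c Y.
Proof.
move=> c0 Y0; apply/cvg_at_rightP => v [v0 cv].
under eq_fun do rewrite heat_cauchy_dil//.
pose w (u : n.-tuple R) := cos (lform (axis Y) u) * expR (- (c * nsq u)).
have mw : measurable_fun setT w.
  apply: measurable_funM; last exact: measurable_exp_nsq.
  by apply: (measurableT_comp measurable_cos); exact: measurable_lform.
apply: (@Rdominated_cvg _ _ _ leb
  (fun k u => (v k `^ (2 * a) + nsq u `^ a) `^ (- b) * w u)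
  (fun u => nsq u `^ (- p) * w u) _ _ _ _ (integrable_nsq_powR_exp c0)).2.
- move=> k; apply: measurable_funM => //; apply: (measurableT_comp (measurable_powR _)).
  by apply: measurable_funD => //; exact: measurable_nsq_powR.
- by apply: measurable_funM => //; exact: measurable_nsq_powR.
have cva : v k `^ (2 * a) @[k --> \oo] --> (0 : R).
  have h : r `^ (2 * a) @[r --> (0 : R)^'+] --> (0 : R) by apply: powR_cvg0; rewrite mulr_gt0.
  by have /cvg_at_rightP := h; apply.
apply: filterS (ae_nsq_gt0 n0) => u q0.
have qa0 : 0 < nsq u `^ a by rewrite powR_gt0.
have pE : nsq u `^ (- p) = (nsq u `^ a) `^ (- b) by rewrite -powRrM mulrN.
split=> [|k].
  apply: cvgMr_tmp; rewrite pE.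
  have cp : {for nsq u `^ a, continuous (fun x => x `^ (- b))}.
    apply: differentiable_continuous; apply/derivable1_diffP; apply: ex_derive.
    exact: (is_derive1_powR (- b) qa0).
  have h : v k `^ (2 * a) + nsq u `^ a @[k --> \oo] --> nsq u `^ a.
    by rewrite -[X in _ --> X]add0r; apply: cvgD => //; exact: cvg_cst.
  exact: (cvg_comp _ _ h cp).
rewrite normrM (ger0_norm (powR_ge0 _ _)) pE; apply: ler_pM; rewrite ?powR_ge0//.
  rewrite !powRN lef_pV2 ?posrE ?powR_gt0//; last by rewrite ltr_wpDl ?powR_ge0.
  by rewrite ge0_ler_powR ?nnegrE ?(ltW b0) ?(ltW qa0) ?addr_ge0 ?powR_ge0// lerDr powR_ge0.
by rewrite normrM (ger0_norm (expR_ge0 _)) ler_piMl ?expR_ge0// cos_max.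
Qed.

Lemma tauberian_cauchy_long_memory (St : ('I_n -> R) -> R) :
  (forall x, 0 < vsq x -> heat_limit (cauchy a b) x (St x)) ->
  forall eta, 0 < eta -> \forall r \near 0^'+, forall x, vsq x = r ^+ 2 ->
    `|St x / r `^ (2 * p - n%:R) -
      Num.sqrt pi ^+ n * ((1 / 4) `^ (- (y - p)) * Gamma (y - p)) / Gamma p| < eta.
Proof.
move=> HS; apply: (tauberian_shifted n0 (N := fun r => r `^ (2 * p - n%:R))
  cF HS _ (L := long_memory_limit)).
- by move=> r /andP[r0 _]; rewrite powR_gt0.
- exact: cvg_heat_long_memory.
- exact: cvg_long_memory_limit.
Qed.

End CauchyLongMemory.

(** * The spectral density at the origin *)

Section SpectralAsymptotics.
Context {R : realType} {n : nat}.
Implicit Types (w : 'rV[R]_n) (S h : 'rV[R]_n -> R).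

Lemma enorm_gt0 w : w != 0 -> 0 < enorm w.
Proof.
move=> w0; rewrite lt_neqAle enorm_ge0 andbT eq_sym; apply: contra_neq w0 => w0.
apply/rowP => i; rewrite mxE; apply/eqP; rewrite -normr_le0 -w0.
exact: ler_coord_enorm.
Qed.

Lemma continuous_enorm : continuous (@enorm R n).
Proof.
have cd : continuous (fun w : 'rV[R]_n => dotv w w).
  apply: continuous_big => [|i _]; first exact: add_continuous.
  have cc : continuous (fun w : 'rV[R]_n => w 0 i) by exact: coord_continuous.
  by move=> w; exact: (cvgM (cc w) (cc w)).
by move=> w; exact: (cvg_comp _ _ (cd w) (@sqrt_continuous R _)).
Qed.

(** The Euclidean norm is continuous, vanishes at 0 and is positive elsewhere, so it carries the
    punctured neighborhoods of 0 to right neighborhoods of 0. *)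
Lemma near_enorm (Q : R -> Prop) :
  (\forall r \near 0^'+, Q r) -> \forall w \near (0 : 'rV[R]_n)^', Q (enorm w).
Proof.
rewrite !near_withinE => HQ.
have e0 : enorm (0 : 'rV[R]_n) = 0.
  by rewrite /enorm /dotv big1 ?sqrtr0// => i _; rewrite mxE mul0r.
have c0 : enorm w @[w --> (0 : 'rV[R]_n)] --> (0 : R).
  by rewrite -[X in _ --> X]e0; exact: continuous_enorm.
have HH : nbhs (0 : 'rV[R]_n) [set w | 0 < enorm w -> Q (enorm w)] := c0 _ HQ.
by apply: (filterS _ HH) => w H w0; exact: (H (enorm_gt0 w0)).
Qed.

(** Both K S and K h are compared with the same gauge N; the two quotients have the same nonzero
    limit [ell], hence S/h tends to 1. K stands for (2 pi)^n. *)
Lemma asymptotic_at0_radial S h (N g : R -> R) (K ell : R) :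
  K != 0 -> ell != 0 -> (forall r, 0 < r < 1 -> 0 < N r) ->
  (forall eta, 0 < eta -> \forall r \near 0^'+, forall x : 'I_n -> R,
     vsq x = r ^+ 2 -> `|K * S (\row_i x i) / N r - ell| < eta) ->
  g r / N r @[r --> 0^'+] --> ell ->
  (forall w, w != 0 -> K * h w = g (enorm w)) ->
  asymptotic_at0 S h.
Proof.
move=> K0 ell0 N0 HS Hg hE.
have cA : K * S w / N (enorm w) @[w --> (0 : 'rV[R]_n)^'] --> ell.
  apply/cvgrPdist_lt => eta eta0; have := near_enorm (HS _ eta0).
  apply: filterS => w /(_ (w 0)); rewrite vsq_enorm => /(_ erefl).
  rewrite distrC (_ : \row_i w 0 i = w)//.
  by apply/rowP => i; rewrite mxE.
have cB : g (enorm w) / N (enorm w) @[w --> (0 : 'rV[R]_n)^'] --> ell.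
  apply/cvgrPdist_lt => eta eta0.
  have /cvgrPdist_lt/(_ _ eta0) H := Hg.
  exact: (near_enorm H).
have H : (K * S w / N (enorm w)) / (g (enorm w) / N (enorm w))
    @[w --> (0 : 'rV[R]_n)^'] --> (1 : R).
  by rewrite -[X in _ --> X](divff ell0); exact: cvgM cA (cvgV ell0 cB).
rewrite /asymptotic_at0; apply: cvg_trans H; apply: near_eq_cvg.
have N1 : \forall r \near (0 : R)^'+, 0 < N r.
  near=> r; apply: N0; apply/andP; split; near: r.
    exact: nbhs_right_gt.
  exact: nbhs_right_lt.
have N1' := near_enorm (Q := fun r => 0 < N r) N1.
near=> w.
have w0 : w != 0 by near: w; exact: nbhs_dnbhs_neq.
have Nw : N (enorm w) != 0 by rewrite lt0r_neq0//; near: w; exact: N1'.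
rewrite /= -hE// !invfM invrK.
move: (S w) (h w)^-1 (N _) Nw => s z t t0; field; by rewrite t0 K0.
Unshelve. all: by end_near. Qed.

Lemma cauchy_covariance_rvec (alpha beta : R) (u : n.-tuple R) :
  cauchy_covariance alpha beta (rvec u) = cauchy (alpha / 2) beta (nsq u).
Proof.
rewrite /cauchy_covariance /cauchy -enorm_rvec; congr ((1 + _) `^ _).
rewrite -powR_mulrn ?enorm_ge0// -powRrM; congr powR.
by rewrite mulrC divfK.
Qed.

(** Each way of attaching S to C leads to the same limit: directly for a convergent Fourier
    integral, and through Gaussian averages and continuity at w for the two others. *)
Lemma spectral_density_heat_limit (alpha beta : R) C S :
  0 < alpha <= 2 -> 0 < beta -> (forall t, C t = cauchy_covariance alpha beta t) ->
  spectral_density C S ->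
  forall x : 'I_n -> R, 0 < vsq x ->
  heat_limit (cauchy (alpha / 2) beta) x ((2 * pi) ^+ n * S (\row_i x i)).
Proof.
move=> /andP[al0 al2] be0 CE HS x x0.
have cF : cmono (cauchy (alpha / 2) beta).
  apply: cmono_cauchy; last exact: ltW.
  by rewrite divr_gt0//= ler_pdivrMr// mul1r.
have CF u : C (rvec u) = cauchy (alpha / 2) beta (nsq u).
  by rewrite CE cauchy_covariance_rvec.
pose w : 'rV[R]_n := \row_i x i.
have wx : x = w 0 by apply/funext => i; rewrite mxE.
have w0 : w != 0.
  apply: contraTneq x0 => w0; rewrite wx vsq_enorm w0 enormE2 big1 ?ltxx//.
  by move=> i _; rewrite mxE expr0n.
rewrite {1}wx -/w; case: HS => [iC SE|_ cS SE|iS cS SE].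
- exact: (@heat_limit_integrable _ _ _ _ cF CF S w iC (SE w w0)).
- exact: gauss_pairing_limit (gauss_pairing_generalized cF CF SE) (cS w w0).
- have H := gauss_pairing_inversion CF iS SE; exact: (gauss_pairing_limit H (cS w w0)).
Qed.

Lemma sqrt_piX : Num.sqrt pi ^+ n = pi `^ (n%:R / 2) :> R.
Proof.
by rewrite -powR12_sqrt ?pi_ge0// -powR_mulrn ?powR_ge0// -powRrM mulrC.
Qed.

Lemma piX : pi ^+ n = pi `^ (n%:R / 2) * pi `^ (n%:R / 2) :> R.
Proof.
by rewrite -powRD ?lt0r_neq0 ?pi_gt0 ?implybT// -splitr powR_mulrn ?pi_ge0.
Qed.

End SpectralAsymptotics.

Theorem proposition3p3 (R : realType) (n : nat) (alpha beta : R)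
  (d : measure_display) (T : measurableType d) (P : probability T R)
  (X : 'rV[R]_n -> {RV P >-> R}) (S : 'rV[R]_n -> R)
  (hn : (1 <= n)%N)
  (halpha : 0 < alpha <= 2)
  (hbeta : 0 < beta)
  (hX : centered_stationary_gaussian_field X (cauchy_covariance alpha beta))
  (hS : field_spectral_density X S) :
  [/\ alpha * beta < n%:R ->
      asymptotic_at0 S (fun w =>
        enorm w `^ (alpha * beta - n%:R)
          / (2 `^ (alpha * beta) * pi `^ (n%:R / 2))
        * (Gamma ((n%:R - alpha * beta) / 2) / Gamma (alpha * beta / 2))),
      alpha * beta = n%:R ->
      asymptotic_at0 S (fun w =>
        1 / (2 ^+ n.-1 * pi `^ (n%:R / 2) * Gamma (n%:R / 2))
        * (ln (1 / enorm w)
           - beta / n%:R * (digamma beta + euler_gamma)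
           + ln 2 - 1 / 2 * euler_gamma + 1 / 2 * digamma (n%:R / 2)))
    & n%:R < alpha * beta ->
      asymptotic_at0 S (fun=>
        1 / (2 ^+ n.-1 * pi `^ (n%:R / 2) * Gamma (n%:R / 2))
        * (Gamma (n%:R / alpha) * Gamma (beta - n%:R / alpha)
           / (alpha * Gamma beta)))].
Proof.
have /andP[al0 al2] := halpha.
have a0 : 0 < alpha / 2 by rewrite divr_gt0.
have a1 : alpha / 2 <= 1 by rewrite ler_pdivrMr// mul1r.
have n_gt0 : 0 < n%:R :> R by rewrite ltr0n.
have n2_gt0 : 0 < n%:R / 2 :> R by rewrite divr_gt0.
have CE t : fine (covariance P (X t) (X 0)) = cauchy_covariance alpha beta t.
  by case: hX => _ -> _; rewrite subr0.
have HH := spectral_density_heat_limit halpha hbeta CE hS.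
have Ppi : 0 < pi `^ (n%:R / 2) :> R by rewrite powR_gt0// pi_gt0.
have K0 : (2 * pi) ^+ n != 0 :> R.
  by rewrite expf_neq0// lt0r_neq0// mulr_gt0// pi_gt0.
have G2 := Gamma_gt0 n2_gt0.
(* One factor 2 is split off because the stated constants involve 2^(n-1). *)
have KE : (2 * pi) ^+ n = 2 * 2 ^+ n.-1 * (pi `^ (n%:R / 2) * pi `^ (n%:R / 2)) :> R.
  by rewrite exprMn piX -exprS prednK.
have X0 : 0 < 2 ^+ n.-1 :> R by rewrite exprn_gt0.
split=> hab.
- have py : alpha / 2 * beta < n%:R / 2 by rewrite mulrAC ltr_pM2r ?invr_gt0.
  have pE : alpha / 2 * beta = alpha * beta / 2 by rewrite mulrAC.
  have p0 : 0 < alpha * beta / 2 by rewrite divr_gt0// mulr_gt0.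
  have := tauberian_cauchy_long_memory hn a0 a1 hbeta py HH.
  rewrite pE -mulrBl (_ : 2 * (alpha * beta / 2) = alpha * beta); last by rewrite mulrC divfK.
  have Gp := Gamma_gt0 p0.
  have yp : 0 < (n%:R - alpha * beta) / 2 by rewrite divr_gt0// subr_gt0.
  have Gq := Gamma_gt0 yp.
  (* The 1/4 comes from the exponent -1/(4 s) of the kernel; it accounts for the power 2^(n - alpha
     beta). *)
  have qE : (1 / 4) `^ (- ((n%:R - alpha * beta) / 2)) = 2 ^+ n / 2 `^ (alpha * beta) :> R.
    rewrite div1r -powR_inv1// -powRrM mulN1r opprK.
    rewrite (_ : 4 = 2 `^ 2%:R); last by rewrite powR_mulrn// -natrX.
    rewrite -powRrM mulrC divfK// powRB ?powR_mulrn//.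
    by rewrite pnatr_eq0 implybT.
  rewrite sqrt_piX qE.
  have q0 : 0 < 2 `^ (alpha * beta) :> R by rewrite powR_gt0.
  pose ell : R := pi `^ (n%:R / 2) * (2 ^+ n / 2 `^ (alpha * beta)
    * Gamma ((n%:R - alpha * beta) / 2)) / Gamma (alpha * beta / 2).
  rewrite -/ell => H.
  have ell0 : 0 < ell.
    rewrite /ell; move: (Gamma _) (Gamma _) Gp Gq => g1 g2 *.
    by rewrite divr_gt0 ?mulr_gt0 ?divr_gt0 ?exprn_gt0.
  apply: (asymptotic_at0_radial (N := fun r => r `^ (alpha * beta - n%:R))
    (g := fun r => ell * r `^ (alpha * beta - n%:R)) K0 (lt0r_neq0 ell0) _ H).
  + by move=> r /andP[r0 _]; rewrite powR_gt0.
  + rewrite -[X in _ --> X]mulr1; under eq_fun do rewrite -mulrA.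
    apply: cvgMl_tmp; apply: cvg_near_cst; near=> r.
    by rewrite divff// lt0r_neq0// powR_gt0//; near: r; exact: nbhs_right_gt.
  + move=> w _; rewrite exprMn piX /ell.
    move: (enorm w `^ _) (Gamma _) (Gamma _) (pi `^ _) (2 `^ _) Gp Gq Ppi q0.
    move=> z g1 g2 Pi q *; field.
    by rewrite !lt0r_neq0.
- have aby : alpha / 2 * beta = n%:R / 2 by rewrite mulrAC hab.
  have := tauberian_cauchy_critical hn a0 hbeta aby a1 HH.
  (* The factor 2 comes from ln(1/r^2) = -2 ln r, the time being proportional to r^2. *)
  pose ell : R := pi `^ (n%:R / 2) / Gamma (n%:R / 2) * 2.
  rewrite sqrt_piX -/ell => H.
  have ell0 : 0 < ell by rewrite /ell mulr_gt0// divr_gt0.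
  set k1 := beta / _ * _; set k2 := 1 / 2 * _; set k3 := 1 / 2 * _.
  apply: (asymptotic_at0_radial (N := fun r => - ln r)
    (g := fun r => ell * (- ln r + (- k1 + ln 2 - k2 + k3))) K0 (lt0r_neq0 ell0) _ H).
  + by move=> r r01; rewrite oppr_gt0 ln_lt0.
  + rewrite -[X in _ --> X]mulr1; under eq_fun do rewrite -mulrA.
    (* The bracket is -ln r plus a constant k. Divided by -ln r it is 1 + k/(-ln r), which tends to
       1. *)
    apply: cvgMl_tmp; move: (- k1 + _ - _ + _) => k.
    have Hk : 1 + k * (- ln r)^-1 @[r --> (0 : R)^'+] --> (1 : R).
      rewrite -[X in _ --> X](_ : 1 + k * 0 = 1); last by rewrite mulr0 addr0.
      by apply: cvgD; [exact: cvg_cst|apply: cvgMl_tmp; exact: cvg_inv_ln].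
    apply: cvg_trans Hk; apply: near_eq_cvg; near=> r.
    rewrite mulrDl divff// oppr_eq0 lt_eqF// ln_lt0//; apply/andP; split; near: r.
      exact: nbhs_right_gt.
    exact: nbhs_right_lt.
  + move=> w w0; rewrite KE /ell !div1r lnV ?posrE ?enorm_gt0//.
    move: (ln (enorm w)) (ln 2) k1 k2 k3 (Gamma _) (pi `^ _) (2 ^+ n.-1) G2 Ppi X0.
    by move=> l l2 k1 k2 k3 g Pi z g0 Pi0 z0; field; rewrite !lt0r_neq0.
- have aE : n%:R / (2 * (alpha / 2)) = n%:R / alpha by rewrite [2 * _]mulrC divfK.
  have nb : n%:R / (2 * (alpha / 2)) < beta by rewrite aE ltr_pdivrMr// mulrC.
  have := tauberian_cauchy_integrable hn (St := fun x => (2 * pi) ^+ n * S (\row_i x i)).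
  move=> /(_ (alpha / 2) beta); rewrite a0 a1 => /(_ isT nb HH).
  rewrite aE in nb *; have na0 : 0 < n%:R / alpha by rewrite divr_gt0.
  (* Gamma(x+1) = x Gamma(x) is used at n/alpha and at n/2; the quotient of these two numbers is the
     factor 2/alpha of the result. *)
  pose ell : R := n%:R / alpha * Gamma (n%:R / alpha) * Gamma (beta - n%:R / alpha) / Gamma beta
    * (pi `^ (n%:R / 2) / (n%:R / 2 * Gamma (n%:R / 2))).
  rewrite !Gamma_rec// sqrt_piX -/ell => H.
  have bn : 0 < beta - n%:R / alpha by rewrite subr_gt0.
  have Gna := Gamma_gt0 na0; have Gb := Gamma_gt0 hbeta; have Gbn := Gamma_gt0 bn.
  have ell0 : 0 < ell.
    rewrite /ell; move: (Gamma _) (Gamma _) (Gamma _) (Gamma _) Gna Gbn Gb G2.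
    by move=> g1 g2 g3 g4 *; rewrite !(mulr_gt0, invr_gt0).
  apply: (asymptotic_at0_radial (N := fun=> 1) (g := fun=> ell) K0 (lt0r_neq0 ell0) _ H) => //.
  + by rewrite divr1; exact: cvg_cst.
  + move=> w _; rewrite KE /ell.
    move: (Gamma _) (Gamma _) (Gamma _) (Gamma _) (pi `^ _) (2 ^+ n.-1) Gna Gbn Gb G2 Ppi X0.
    by move=> g1 g2 g3 g4 Pi z *; field; rewrite !lt0r_neq0.
Unshelve. all: by end_near. Qed.
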